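(* Let $\phi,\psi$ satisfy the wavelet condition (with constants $0<a'<a$) described in the context. Let $f_n(\cdot,j)$ be the wavelet deconvolution estimator, suppose that the error law $\varphi$ satisfies $|F[\varphi]|>0$ on $[-2^ja,2^ja]$, and assume that $X$ has a bounded density $f:\mathbb{R}\to[0,\infty)$. Then, for every $n\ge1$, every $j\in\mathbb{N}$ and every $z>0$, $$\Pr\Big\{\sup_{x\in\mathbb{R}}|f_n(x,j)-Ef_n(x,j)|\ge\sigma^R(n,j,z)\Big\}\le e^{-z}.$$ Moreover, the band $\bar C_n=[f_n(\cdot,j)-\sigma^R(n,j,z),\,f_n(\cdot,j)+\sigma^R(n,j,z)]$ has expected diameter $$2E\sigma^R(n,j,z)\le C\delta_j^{-1}\left(\sqrt{\frac{2^jj}{n}}+\frac{2^jj}{n}\right)$$ for every $z>0$, every $n\in\mathbb{N}$, every $j\ge1$ and some constant $C$ depending only on $\|g\|_\infty,\phi,\psi,z$.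
   Context: Fourier transform: $F[h](t)=\int h(x)e^{-itx}\,dx$ (extended to $L^2(\mathbb{R})$), $F^{-1}$ its inverse, and $F[\varphi](t)=\int e^{-itx}\,d\varphi(x)$. Model: $Y=X+\epsilon$, with $X$ having density $f$ and $\epsilon$ independent of $X$ with law $\varphi$ (a probability measure on $\mathbb{R}$), so $Y$ has density $g=f\ast\varphi$; $Y_1,\dots,Y_n$ are i.i.d. copies of $Y$. Wavelet condition: $\phi$ and $\psi$ are the (real-valued) scaling function and associated wavelet of an orthonormal multiresolution analysis of $L^2(\mathbb{R})$; $\phi,\psi\in L^p(\mathbb{R})$ for every $1\le p\le\infty$; for some $0<a'<a$, $\operatorname{supp}(F[\phi])\subset[-a,a]$ and $\operatorname{supp}(F[\psi])\subset[-a,a]\setminus[-a',a']$; and $c(\phi):=\sup_{x}\sum_{k\in\mathbb{Z}}|\phi(x-k)|<\infty$, $c(\psi):=\sup_{x}\sum_{k\in\mathbb{Z}}|\psi(x-k)|<\infty$. Estimator: with $\phi_{0k}(x)=\phi(x-k)$, $$\tilde\phi_{jk}=F^{-1}\left[\frac{F[\phi_{0k}](2^{-j}\cdot)}{2^j\,\overline{F[\varphi]}}\right],\quad K_j^*(x,y)=2^j\sum_{k\in\mathbb{Z}}\phi(2^jx-k)\tilde\phi_{jk}(y),\quad f_n(x,j)=\frac1n\sum_{m=1}^nK_j^*(x,Y_m).$$ Band width: $\delta_j=\min_{t\in[-2^ja,2^ja]}|F[\varphi](t)|$. Let $\varepsilon_1,\dots,\varepsilon_n$ be i.i.d. Rademacher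 variables ($\pm1$ with probability $1/2$ each), independent of the $Y_m$'s, and $$R_n(j)=\sup_{x\in\mathbb{R}}\left|\frac1n\sum_{m=1}^n\varepsilon_mK_j^*(x,Y_m)\right|,$$ $$\sigma^R(n,j,z)=6R_n(j)+\frac{D_1}{\delta_j}\sqrt{\frac{2^j\|g\|_\infty(z+\log2)}{n}}+\frac{D_2}{\delta_j}\frac{2^j(z+\log2)}{n},$$ where $D_1=10\,c(\phi)\|\phi\|_1\sqrt{a/\pi}$ and $D_2=44\,c(\phi)\sqrt{a/(2\pi^2)}$. *)

(* Defs.v *)
From HB Require Import structures.
From mathcomp Require Import all_boot all_order all_algebra.
From mathcomp Require Import all_classical all_reals all_analysis.
From mathcomp Require Import complex.

Set Implicit Arguments.
Unset Strict Implicit.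
Unset Printing Implicit Defensive.
Import Order.TTheory GRing.Theory Num.Theory.
Import numFieldNormedType.Exports.
Local Open Scope classical_set_scope.
Local Open Scope ring_scope.

Section Fourier.
Context {R : realType}.

Definition expi (t : R) : R[i] := (cos t +i* sin t)%C.


Definition cabs (z : R[i]) : R := ComplexField.Normc.normc z.

Definition cintegral d (T : measurableType d) (mu : {measure set T -> \bar R})
    (h : T -> R[i]) : R[i] :=
  ((\int[mu]_x complex.Re (h x))%R +i* (\int[mu]_x complex.Im (h x))%R)%C.

(* All the functions transformed below are integrable, so that the integral
   formulas for F and F^-1 agree with their extensions to L^2. *)
Definition fourier (h : R -> R[i]) (t : R) : R[i] :=
  cintegral lebesgue_measure (fun x => h x * expi (- (t * x))).

Definition inv_fourier (h : R -> R[i]) (x : R) : R[i] :=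
  (2 * pi)^-1%:C%C * cintegral lebesgue_measure (fun t => h t * expi (t * x)).

Definition fourier_law (nu : probability (measurableTypeR R) R) (t : R) : R[i] :=
  cintegral nu (fun x => expi (- (t * x))).

Definition fourier_real (h : R -> R) : R -> R[i] := fourier (fun x => (h x)%:C%C).

Definition supp (h : R -> R[i]) : set R := closure [set t | h t != 0].

End Fourier.

Section Wavelets.
Context {R : realType}.
Local Notation mu := (@lebesgue_measure R).

Definition dot2 (f g : R -> R) : R := (\int[mu]_x (f x * g x))%R.
Definition norm2 (f : R -> R) : \bar R := 'N[mu]_(2%:E)[EFin \o f].
Arguments norm2 f%_R.
Definition L2 : set (R -> R) := [set f | f \in Lfun mu 2%:E].

Definition span (u : int -> R -> R) : set (R -> R) :=
  [set h | exists (s : seq int) (c : int -> R),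
             h = (fun x => \sum_(k <- s) c k * u k x)].

(* Subsets of L^2 are sets of measurable functions; clause 4 makes a closed
   subspace stable under almost everywhere equality. *)
Definition closed_subspace (V : set (R -> R)) : Prop :=
  [/\ V `<=` L2, V (cst 0),
      (forall (c : R) f g, V f -> V g -> V (fun x => c * f x + g x)) &
      (forall f, L2 f ->
        (forall e : R, 0 < e -> exists2 h, V h & (norm2 (f \- h) < e%:E)%E) ->
        V f)].

Definition orthonormal_basis (u : int -> R -> R) (V : set (R -> R)) : Prop :=
  [/\ forall k, V (u k),
      (forall k l, dot2 (u k) (u l) = (k == l)%:R) &
      (forall f, V f -> forall e : R, 0 < e ->
        exists2 h, span u h & (norm2 (f \- h) < e%:E)%E)].

Definition translates (h : R -> R) (k : int) : R -> R := fun x => h (x - k%:~R).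

Definition multiresolution (V : int -> set (R -> R)) (phi : R -> R) : Prop :=
  (forall j, closed_subspace (V j)) /\
  (forall j, V j `<=` V (j + 1)) /\
  (forall j f, V j f <-> V (j + 1) (fun x => f (2 * x))) /\
  (forall f, (forall j, V j f) -> norm2 f = 0%E) /\
  (forall f, L2 f -> forall e : R, 0 < e ->
     exists j, exists2 h, V j h & (norm2 (f \- h) < e%:E)%E) /\
  orthonormal_basis (translates phi) (V 0).

Definition wavelet_space (V : int -> set (R -> R)) : set (R -> R) :=
  [set f | V 1 f /\ forall h, V 0 h -> dot2 f h = 0].

Definition scaling_wavelet_pair (phi psi : R -> R) : Prop :=
  exists V, multiresolution V phi /\
            orthonormal_basis (translates psi) (wavelet_space V).

Definition csum (h : R -> R) : \bar R :=
  ereal_sup (range (fun x => \esum_(k in [set: int]) `|h (x - k%:~R)|%:E)%E).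

Definition wavelet_condition (phi psi : R -> R) (a' a : R) : Prop :=
  scaling_wavelet_pair phi psi /\
  (forall p : \bar R, (1 <= p)%E -> phi \in Lfun mu p /\ psi \in Lfun mu p) /\
  (0 < a' /\ a' < a) /\
  supp (fourier_real phi) `<=` `[- a, a] /\
  supp (fourier_real psi) `<=` `[- a, a] `\` `[- a', a'] /\
  (csum phi < +oo)%E /\ (csum psi < +oo)%E.

End Wavelets.

Section Probability.
Context d (T : measurableType d) {R : realType} (P : probability T R).

(* The sets B i may be the full line, so every finite subfamily is covered. *)
Definition mutually_independent (I : finType) (Z : I -> {RV P >-> R}) : Prop :=
  forall B : I -> set R, (forall i, measurable (B i)) ->
    P (\bigcap_i (Z i @^-1` B i)) = (\prod_i P (Z i @^-1` B i))%E.

Definition independent (X Z : {RV P >-> R}) : Prop :=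
  forall A B : set R, measurable A -> measurable B ->
    P (X @^-1` A `&` Z @^-1` B) = (P (X @^-1` A) * P (Z @^-1` B))%E.

Definition has_density (X : {RV P >-> R}) (f : R -> R) : Prop :=
  [/\ measurable_fun setT f, (forall x, 0 <= f x) &
      forall A : set R, measurable A ->
        P (X @^-1` A) = (\int[lebesgue_measure]_(x in A) (f x)%:E)%E].

Definition has_law (X : {RV P >-> R})
    (nu : probability (measurableTypeR R) R) : Prop :=
  forall A : set R, measurable A -> P (X @^-1` A) = nu A.

Definition bounded_function (f : R -> R) : Prop :=
  exists M : R, forall x, `|f x| <= M.

Definition deconvolution_model (f : R -> R)
    (nu : probability (measurableTypeR R) R) (X e : {RV P >-> R}) : Prop :=
  [/\ has_density X f, bounded_function f, has_law e nu & independent X e].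

Definition iid_copies (n : nat) (Z : T -> R) (Y : 'I_n -> {RV P >-> R}) : Prop :=
  mutually_independent Y /\
  (forall m (A : set R), measurable A -> P (Y m @^-1` A) = P (Z @^-1` A)).

Definition joint_family (n : nat) (Y r : 'I_n -> {RV P >-> R}) (i : 'I_n + 'I_n) :
    {RV P >-> R} :=
  match i with inl m => Y m | inr m => r m end.

(* Given that the Y m are independent, independence of the 2n variables says
   that the r m are independent and that (r m)_m is independent of (Y m)_m. *)
Definition rademacher_multipliers (n : nat) (Y r : 'I_n -> {RV P >-> R}) : Prop :=
  (forall m, P (r m @^-1` [set 1]) = (2^-1)%:E /\
             P (r m @^-1` [set -1]) = (2^-1)%:E) /\
  mutually_independent (joint_family Y r).

End Probability.

Section Estimator.
Context {R : realType}.
Variables (phi : R -> R) (nu : probability (measurableTypeR R) R) (j : nat).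
Local Notation mu := (@lebesgue_measure R).

(* sum of an absolutely summable real family indexed by the integers *)
Definition zsum (u : int -> R) : R :=
  fine (\esum_(k in [set: int]) (EFin \o u)^\+ k
        - \esum_(k in [set: int]) (EFin \o u)^\- k)%E.

(* Outside the support of F[phi] the denominator may vanish; the quotient is
   then 0, by x / 0 = 0. *)
Definition phitilde (k : int) : R -> R[i] :=
  inv_fourier (fun t => fourier_real (translates phi k) (2 ^- j * t) /
                        ((2 ^+ j)%:C%C * (fourier_law nu t)^*%C)).

(* phitilde is real-valued (see Im_phitilde), so nothing is lost by Re *)
Definition Kstar (x y : R) : R :=
  2 ^+ j * zsum (fun k => phi (2 ^+ j * x - k%:~R) * complex.Re (phitilde k y)).

(* The infimum is a minimum: |F[nu]| is continuous on a compact interval. *)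
Definition delta (a : R) : R :=
  inf [set cabs (fourier_law nu t) | t in `[- (2 ^+ j * a), 2 ^+ j * a]].

Definition sup_norm (h : R -> R) : \bar R :=
  ereal_sup (range (fun x => `|h x|%:E)).

Definition diameter (A : set (R -> R)) : \bar R :=
  ereal_sup [set sup_norm (h.1 \- h.2) | h in A `*` A].

(* density of X + e when X has density f, e has law nu, and X, e are
   independent; only its essential supremum is used below *)
Definition convolution (f : R -> R) (y : R) : R := (\int[nu]_u f (y - u))%R.

Definition linfty_norm (g : R -> R) : R := fine ('N[mu]_(+oo)[EFin \o g])%E.

Definition D1 (a : R) : R :=
  10 * fine (csum phi) * fine 'N[mu]_1[EFin \o phi] * Num.sqrt (a / pi).

Definition D2 (a : R) : R :=
  44 * fine (csum phi) * Num.sqrt (a / (2 * pi ^+ 2)).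

Section Sample.
Context d (T : measurableType d) (P : probability T R).
Variables (n : nat) (Y r : 'I_n -> {RV P >-> R}).

Definition estimator (x : R) (w : T) : R :=
  n%:R^-1 * \sum_(m < n) Kstar x (Y m w).

Definition mean_estimator (x : R) : R := fine ('E_P[estimator x])%E.

Definition rademacher_sup (w : T) : \bar R :=
  sup_norm (fun x => n%:R^-1 * \sum_(m < n) r m w * Kstar x (Y m w)).

Definition sigmaR (f : R -> R) (a z : R) (w : T) : \bar R :=
  (6%:E * rademacher_sup w
   + (D1 a / delta a *
        Num.sqrt (2 ^+ j * linfty_norm (convolution f) * (z + ln 2) / n%:R))%:E
   + (D2 a / delta a * (2 ^+ j * (z + ln 2) / n%:R))%:E)%E.

Definition confidence_band (f : R -> R) (a z : R) (w : T) : set (R -> R) :=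
  [set h | forall x,
     ((estimator x w)%:E - sigmaR f a z w <= (h x)%:E)%E /\
     ((h x)%:E <= (estimator x w)%:E + sigmaR f a z w)%E].

End Sample.
End Estimator.

Section Reality.
Context {R : realType}.
Local Notation mu := (@lebesgue_measure R).
Import HBNNSimple.
Local Open Scope ereal_scope.

Let moppr : measurable_fun setT (-%R : R -> measurableTypeR R).
Proof. exact: measurable_realfun.oppr_measurable. Qed.

Let nnsfun_opp (h : {nnsfun (measurableTypeR R) >-> R}) :
  exists2 g : {nnsfun (measurableTypeR R) >-> R},
    (forall x, g x = h (- x)%R) & sintegral mu g = sintegral mu h.
Proof.
pose g0 : measurableTypeR R -> R := fun x => h (- x)%R.
have mg : measurable_fun setT g0.
  exact: (measurableT_comp (@measurable_funPT _ _ _ _ h) moppr).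
have fg : finite_set (range g0).
  apply: (@sub_finite_set _ _ (range h)); last exact: fimfunP.
  by move=> _ [x _ <-]; exists (- x)%R.
have pg x : (0 <= g0 x)%R by exact: fun_ge0.
pose M := isMeasurableFun.Build _ _ _ _ g0 mg.
pose F := FiniteImage.Build _ _ g0 fg.
pose N := isNonNegFun.Build _ _ g0 pg.
pose g : {nnsfun (measurableTypeR R) >-> R} := HB.pack g0 M F N.
exists g => //.
rewrite !sintegralE.
have -> : range g = range h.
  apply/seteqP; split => _ [x _ <-]; first by exists (- x)%R.
  by exists (- x)%R => //=; rewrite /g /= /g0 opprK.
apply: eq_fsbigr => r _; congr (_ * _).
have mhr : measurable (h @^-1` [set r] : set (measurableTypeR R)).
  exact: measurable_funPTI.
by have := lebesgue_measureN mhr.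
Qed.

Let ge0_integral_opp_le (f : R -> \bar R) : (forall x, 0 <= f x) ->
  \int[mu]_x f x <= \int[mu]_x f (- x)%R.
Proof.
move=> f0; rewrite !ge0_integralTE//.
apply: ge_ereal_sup => _ [h /= hf <-].
have [g gE <-] := nnsfun_opp h.
by apply: ereal_sup_ubound; exists g => //= x; rewrite gE.
Qed.

Let integral_opp (f : R -> \bar R) : \int[mu]_x f (- x)%R = \int[mu]_x f x.
Proof.
have ge0 (g : R -> \bar R) : (forall x, 0 <= g x) ->
    \int[mu]_x g (- x)%R = \int[mu]_x g x.
  move=> g0; apply/eqP; rewrite eq_le ge0_integral_opp_le// andbT.
  apply: le_trans (ge0_integral_opp_le (f := fun x => g (- x)%R) _) _ => //.
  by under eq_integral do rewrite opprK.
rewrite integralE [RHS]integralE.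
rewrite -(ge0 f^\+); last exact: funepos_ge0.
rewrite -(ge0 f^\-); last exact: funeneg_ge0.
by congr (_ - _); apply: eq_integral => x _; rewrite ?funepos.unlock ?funeneg.unlock.
Qed.

Local Close Scope ereal_scope.

Let Rintegral_opp (f : R -> R) : (\int[mu]_x f (- x))%R = (\int[mu]_x f x)%R.
Proof. by rewrite /Rintegral (integral_opp (EFin \o f)). Qed.

Let RintegralN d (T : measurableType d) (m : {measure set T -> \bar R})
  (f : T -> R) : (\int[m]_x - f x)%R = - (\int[m]_x f x)%R.
Proof.
rewrite /Rintegral integralE [in RHS]integralE.
have -> : (fun x => ((fun y => (- f y)%:E)^\+ x)%E) = (EFin \o f)^\-%E.
  by apply/funext => x; rewrite ?funepos.unlock ?funeneg.unlock.
have -> : (fun x => ((fun y => (- f y)%:E)^\- x)%E) = (EFin \o f)^\+%E.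
  by apply/funext => x; rewrite ?funepos.unlock ?funeneg.unlock /= opprK.
case: (integral _ _ _) => [r| |]; case: (integral _ _ _) => [s| |] //=;
  by rewrite ?oppr0 ?opprB.
Qed.

Let Rintegral_odd (f : R -> R) : (forall x, f (- x) = - f x) ->
  (\int[mu]_x f x)%R = 0.
Proof.
move=> fN; apply/eqP; rewrite -eqNr -RintegralN.
by under eq_fun do rewrite -fN; rewrite Rintegral_opp.
Qed.

Lemma Im_inv_fourier (h : R -> R[i]) (x : R) :
  (forall t, h (- t) = (h t)^*%C) -> complex.Im (inv_fourier h x) = 0.
Proof.
move=> hN; rewrite /inv_fourier /cintegral /= mul0r addr0 Rintegral_odd ?mulr0//.
move=> t; rewrite hN mulNr; case: (h t) => u v /=.
by rewrite cosN sinN mulrN mulNr opprD.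
Qed.

Let fourier_realN (h : R -> R) (t : R) :
  fourier_real h (- t) = (fourier_real h t)^*%C.
Proof.
rewrite /fourier_real /fourier /cintegral /=; congr (_ +i* _)%C.
  by congr (Rintegral _ _ _); apply/funext => x; rewrite /= mulNr !mul0r cosN.
rewrite -RintegralN; congr (Rintegral _ _ _); apply/funext => x.
by rewrite /= mulNr opprK !mul0r !addr0 sinN mulrN opprK.
Qed.

Let fourier_lawN (nu : probability (measurableTypeR R) R) (t : R) :
  fourier_law nu (- t) = (fourier_law nu t)^*%C.
Proof.
rewrite /fourier_law /cintegral /=; congr (_ +i* _)%C.
  by congr (Rintegral _ _ _); apply/funext => x; rewrite /= mulNr cosN.
rewrite -RintegralN; congr (Rintegral _ _ _); apply/funext => x.
by rewrite /= mulNr opprK sinN opprK.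
Qed.

Lemma Im_phitilde (phi : R -> R) (nu : probability (measurableTypeR R) R)
  (j : nat) (k : int) (y : R) : complex.Im (phitilde phi nu j k y) = 0.
Proof.
apply: Im_inv_fourier => t.
rewrite mulrN fourier_realN fourier_lawN.
move: (fourier_real _ _) (fourier_law _ _) => u v.
rewrite rmorphM; congr (_ * _); apply: etrans (esym (conjc_inv _)).
by congr _^-1; rewrite rmorphM; congr (_ * _); rewrite [RHS]conjc_real.
Qed.

End Reality.

(* Main.v *)
Require Import Defs.
From HB Require Import structures.
From mathcomp Require Import all_boot all_order all_algebra.
From mathcomp Require Import all_classical all_reals all_analysis.
From mathcomp Require Import measurable_realfun ess_sup_inf.
From mathcomp Require Import complex.
From mathcomp Require Import ring lra.

Set Implicit Arguments.
Unset Strict Implicit.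
Unset Printing Implicit Defensive.
Import Order.TTheory GRing.Theory Num.Theory.
Import numFieldNormedType.Exports.
Local Open Scope classical_set_scope.
Local Open Scope ring_scope.

(** Write K_x(y) for the kernel at the points x and y, kappa(x) for the mean of
    K_x(Y_m), and z' = z + ln 2.  Everything rests on three facts about the
    kernel, with delta the minimum of the modulus of F[nu] on the band: K_x is
    bounded by U = 2^j c(phi) sqrt(a/pi) / delta; the second moments of K_x(Y_m)
    are at most v, of order 2^j / delta^2; and the K_x form an l^1-bounded class,
    K_x = 2^j sum_k phi(2^j x - k) phitilde_k with coefficients of total mass at
    most c(phi).

    Deviation probability.  No concentration inequality for suprema is used.
    Fix a pattern of signs and split each sum over the observations into the
    part p(x) over the signs +1 and the part q(x) over the signs -1.  Then
    sum_m K_x(Y_m) = p + q while the Rademacher sum is p - q.  Suppose that, for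
    some x, |p + q - n kappa| exceeds 6 times the supremum of |p - q| by c.  Let
    x be instead a maximiser of |2p - n kappa|: it depends only on the
    observations of sign +1, and a triangle inequality gives
    |q - n kappa / 2| >= c/2 there.  Given the signs and the observations of
    sign +1, the index x is frozen and q is a sum of independent bounded
    variables, so an exponential moment bound for this single index suffices
    (deviation_probability).  The number of signs -1 is not n/2, but this only
    costs an average of exponentials of Rademacher sums.  The outcome is the
    probability e^(-z) for c = 10 sqrt(v n z') + 15 U z', and the constants D1
    and D2 dominate this c.  The selection needs a maximiser, hence a finite
    class; monotone limits extend the bound to a countable class
    (countable_deviation_probability), and separability of l^1 reduces the
    supremum over real x to a countable one (series_class_dense).  The same
    reduction shows that the events are measurable.

    Bounds on phitilde.  Up to the factor 1/(2 pi), phitilde_k is the translate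
    by 2^-j k of one band-limited integral eta, over the band of half-width
    Q = 2^j a.  Its energy on the frequency side is controlled by delta and by
    the Fourier transform of phi, whose square integral is at most 2 pi.  A
    finite form of Bessel's inequality bounds sums of eta^2 over arithmetic
    progressions (bessel).  Applied to all the translates phitilde_k it bounds
    sum_k phitilde_k(y)^2; folded over one period it gives Plancherel's
    inequality for eta (plancherel_osc), hence the second moments; and by
    duality it also gives the bound 2 pi on the square integral of F[phi]
    (fourier_energy_le).  The observations have a density bounded by
    G, the essential supremum of the convolution, so Lebesgue square
    integrals bound second moments (copy_expectation).

    Expected diameter.  The band has diameter twice sigma^R, so the Rademacher
    supremum has to be integrated.  It is at most
    2^j c(phi) sup_k |n^-1 sum_m eps_m phitilde_k(Y_m)|.  This supremum is over
    infinitely many k, but the variances of the phitilde_k(Y_m) have a finite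
    sum, about 2^j times their maximum.  A maximal inequality with the functions
    cosh - 1, whose expectations are proportional to these variances, therefore
    pays only the logarithm of 2^j, that is j (rademacher_sup_expectation). *)

(** * Integration through weighted image measures *)

Section Weighted.
Local Open Scope ereal_scope.
Import HBNNSimple.

(** Testing the image of the weighted measure on sets suffices: both sides are
    additive and continuous along increasing limits, and simple functions are
    dense. The weight is what lets one factor of a product of independent
    variables be replaced by a function while the other factors stay fixed. *)
Lemma ge0_integral_weight d1 d2 (X : measurableType d1) (Y : measurableType d2)
    (R : realType) (mu : {measure set X -> \bar R}) (nu : {measure set Y -> \bar R})
    (W : X -> R) (p : X -> Y) (c : R) :
  measurable_fun setT W -> (forall x, 0 <= W x)%R -> measurable_fun setT p ->
  (0 <= c)%R ->
  (forall B, measurable B -> \int[mu]_x (W x * \1_B (p x))%:E = c%:E * nu B) ->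
  forall g : Y -> R, measurable_fun setT g -> (forall y, 0 <= g y)%R ->
  \int[mu]_x (W x * g (p x))%:E = c%:E * \int[nu]_y (g y)%:E.
Proof.
move=> mW W0 mp c0 H g mg g0.
have mEg : measurable_fun setT (fun y => (g y)%:E) by exact/measurable_EFinP.
pose f_ := nnsfun_approx (@measurableT _ Y) mEg.
have mindic (B : set Y) : measurable B ->
    measurable_fun setT (fun x => \1_B (p x) : R).
  move=> mB; apply: measurableT_comp mp; exact: measurable_indic.
have Hn n : \int[mu]_x (W x * f_ n (p x))%:E = c%:E * \int[nu]_y (f_ n y)%:E.
  rewrite (eq_integral (fun x => \sum_(r \in range (f_ n))
      (r * (W x * \1_(f_ n @^-1` [set r]) (p x)))%:E)); last first.
    move=> x _; rewrite fimfunE mulr_fsumr fsumEFin//.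
    by congr EFin; apply: eq_fsbigr => r _; rewrite mulrCA.
  rewrite ge0_integral_fsum//; last 2 first.
  - move=> r; apply/measurable_EFinP; apply: measurable_funM => //.
    apply: measurable_funM => //.
    by apply: mindic; exact: measurable_funPTI.
  - by move=> r x _; rewrite lee_fin mulrCA mulr_ge0//; exact: nnfun_muleindic_ge0.
  rewrite [in RHS](eq_integral (fun y => \sum_(r \in range (f_ n))
      (r * \1_(f_ n @^-1` [set r]) y)%:E)); last first.
    by move=> y _; rewrite fimfunE fsumEFin.
  rewrite ge0_integral_fsum//; last 2 first.
  - by move=> r; apply/measurable_EFinP; apply: measurable_funM.
  - by move=> r x _; rewrite nnfun_muleindic_ge0.
  rewrite ge0_mule_fsumr; last first.
    by move=> r; apply: integral_ge0 => x _; rewrite nnfun_muleindic_ge0.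
  apply: eq_fsbigr => r; rewrite inE => -[y _ <-].
  have fy0 : (0 <= f_ n y)%R by [].
  under eq_integral do rewrite EFinM.
  rewrite ge0_integralZl_EFin//; last 2 first.
  - by move=> x _; rewrite lee_fin mulr_ge0// indic_ge0.
  - apply/measurable_EFinP; apply: measurable_funM => //.
    by apply: mindic; exact: measurable_funPTI.
  rewrite H; last exact: measurable_funPTI.
  under [in RHS]eq_integral do rewrite EFinM.
  rewrite ge0_integralZl_EFin//; last by exact/measurable_EFinP.
  rewrite integral_indic// setIT.
  by rewrite muleCA.
transitivity (limn (fun n => \int[mu]_x (W x * f_ n (p x))%:E)).
  rewrite -monotone_convergence//.
  - apply: eq_integral => x _; apply/esym/cvg_lim => //.
    rewrite EFinM; under eq_fun do rewrite EFinM.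
    apply: cvgeZl => //.
    by apply: (cvg_nnsfun_approx measurableT mEg) => // y _; rewrite lee_fin.
  - move=> n; apply/measurable_EFinP; apply: measurable_funM => //.
    by apply: measurableT_comp.
  - by move=> n x _; rewrite lee_fin mulr_ge0.
  - move=> x _ m n mn; rewrite lee_fin ler_wpM2l//.
    exact/lefP/nd_nnsfun_approx.
under eq_fun do rewrite Hn.
have nd : {homo (fun n => \int[nu]_y (f_ n y)%:E) : m n / (m <= n)%N >-> m <= n}.
  move=> m n mn; apply: ge0_le_integral => //.
  - by move=> y _; rewrite lee_fin.
  - exact/measurable_EFinP.
  - exact/measurable_EFinP.
  - by move=> y _; rewrite lee_fin; exact/lefP/nd_nnsfun_approx.
apply/cvg_lim => //; apply: cvgeZl => //.
rewrite (_ : \int[nu]_y _ = limn (fun n => \int[nu]_y (f_ n y)%:E)).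
  exact: ereal_nondecreasing_is_cvgn.
rewrite -monotone_convergence//.
- apply: eq_integral => y _; apply/esym/cvg_lim => //.
  by apply: (cvg_nnsfun_approx measurableT mEg) => // z _; rewrite lee_fin.
- by move=> n; exact/measurable_EFinP.
- by move=> n y _; rewrite lee_fin.
- by move=> y _ m n mn; rewrite lee_fin; exact/lefP/nd_nnsfun_approx.
Qed.

End Weighted.

(** * Independence of a sub-family from product events *)

Section Indep.
Context d (T : measurableType d) (R : realType) (P : probability T R).
Context (I : finType) (Z : I -> {RV P >-> R}).
Hypothesis indZ : mutually_independent Z.

(** A pi-system generating the sigma-algebra of the variables indexed by J: the
    coordinates outside J are left unconstrained. *)
Definition cylinders (J : pred I) : set (set T) :=
  [set A | exists B : I -> set R, [/\ forall i, measurable (B i),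
     forall i, ~~ J i -> B i = setT & A = \bigcap_i (Z i @^-1` B i)]].

Lemma measurable_cylinder (B : I -> set R) : (forall i, measurable (B i)) ->
  measurable (\bigcap_i (Z i @^-1` B i)).
Proof.
move=> mB; apply: fin_bigcap_measurable => //.
by move=> i _; exact: measurable_funPTI.
Qed.

(** Both sides are finite measures in A; they agree on the pi-system of
    cylinders, hence on the sigma-algebra that it generates. *)
Lemma indep_sigma (J : pred I) (A : set T) (B : I -> set R) :
  <<s cylinders J>> A -> (forall i, measurable (B i)) ->
  (forall i, J i -> B i = setT) ->
  P (A `&` \bigcap_i (Z i @^-1` B i)) = (P A * \prod_i P (Z i @^-1` B i))%E.
Proof.
move=> sA mB BJ.
pose C := \bigcap_i (Z i @^-1` B i).
have mC : measurable C by exact: measurable_cylinder.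
have PC : P C = (\prod_i P (Z i @^-1` B i))%E by exact: indZ.
have PCf : (P C \is a fin_num)%E by exact: fin_num_measure.
have c0 : 0 <= fine (P C) by exact: fine_ge0.
pose k : {nonneg R} := NngNum c0.
suff -> : P (A `&` C) = mscale k P A.
  by rewrite /mscale /= fineK// PC muleC.
rewrite -[LHS]/(mrestr P mC A).
apply: (@g_sigma_algebra_measure_unique _ R T (cylinders J) _ (fun=> setT)
  _ _ (mrestr P mC) (mscale k P) _ _ _ A sA).
- by move=> _ [B' [mB' _ ->]]; exact: measurable_cylinder.
- move=> _; exists (fun=> setT); split => //.
  by apply/seteqP; split.
- by rewrite bigcup_const//; exists 0%N.
- move=> _ _ [B1 [mB1 B1J ->]] [B2 [mB2 B2J ->]].
  exists (fun i => B1 i `&` B2 i); split => //.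
  + by move=> i; exact: measurableI.
  + by move=> i Ji; rewrite B1J// B2J// setIT.
  + by rewrite -bigcapI.
- move=> _ [B1 [mB1 B1J ->]].
  change (P ((\bigcap_i (Z i @^-1` B1 i)) `&` C) =
          k%:num%:E * P (\bigcap_i (Z i @^-1` B1 i)))%E.
  rewrite /= fineK// PC [in RHS]indZ// -bigcapI.
  rewrite (_ : (\bigcap_i _) = \bigcap_i (Z i @^-1` (B1 i `&` B i))); last first.
    by apply: eq_bigcapr => i _; rewrite preimage_setI.
  rewrite indZ; last by move=> i; exact: measurableI.
  rewrite muleC -big_split/=; apply: eq_bigr => i _.
  have [Ji|nJi] := boolP (J i).
    by rewrite BJ// setIT preimage_setT probability_setT mule1.
  by rewrite B1J// setTI preimage_setT probability_setT mul1e.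
- by move=> _; change (P (setT `&` C) < +oo)%E; rewrite setTI ltey_eq PCf.
Qed.

(** Starting from products of indicators, where this is the previous lemma, the
    factors are replaced one at a time: each replacement integrates one function
    against an image measure, all other factors acting as a weight. *)
Lemma indep_expectation (J : pred I) (A : set T) (h : I -> R -> R) (e : I -> R) :
  <<s cylinders J>> A ->
  (forall i, measurable_fun setT (h i)) -> (forall i y, 0 <= h i y) ->
  (forall i, J i -> h i = cst 1) ->
  (forall i, (\int[P]_w (h i (Z i w))%:E = (e i)%:E)%E) ->
  (\int[P]_w (\1_A w * \prod_i h i (Z i w))%:E = P A * (\prod_i e i)%:E)%E.
Proof.
move=> sA mh h0 hJ he.
have mA : measurable A.
  apply: (@smallest_sub _ _ (cylinders J)) sA; first exact: sigma_algebra_measurable.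
  by move=> _ [B' [mB' _ ->]]; exact: measurable_cylinder.
have PAf : (P A \is a fin_num)%E by exact: fin_num_measure.
suff H (s : seq I) : forall (h : I -> R -> R) (e : I -> R), (forall i, measurable_fun setT (h i)) ->
   (forall i (y : R), 0 <= h i y) -> (forall i, J i -> h i = cst 1) ->
   (forall i, (\int[P]_w (h i (Z i w))%:E = (e i)%:E)%E) ->
   (forall i, i \notin s -> exists2 B, measurable B & h i = \1_B) ->
  (\int[P]_w (\1_A w * \prod_i h i (Z i w))%:E = P A * (\prod_i e i)%:E)%E.
  by apply: (H (enum I)) => // i; rewrite mem_enum.
elim: s => [|k s IH] {}h {}e {}mh {}h0 {}hJ {}he hs.
  have /choice[B HB] : forall i, exists B, measurable B /\ h i = \1_B.
    by move=> i; have [B mB hB] := hs i isT; exists B.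
  have mB i : measurable (B i) by have [] := HB i.
  have hB i : h i = \1_(B i) by have [] := HB i.
  have BJ i : J i -> B i = setT.
    move=> Ji; apply/seteqP; split => // y _.
    have : h i y = 1 by rewrite hJ.
    rewrite hB indicE; case: (boolP (y \in B i)) => [/set_mem//|_] /eqP.
    by rewrite eq_sym oner_eq0.
  rewrite (eq_integral (EFin \o \1_(A `&` \bigcap_i (Z i @^-1` B i)))); last first.
    move=> w _ /=; rewrite indicI; congr (_ * _)%:E.
    rewrite indicE; case: (boolP (w \in _)) => [/set_mem H|/negP H].
      rewrite big1// => i _; rewrite hB indicE mem_set//; exact: H.
    apply/eqP; have [i Hi] : exists i, ~ B i (Z i w).
      apply/existsNP => H'; apply: H; apply/mem_set => i _; exact: H'.
    by apply/prodf_eq0; exists i => //; rewrite hB indicE memNset.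
  rewrite integral_indic//; last by apply: measurableI => //; exact: measurable_cylinder.
  rewrite setIT; transitivity (P (A `&` \bigcap_i (Z i @^-1` B i))); first by [].
  rewrite (indep_sigma sA)//; congr (_ * _)%E.
  rewrite -prodEFin; apply: eq_bigr => i _; rewrite -he hB.
  by rewrite -[in LHS](setIT (Z i @^-1` _)) -integral_indic//; exact: measurable_funPTI.
have [Jk|nJk] := boolP (J k).
  apply: IH => // i ni; have [->|ik] := eqVneq i k.
    by exists setT => //; rewrite hJ// indicT.
  by apply: hs; rewrite inE negb_or ik.
have e0 i : 0 <= e i.
  by rewrite -lee_fin -he; apply: integral_ge0 => w _; rewrite lee_fin.
pose W w := \1_A w * \prod_(i | i != k) h i (Z i w).
pose c := fine (P A) * \prod_(i | i != k) e i.
have mW : measurable_fun setT W.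
  apply: measurable_funM => //.
  under eq_fun do rewrite big_mkcond/=.
  apply: measurable_prod => i _; case: (i != k) => //.
  exact: measurableT_comp.
have W0 w : 0 <= W w by rewrite mulr_ge0 ?prodr_ge0.
have c0 : 0 <= c by rewrite mulr_ge0 ?prodr_ge0// fine_ge0.
have EW B : measurable B ->
    (\int[P]_w (W w * \1_B (Z k w))%:E = c%:E * distribution P (Z k) B)%E.
  move=> mB.
  pose h' i := if i == k then \1_B else h i.
  pose e' i := if i == k then fine (P (Z k @^-1` B)) else e i.
  have := IH h' e' _ _ _ _ _.
  under eq_integral => w _.
    rewrite (bigD1 k)//= {1}/h' eqxx mulrCA mulrC.
    under eq_bigr => i /negbTE ik do rewrite /h' ik.
    over.
  move=> ->.
  - rewrite (bigD1 k)//= {1}/e' eqxx /c EFinM EFinM fineK; last first.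
      by apply: fin_num_measure; exact: measurable_funPTI.
    rewrite fineK// (eq_bigr e); last by move=> i /negbTE ik; rewrite /e' ik.
    by rewrite muleA muleAC.
  - by move=> i; rewrite /h'; case: ifP.
  - by move=> i y; rewrite /h'; case: ifP.
  - move=> i Ji; rewrite /h'; case: ifP => [/eqP ik|_]; last exact: hJ.
    by move: nJk; rewrite -ik Ji.
  - move=> i; rewrite /h' /e'; case: ifP => [/eqP ->|_]; last exact: he.
    have mkB : measurable (Z k @^-1` B) by exact: measurable_funPTI.
    rewrite fineK; last exact: fin_num_measure.
    by rewrite -[in RHS](setIT (Z k @^-1` _)) -integral_indic.
  - move=> i ni; rewrite /h'; case: ifP => [_|/negbT ik]; first by exists B.
    by apply: hs; rewrite inE negb_or ik.
have := ge0_integral_weight mW W0 (measurable_funPT (Z k)) c0 EW (mh k) (h0 k).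
rewrite (ge0_integral_distribution (Z k)) ?he; last 2 first.
- exact/measurable_EFinP.
- by move=> y; rewrite lee_fin.
rewrite (eq_integral (fun w => (\1_A w * \prod_i h i (Z i w))%:E)); last first.
  by move=> w _; rewrite (bigD1 k)//= /W [in RHS]mulrCA [in RHS]mulrC.
by move=> ->; rewrite (bigD1 k)//= /c !EFinM fineK// -muleA; congr (_ * _)%E;
  rewrite muleC.
Qed.

End Indep.

(** * Exponential moments of bounded random variables *)

Section ExpBounds.
Context {R : realType}.

(** From e^(x/4) <= 1 / (1 - x/4), raised to the fourth power. The claim becomes
    (1 + x + x^2) (1 - x/4)^4 >= 1, whose difference is x^2 times a polynomial
    positive up to x = 3/4. *)
Lemma expR_le_quadratic (x : R) : x <= 3 / 4 -> expR x <= 1 + x + x ^+ 2.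
Proof.
move=> x34.
have q0 : 0 < 1 - x / 4 by lra.
have e1 : expR (x / 4) <= (1 - x / 4)^-1.
  rewrite -[leLHS]invrK lef_pV2 ?posrE ?invr_gt0 ?expR_gt0// -expRN.
  by apply: le_trans (expR_ge1Dx _); lra.
have -> : expR x = expR (x / 4) ^+ 4.
  by rewrite -expRM_natl; congr expR; field.
apply: (@le_trans _ _ ((1 - x / 4)^-1 ^+ 4)).
  by rewrite lerXn2r// nnegrE ?expR_ge0// invr_ge0 ltW.
rewrite exprVn -div1r ler_pdivrMr ?exprn_gt0//.
rewrite -subr_ge0 (_ : _ - 1 = x ^+ 2 *
  ((96 - 176 * x + 81 * x ^+ 2) + x ^+ 3 * (x - 15)) / 256); last by field.
rewrite -mulrA; apply: mulr_ge0; first exact: sqr_ge0.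
apply: divr_ge0; last exact: ler0n.
have x2 : 0 <= x ^+ 2 by exact: sqr_ge0.
have [x0|x0] := leP 0 x.
  have h1 : 0 <= (3 / 4 - x) * (3 / 2 - x) by apply: mulr_ge0; lra.
  have h2 : x ^+ 3 <= 9 / 16 * x.
    rewrite exprSr ler_wpM2r//.
    have -> : (9 / 16 = (3 / 4) ^+ 2 :> R) by field.
    by rewrite !expr2; apply: ler_pM; lra.
  have h3 : 0 <= x ^+ 3 * x by rewrite mulr_ge0// exprn_ge0.
  have -> : x ^+ 3 * (x - 15) = x ^+ 3 * x - 15 * x ^+ 3 by ring.
  have h4 : (3 / 4 - x) * (3 / 2 - x) = 9 / 8 - 9 / 4 * x + x ^+ 2 by field.
  by rewrite h4 in h1; lra.
have h1 : 0 <= x ^+ 2 * (x * (x - 15)).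
  by apply: mulr_ge0 => //; apply: mulr_le0; lra.
have -> : x ^+ 3 * (x - 15) = x ^+ 2 * (x * (x - 15)) by ring.
lra.
Qed.

Lemma expR_addN_le (x : R) : `|x| <= 3 / 4 ->
  expR x + expR (- x) <= 2 * expR (x ^+ 2).
Proof.
move=> x34.
have h1 := expR_le_quadratic (le_trans (ler_norm x) x34).
have h2 : expR (- x) <= 1 + - x + (- x) ^+ 2.
  by apply: expR_le_quadratic; rewrite (le_trans (ler_norm _))// normrN.
have h3 := expR_ge1Dx (x ^+ 2).
by rewrite sqrrN in h2; lra.
Qed.

End ExpBounds.

Section Mgf.
Context d (T : measurableType d) (R : realType) (P : probability T R).

Lemma bounded_integrable (X : T -> R) (M : R) : measurable_fun setT X ->
  (forall w, `|X w| <= M) -> P.-integrable setT (EFin \o X).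
Proof.
move=> mX XM; apply: (@le_integrable _ _ _ _ _ measurableT _ (EFin \o cst M)).
- exact/measurable_EFinP.
- move=> w _ /=; rewrite lee_fin (le_trans (XM w))//; exact: ler_norm.
- exact: finite_measure_integrable_cst.
Qed.

Lemma EFin_Rintegral (X : T -> R) : P.-integrable setT (EFin \o X) ->
  ((\int[P]_w X w)%R%:E = \int[P]_w (X w)%:E)%E.
Proof. by move=> iX; rewrite /Rintegral fineK//; exact: integrable_fin_num. Qed.

(** Bennett's argument: bounding the exponential by its quadratic majorant leaves
    only the variance, which is at most the second moment. *)
Lemma mgf_bound (X : T -> R) (U k s l : R) : measurable_fun setT X ->
  (forall w, `|X w| <= U) -> (\int[P]_w (X w)%:E = k%:E)%E ->
  (\int[P]_w (X w ^+ 2)%:E <= s%:E)%E -> `|l| * (2 * U) <= 3 / 4 ->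
  exists2 e, (\int[P]_w (expR (l * (X w - k)))%:E = e%:E)%E &
             0 <= e <= expR (l ^+ 2 * s).
Proof.
move=> mX XU Xk Xs lU.
have iX := bounded_integrable mX XU.
have mX2 : measurable_fun setT (fun w => X w ^+ 2) by exact: measurable_funX.
have iX2 : P.-integrable setT (EFin \o (fun w => X w ^+ 2)).
  apply: (@bounded_integrable _ (U ^+ 2)) => // w.
  by rewrite normrX lerXn2r// nnegrE ?(le_trans _ (XU w)).
have kU : `|k| <= U.
  have -> : k = (\int[P]_w X w)%R by rewrite /Rintegral Xk.
  apply: le_trans (le_normr_Rintegral _ _) _ => //.
  apply: (@le_trans _ _ (\int[P]_w (cst U w))%R).
    apply: le_Rintegral => //.
    - apply: (@bounded_integrable _ U); first exact: measurableT_comp.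
      by move=> w; rewrite normr_id.
    - exact: finite_measure_integrable_cst.
  by rewrite Rintegral_cst//= probability_setT mulr1.
pose Q w := (1 - l * k + l ^+ 2 * k ^+ 2) +
   ((l - 2 * l ^+ 2 * k) * X w + l ^+ 2 * X w ^+ 2).
have bl w : l * (X w - k) <= 3 / 4.
  rewrite (le_trans (ler_norm _))// normrM (le_trans _ lU)// ler_wpM2l//.
  by rewrite (le_trans (ler_normB _ _))// mulr2n mulrDl mul1r lerD.
have eQ w : expR (l * (X w - k)) <= Q w.
  by rewrite (le_trans (expR_le_quadratic (bl w)))// /Q; nra.
have mE : measurable_fun setT (fun w => expR (l * (X w - k))).
  apply: measurableT_comp => //; apply: measurable_funM => //.
  exact: measurable_funB.
have iE : P.-integrable setT (EFin \o (fun w => expR (l * (X w - k)))).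
  apply: (@bounded_integrable _ (expR (3 / 4))) => // w.
  by rewrite ger0_norm ?expR_ge0// ler_expR.
have i1 : P.-integrable setT (EFin \o (fun w => (l - 2 * l ^+ 2 * k) * X w)).
  exact: (integrableZl measurableT (l - 2 * l ^+ 2 * k) iX).
have i2 : P.-integrable setT (EFin \o (fun w => l ^+ 2 * X w ^+ 2)).
  exact: (integrableZl measurableT (l ^+ 2) iX2).
have i12 : P.-integrable setT (EFin \o (fun w =>
   (l - 2 * l ^+ 2 * k) * X w + l ^+ 2 * X w ^+ 2)).
  exact: (integrableD measurableT i1 i2).
have iQ : P.-integrable setT (EFin \o Q).
  exact: (integrableD measurableT (finite_measure_integrable_cst _ _ measurableT) i12).
exists (\int[P]_w expR (l * (X w - k)))%R; first by rewrite EFin_Rintegral.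
rewrite Rintegral_ge0; last by move=> w _; exact: expR_ge0.
apply: (@le_trans _ _ (\int[P]_w Q w)%R); first exact: le_Rintegral.
rewrite RintegralD//; last exact: finite_measure_integrable_cst.
rewrite Rintegral_cst//= probability_setT mulr1 RintegralD// !RintegralZl//.
have -> : (\int[P]_w X w)%R = k by rewrite /Rintegral Xk.
have sX2 : (\int[P]_w X w ^+ 2)%R <= s by rewrite -lee_fin EFin_Rintegral.
apply: le_trans (expR_ge1Dx _).
have : l ^+ 2 * (\int[P]_w X w ^+ 2)%R <= l ^+ 2 * s by rewrite ler_wpM2l// sqr_ge0.
set m2 := (\int[P]_w _)%R; nra.
Qed.

End Mgf.

(** * Decomposition along the patterns of signs *)

Section Patterns.
Context d (T : measurableType d) (R : realType) (P : probability T R).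
Context (n : nat) (Y r : 'I_n -> {RV P >-> R}).
Hypothesis hr : rademacher_multipliers Y r.

Definition bsign (b : bool) : R := if b then 1 else -1.

Definition pattern (e : {ffun 'I_n -> bool}) : set T :=
  [set w | forall m, r m w = bsign (e m)].

Lemma measurable_pattern e : measurable (pattern e).
Proof.
rewrite (_ : pattern e = \bigcap_m (r m @^-1` [set bsign (e m)])); last first.
  by apply/seteqP; split => w h m; have := h m; [|apply].
by apply: fin_bigcap_measurable => // m _; exact: measurable_funPTI.
Qed.

Lemma probability_sign m b : P (r m @^-1` [set bsign b]) = (2^-1)%:E.
Proof. by have [/(_ m)[h1 h2] _] := hr; case: b. Qed.

Lemma probability_pattern e : P (pattern e) = (2^-1 ^+ n)%:E.
Proof.
pose B (i : 'I_n + 'I_n) : set R :=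
  match i with inl _ => setT | inr m => [set bsign (e m)] end.
have mB i : measurable (B i) by case: i => m /=; [exact: measurableT|exact: measurable_set1].
have -> : pattern e = \bigcap_i (joint_family Y r i @^-1` B i).
  apply/seteqP; split => w h; last by move=> m; exact: (h (inr m) I).
  by case=> m _ /=; [exact: I|exact: h].
have [_ hi] := hr; rewrite hi// big_sumType/= big1 ?mul1e; last first.
  by move=> m _; rewrite preimage_setT probability_setT.
under eq_bigr do rewrite probability_sign.
by rewrite prodEFin prodr_const card_ord.
Qed.

(** The signs are prescribed only up to a null set, outside of which exactly one
    pattern occurs. *)
Lemma ae_sum_pattern :
  {ae P, forall w, (\sum_e \1_(pattern e) w : R) = 1}.
Proof.
have rpm m : {ae P, forall w, r m w = 1 \/ r m w = -1}.
  have m1 (x : R) : measurable (r m @^-1` [set x]) by exact: measurable_funPTI.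
  exists (~` (r m @^-1` [set 1] `|` r m @^-1` [set -1])); split.
  - by apply: measurableC; exact: measurableU.
  - rewrite probability_setC; last exact: measurableU.
    rewrite measureU//; last first.
      by apply/seteqP; split => // w [/= -> /eqP]; rewrite eq_sym eqNr oner_eq0.
    rewrite [X in (1 - (X + _)%R)%E](probability_sign m true).
    rewrite [X in (1 - (_ + X)%R)%E](probability_sign m false).
    have <- : 1%:E = ((2^-1)%:E + (2^-1)%:E)%E :> \bar R.
      by rewrite -EFinD; congr EFin; field.
    by rewrite subee.
  - by move=> w /= h1 h2; apply: h1.
have {rpm} : {ae P, forall w, forall m, r m w = 1 \/ r m w = -1}.
  exact: filter_forall.
apply: filterS => w rpm.
pose e0 : {ffun 'I_n -> bool} := [ffun m => r m w == 1].
have N11 : (-1 == 1 :> R) = false by apply/eqP; lra.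
have H m : r m w = bsign (e0 m).
  by rewrite ffunE /bsign; have [->|->] := rpm m; rewrite ?eqxx ?N11.
rewrite (bigD1 e0)//= big1 ?addr0; first by rewrite indicE mem_set.
move=> e ne; rewrite indicE memNset// => /= he.
move/eqP: ne; apply; apply/ffunP => m; rewrite ffunE he /bsign.
by case: (e m); rewrite ?eqxx ?N11.
Qed.

Lemma pattern_decomposition (W : T -> R) : measurable_fun setT W ->
  (forall w, 0 <= W w) ->
  (\int[P]_w (W w)%:E = \sum_e \int[P]_w (\1_(pattern e) w * W w)%:E)%E.
Proof.
move=> mW W0.
rewrite -ge0_integral_sum//; last 2 first.
- move=> e; apply/measurable_EFinP/measurable_funM => //.
  apply: measurable_indic; exact: measurable_pattern.
- by move=> e w _; rewrite lee_fin mulr_ge0.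
apply: ge0_ae_eq_integral => //.
- exact/measurable_EFinP.
- apply: emeasurable_sum => e; apply/measurable_EFinP/measurable_funM => //.
  apply: measurable_indic; exact: measurable_pattern.
- by move=> w _; rewrite lee_fin.
- by move=> w _; rewrite sumEFin lee_fin sumr_ge0// => e _; rewrite mulr_ge0.
- apply: filterS ae_sum_pattern => w h _.
  by rewrite sumEFin -mulr_suml h mul1r.
Qed.

End Patterns.

(** * Symmetrised deviations over a finite class *)

Lemma measurable_ler_set d (T : measurableType d) (R : realType) (f g : T -> R) :
  measurable_fun setT f -> measurable_fun setT g -> measurable [set w | f w <= g w].
Proof.
move=> mf mg; rewrite (_ : [set w | _] = setT `&` (fun w => f w <= g w) @^-1` [set true]).
  by apply: measurable_fun_ler.
by rewrite setTI.
Qed.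

Lemma measurable_ltr_set d (T : measurableType d) (R : realType) (f g : T -> R) :
  measurable_fun setT f -> measurable_fun setT g -> measurable [set w | f w < g w].
Proof.
move=> mf mg; rewrite (_ : [set w | _] = setT `&` (fun w => f w < g w) @^-1` [set true]).
  by apply: measurable_fun_ltr.
by rewrite setTI.
Qed.

Lemma measurable_sum_cond d (T : measurableType d) (R : realType) (I : finType)
    (p : pred I) (h : I -> T -> R) : (forall i, p i -> measurable_fun setT (h i)) ->
  measurable_fun setT (fun w => \sum_(i | p i) h i w).
Proof.
move=> mh; rewrite (_ : (fun w => _) =
    (fun w => \sum_i (if p i then h i w else 0))); last first.
  by apply/funext => w; rewrite big_mkcond.
apply: measurable_sum => i; case: (boolP (p i)) => [/mh//|_].
exact: measurable_cst.
Qed.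

(** The average over all patterns of a product of functions of single signs: the
    signs are independent. *)
Lemma sum_pattern_prod (R : realType) (n : nat) (x : 'I_n -> bool -> R) :
  \sum_(e : {ffun 'I_n -> bool}) 2^-1 ^+ n * \prod_m x m (e m) =
  \prod_m (2^-1 * (x m true + x m false)).
Proof.
under [RHS]eq_bigr => m _ do rewrite -(big_bool _ (fun b => x m b)) mulr_sumr.
rewrite bigA_distr_bigA/=; apply: eq_bigr => e _.
by rewrite big_split/= prodr_const card_ord.
Qed.

Lemma sum_pattern_exp (R : realType) (n : nat) (x : R) : `|x| <= 3 / 4 ->
  \sum_(e : {ffun 'I_n -> bool}) 2^-1 ^+ n * expR (\sum_m x * bsign R (e m)) <=
  expR (n%:R * x ^+ 2).
Proof.
move=> x34.
under eq_bigr do rewrite expR_sum.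
rewrite (sum_pattern_prod (fun (_ : 'I_n) b => expR (x * bsign R b))).
rewrite prodr_const card_ord expRM_natl.
rewrite lerXn2r ?nnegrE ?expR_ge0 ?mulr_ge0 ?addr_ge0 ?expR_ge0//.
rewrite /bsign mulr1 mulrN1.
by have := expR_addN_le x34; lra.
Qed.

Section FiniteClass.
Context d (T : measurableType d) (R : realType) (P : probability T R).
Context (n : nat) (Y r : 'I_n -> {RV P >-> R}).
Hypothesis hr : rademacher_multipliers Y r.
Context (N : nat) (F : 'I_N -> R -> R) (k : 'I_N -> R) (U v kb : R).
Hypothesis mF : forall i, measurable_fun setT (F i).
Hypothesis FU : forall i y, `|F i y| <= U.
Hypothesis Fk : forall i m, (\int[P]_w (F i (Y m w))%:E = (k i)%:E)%E.
Hypothesis Fv : forall i m, (\int[P]_w (F i (Y m w) ^+ 2)%:E <= v%:E)%E.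
Hypothesis kkb : forall i, `|k i| <= kb.

Let mFY i m : measurable_fun setT (fun w => F i (Y m w)).
Proof. exact: measurableT_comp. Qed.

(* Twice the sum over the signs +1, centred: a function of half of the
   observations, which is comparable with the full deviation as soon as the two
   half-sums are close to each other. *)
Let D (e : {ffun 'I_n -> bool}) i w :=
  `|2 * (\sum_(m | e m) F i (Y m w)) - n%:R * k i|.

(* The index i maximises D; ties go to the smallest index, so that the
   selection events of distinct indices are disjoint. *)
Let Sel e i := [set w | forall i', D e i' w <= D e i w /\
                          ((i' < i)%N -> D e i' w < D e i w)].

Let J (e : {ffun 'I_n -> bool}) (x : 'I_n + 'I_n) : bool :=
  match x with inl m => e m | inr _ => true end.

Let Z := joint_family Y r.

(* The selected index is a function of the observations of sign +1 only, hence
   independent of those of sign -1. *)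
Let sigma_Sel e i : <<s cylinders Z (J e)>> (pattern r e `&` Sel e i).
Proof.
pose T' := g_sigma_algebraType (cylinders Z (J e)).
have mY m : e m -> measurable_fun (setT : set T') (Y m : T' -> R).
  move=> em _ B mB; rewrite setTI; apply: sub_sigma_algebra.
  exists (fun x => if x == inl m then B else setT); split.
  - by move=> x; case: ifP.
  - by move=> x; case: ifP => // /eqP ->; rewrite /= em.
  - apply/seteqP; split => [w Bw x _|w /(_ (inl m) I)]; last by rewrite eqxx.
    by case: ifP => // /eqP ->.
have mD i' : measurable_fun (setT : set T') (D e i' : T' -> R).
  apply: measurableT_comp => //; apply: measurable_funB => //.
  apply: measurable_funM => //; apply: measurable_sum_cond => m em.
  by apply: measurableT_comp => //; exact: mY.
suff : measurable ((pattern r e `&` Sel e i) : set T') by [].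
apply: measurableI.
  apply: sub_sigma_algebra.
  exists (fun x => match x with inl _ => setT | inr m => [set bsign R (e m)] end); split.
  - by case=> m; [exact: measurableT|exact: measurable_set1].
  - by case.
  - apply/seteqP; split => w h; last by move=> m; exact: (h (inr m) I).
    by case=> m _ /=; [exact: I|exact: h].
rewrite (_ : Sel e i = \bigcap_i' [set w | D e i' w <= D e i w] `&`
    \bigcap_(i' in [set i' : 'I_N | (i' < i)%N]) [set w | D e i' w < D e i w]); last first.
  apply/seteqP; split => [w h|w [h1 h2] i'].
    by split => i' hi' /=; have [? ?] := h i' => //; auto.
  by split; [exact: (h1 i' I)|move=> ii'; exact: (h2 i' ii')].
apply: measurableI.
  apply: fin_bigcap_measurable => // i' _; exact: measurable_ler_set.
apply: fin_bigcap_measurable; first exact: finite_finset.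
by move=> i' _; exact: measurable_ltr_set.
Qed.

Let Sel_exists e w (i0 : 'I_N) : exists i, Sel e i w.
Proof.
pose p (i : 'I_N) := [forall i', D e i' w <= D e i w].
have pi1 : p [arg max_(i > i0) D e i w]%O.
  by case: arg_maxP => // i _ h; apply/forallP => i'; exact: h.
exists [arg min_(i < [arg max_(i > i0) D e i w]%O | p i) (i : nat)].
case: arg_minnP => // i pi hi i'; split; first by move/forallP : pi; apply.
move=> ii'; rewrite ltNge; apply/negP => h.
have /hi : p i'.
  by apply/forallP => i''; apply: le_trans h; move/forallP : pi; apply.
by rewrite leqNgt ii'.
Qed.

Let Sel_unique e w i i' : Sel e i w -> Sel e i' w -> i = i'.
Proof.
move=> h h'; apply/val_inj => /=; have [ii'|ii'|//] := ltngtP i i'.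
- by have [_ /(_ ii')] := h' i; have [+ _] := h i'; rewrite leNgt => /negbTE ->.
- by have [_ /(_ ii')] := h i'; have [+ _] := h' i; rewrite leNgt => /negbTE ->.
Qed.

Let dev i w := `|\sum_m F i (Y m w) - n%:R * k i|.
Let rad i w := `|\sum_m r m w * F i (Y m w)|.

Definition deviation_event (c : R) : set T :=
  [set w | exists i, forall i', 6 * rad i' w + c < dev i w].

Let mdev i : measurable_fun setT (dev i).
Proof.
apply: measurableT_comp => //; apply: measurable_funB => //.
by apply: measurable_sum => m; exact: mFY.
Qed.

Let mrad i : measurable_fun setT (rad i).
Proof.
apply: measurableT_comp => //; apply: measurable_sum => m.
by apply: measurable_funM => //; exact: mFY.
Qed.

Lemma measurable_deviation_event c : measurable (deviation_event c).
Proof.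
rewrite (_ : deviation_event c = \bigcup_i \bigcap_i'
    [set w | 6 * rad i' w + c < dev i w]); last first.
  apply/seteqP; split => w; first by move=> [i h]; exists i => // i' _; exact: h.
  by move=> [i _ h]; exists i => i'; exact: h.
apply: fin_bigcup_measurable => // i _; apply: fin_bigcap_measurable => // i' _.
apply: measurable_ltr_set => //; apply: measurable_funD => //.
exact: measurable_funM.
Qed.

(* With p and q the sums over the signs +1 and -1: the selected i has
   |2p - n k| at least its value at i0, which is within |p - q| of the deviation
   at i0, and |2p - n k| <= 2 |q - n k / 2| + 2 |p - q|. The factor 6 leaves room
   for these three terms. *)
Let dev_selected c e w : pattern r e w -> deviation_event c w ->
  exists2 i, Sel e i w & c / 2 <=
    `|\sum_(m | ~~ e m) F i (Y m w) - n%:R / 2 * k i|.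
Proof.
move=> he [i0 hi0]; have [i hi] := Sel_exists e w i0; exists i => //.
pose p i := \sum_(m | e m) F i (Y m w).
pose q i := \sum_(m | ~~ e m) F i (Y m w).
have devE i' : dev i' w = `|p i' + q i' - n%:R * k i'|.
  rewrite /dev (bigID (fun m => e m))/=; congr (`|_ + _ - _|).
have radE i' : rad i' w = `|p i' - q i'|.
  rewrite /rad (bigID (fun m => e m))/= -sumrN; congr (`|_ + _|).
    by apply: eq_bigr => m em; rewrite he /bsign em mul1r.
  by apply: eq_bigr => m em; rewrite he /bsign (negbTE em) mulN1r.
have := hi0 i; have := hi0 i0; have [+ _] := hi i0.
rewrite /D !devE !radE -/(p i) -/(q i) -/(p i0).
have -> : 2 * p i0 - n%:R * k i0 = (p i0 + q i0 - n%:R * k i0) + (p i0 - q i0).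
  by ring.
set A := p i0 + q i0 - _; set B0 := p i0 - q i0.
have -> : 2 * p i - n%:R * k i = 2 * (q i - n%:R / 2 * k i) + 2 * (p i - q i) by field.
set B := p i - q i; set G := q i - _.
move=> h1 h2 h3.
have h4 : `|A| <= `|A + B0| + `|B0|.
  by rewrite -[X in `|X| <= _](addrK B0) ler_normB.
have h5 : `|2 * G + 2 * B| <= 2 * `|G| + 2 * `|B|.
  by rewrite (le_trans (ler_normD _ _))// !normrM normr_nat.
have := normr_ge0 B; have := normr_ge0 B0.
by lra.
Qed.

Let h (e : {ffun 'I_n -> bool}) (l : R) i (x : 'I_n + 'I_n) : R -> R :=
  match x with
  | inl m => if e m then cst 1 else fun y => expR (l * (F i y - k i))
  | inr _ => cst 1
  end.

Let prodhE e l i w : \prod_x h e l i x (Z x w) =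
  expR (\sum_(m | ~~ e m) l * (F i (Y m w) - k i)).
Proof.
rewrite big_sumType/= [X in _ * X]big1 ?mulr1// expR_sum [RHS]big_mkcond/=.
by apply: eq_bigr => m _; case: (e m).
Qed.

Let int1 : (\int[P]_w (1 : R)%:E = 1%:E)%E.
Proof.
rewrite (_ : (fun w => _) = cst (1 : R)%:E)// integral_cst//=.
by rewrite probability_setT mule1.
Qed.

(* Only the observations of sign -1 contribute a factor; the others are replaced
   by 1, as the selection event already depends on them. *)
Let hmgf e (l : R) i : `|l| * (2 * U) <= 3 / 4 -> 0 <= v ->
  exists2 E : 'I_n + 'I_n -> R,
    (forall x, (\int[P]_w (h e l i x (Z x w))%:E = (E x)%:E)%E) &
    0 <= \prod_x E x <= expR (n%:R * (l ^+ 2 * v)).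
Proof.
move=> lU v0.
have HE m : exists E, (\int[P]_w (h e l i (inl m) (Y m w))%:E = E%:E)%E /\
    0 <= E <= expR (l ^+ 2 * v).
  rewrite /h; case: (e m).
    exists 1; split; first exact: int1.
    by rewrite ler01 -expR0 ler_expR mulr_ge0// sqr_ge0.
  have [E E1 E2] := mgf_bound (mFY i m) (fun w => FU i _) (Fk i m) (Fv i m) lU.
  by exists E.
have [E hE] := choice HE.
exists (fun x => match x with inl m => E m | inr _ => 1 end).
  case=> m; first by have [] := hE m.
  exact: int1.
rewrite big_sumType/= [X in _ * X]big1// mulr1.
rewrite prodr_ge0/=; last by move=> m _; have [_ /andP[]] := hE m.
rewrite (_ : expR _ = \prod_(m < n) expR (l ^+ 2 * v)); last first.
  by rewrite prodr_const card_ord expRM_natl.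
by apply: ler_prod => m _; have [_ ->] := hE m.
Qed.

Let m_pattern_Sel e i : measurable (pattern r e `&` Sel e i).
Proof.
have := @sigma_Sel e i; move: (_ `&` _) => B.
apply: (@smallest_sub _ _ (cylinders Z (J e)) (@measurable d T)).
  exact: sigma_algebra_measurable.
by move=> _ [B' [mB' _ ->]]; exact: measurable_cylinder.
Qed.

Let sum_Sel e : (\sum_i P (pattern r e `&` Sel e i) <= (2^-1 ^+ n)%:E)%E.
Proof.
have intP A : measurable A -> (P A = \int[P]_w (\1_A w)%:E)%E.
  by move=> mA; rewrite integral_indic// setIT.
rewrite -(probability_pattern hr e) intP; last exact: measurable_pattern.
under eq_bigr do rewrite intP//.
rewrite -ge0_integral_sum//; last first.
  by move=> i; apply/measurable_EFinP; exact: measurable_indic.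
apply: ge0_le_integral => //.
- by move=> w _; rewrite sumEFin lee_fin sumr_ge0.
- apply: emeasurable_sum => i; apply/measurable_EFinP; exact: measurable_indic.
- apply/measurable_EFinP; apply: measurable_indic; exact: measurable_pattern.
move=> w _; rewrite sumEFin lee_fin.
have [[i [wp wS]]|nS] := pselect (exists i, (pattern r e `&` Sel e i) w).
  rewrite (bigD1 i)//= big1 ?addr0.
    by rewrite !indicE !mem_set//; split.
  move=> i' ne; rewrite indicE memNset// => -[_ wS'].
  by move/eqP: ne; apply; exact: Sel_unique wS' wS.
rewrite big1// => i _; rewrite indicE memNset// => wS; apply: nS.
by exists i.
Qed.

(* Sum over the disjoint selection events; on each, Chebyshev's exponential
   inequality for q at one frozen index. Centring q by n k / 2 instead of its mean
   leaves a factor exp(l k (m - n/2)), with m the number of signs -1; it is kept as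
   the exponential of a sum of signs so that it can be averaged over the patterns. *)
Let pattern_bound (l c : R) e : 0 <= v -> 0 <= l -> l * (2 * U) <= 3 / 4 ->
  (\int[P]_w (\1_(pattern r e) w * \1_(deviation_event c) w)%:E <=
   (2 * expR (n%:R * (l ^+ 2 * v) - l * (c / 2)) *
     (2^-1 ^+ n * expR (\sum_m (l * kb / 2) * bsign R (e m)) +
      2^-1 ^+ n * expR (\sum_m (- (l * kb / 2)) * bsign R (e m))))%:E)%E.
Proof.
move=> v0 l0 lU.
pose L (s : bool) := l * bsign R s.
have LU s : `|L s| * (2 * U) <= 3 / 4.
  by rewrite /L normrM (ger0_norm l0) /bsign; case: s; rewrite ?normrN normr1 mulr1.
have L2 s : L s ^+ 2 = l ^+ 2 by rewrite /L /bsign; case: s; ring.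
pose q := \sum_m (1 / 2) * bsign R (e m).
have qE : (\sum_(m | ~~ e m) 1) - n%:R / 2 = - q.
  rewrite /q big_mkcond/= -[n%:R]mulr1 -[X in X%:R]card_ord mulr_natl -sumr_const.
  rewrite mulr_suml -sumrB -sumrN; apply: eq_bigr => m _.
  by rewrite /bsign; case: (e m) => /=; field.
pose t := 2^-1 ^+ n : R.
have t0 : 0 <= t by rewrite exprn_ge0// invr_ge0.
pose g := expR (\sum_m (l * kb / 2) * bsign R (e m)) +
      expR (\sum_m (- (l * kb / 2)) * bsign R (e m)).
have gE (s : bool) i : expR (L s * - q * k i) <= g.
  have sumE (x : R) : \sum_m (x / 2) * bsign R (e m) = x * q.
    by rewrite /q mulr_sumr; apply: eq_bigr => m _; field.
  rewrite /g -mulNr !sumE.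
  have : `|L s * - q * k i| <= `|l * kb * q|.
    rewrite !normrM normrN mulrAC ler_wpM2r//.
    have kb0 : 0 <= kb by exact: le_trans (kkb i).
    have -> : `|bsign R s| = 1 by rewrite /bsign; case: s; rewrite ?normrN normr1.
    by rewrite mulr1 (ger0_norm kb0) ler_wpM2l.
  move=> H; have {H} := le_trans (ler_norm _) H.
  have [x0|x0] := leP 0 (l * kb * q) => H.
    apply: (@le_trans _ _ (expR (l * kb * q))); last by rewrite lerDl expR_ge0.
    by rewrite ler_expR -[leRHS](ger0_norm x0).
  apply: (@le_trans _ _ (expR (- (l * kb) * q))); last by rewrite lerDr expR_ge0.
  by rewrite ler_expR mulNr -[leRHS](ltr0_norm x0).
pose th := expR (n%:R * (l ^+ 2 * v) - l * (c / 2)).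
pose wt s i := expR (L s * - q * k i - l * (c / 2)).
have step w : \1_(pattern r e) w * \1_(deviation_event c) w <=
   \sum_i \sum_(s : bool) wt s i *
     (\1_(pattern r e `&` Sel e i) w * \prod_x h e (L s) i x (Z x w)).
  have -> : \1_(pattern r e) w * \1_(deviation_event c) w =
      \1_(pattern r e `&` deviation_event c) w :> R by rewrite indicI.
  have S0 i : 0 <= \sum_(s : bool) wt s i *
     (\1_(pattern r e `&` Sel e i) w * \prod_x h e (L s) i x (Z x w)).
    apply: sumr_ge0 => s _; rewrite prodhE !mulr_ge0// ?expR_ge0//.
  have [[we wd]|] := pselect (pattern r e w /\ deviation_event c w); last first.
    by move=> nw; rewrite indicE memNset ?sumr_ge0.
  have [i wS dc] := dev_selected we wd.
  rewrite indicE mem_set; last by split.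
  rewrite (bigD1 i)//= -[leLHS]addr0 lerD ?sumr_ge0//.
  have -> : \1_(pattern r e `&` Sel e i) w = 1 :> R.
    by rewrite indicE mem_set//; split.
  pose G := \sum_(m | ~~ e m) F i (Y m w) - n%:R / 2 * k i.
  have GE s : wt s i * (1 * \prod_x h e (L s) i x (Z x w)) =
      expR (L s * G - l * (c / 2)).
    rewrite mul1r prodhE /wt -expRD; congr expR.
    rewrite -mulr_sumr sumrB /G.
    have -> : \sum_(m | ~~ e m) k i = (\sum_(m | ~~ e m) 1) * k i.
      by rewrite mulr_suml; apply: eq_bigr => m _; rewrite mul1r.
    by rewrite -qE; ring.
  under eq_bigr do rewrite GE.
  rewrite big_bool/= /L /bsign.
  have [G0|G0] := leP 0 G.
    rewrite -[leLHS]addr0 lerD ?expR_ge0// -[leLHS]expR0 ler_expR mulr1.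
    by rewrite -mulrBr mulr_ge0// subr_ge0 (le_trans dc)// ger0_norm.
  rewrite -[leLHS]add0r lerD ?expR_ge0// -[leLHS]expR0 ler_expR mulrN1 mulNr -mulrN.
  by rewrite -mulrBr mulr_ge0// subr_ge0 (le_trans dc)// ltr0_norm.
have mh s i x : measurable_fun setT (h e (L s) i x).
  case: x => m //=; case: (e m) => //; apply: measurableT_comp => //.
  by apply: measurable_funM => //; exact: measurable_funB.
have h0 s i x y : 0 <= h e (L s) i x y.
  by case: x => m //=; case: (e m); rewrite //= expR_ge0.
have mW s i : measurable_fun setT (fun w =>
   \1_(pattern r e `&` Sel e i) w * \prod_x h e (L s) i x (Z x w)).
  apply: measurable_funM; first exact: measurable_indic.
  by apply: measurable_prod => x _; exact: measurableT_comp.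
have W0 s i w : 0 <= wt s i *
    (\1_(pattern r e `&` Sel e i) w * \prod_x h e (L s) i x (Z x w)).
  by rewrite !mulr_ge0// ?expR_ge0// prodr_ge0.
apply: (@le_trans _ _ (\int[P]_w (\sum_i \sum_(s : bool) wt s i *
     (\1_(pattern r e `&` Sel e i) w * \prod_x h e (L s) i x (Z x w)))%:E)%E).
  apply: ge0_le_integral => //.
  - apply/measurable_EFinP; apply: measurable_funM; apply: measurable_indic.
      exact: measurable_pattern.
    exact: measurable_deviation_event.
  - apply/measurable_EFinP; apply: measurable_sum => i; apply: measurable_sum => s.
    exact: measurable_funM.
  - by move=> w _; rewrite lee_fin; exact: step.
under eq_integral do rewrite -sumEFin.
rewrite ge0_integral_sum//; last 2 first.
- move=> i; apply/measurable_EFinP; apply: measurable_sum => s.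
  exact: measurable_funM.
- by move=> i w _; rewrite lee_fin sumr_ge0.
apply: (@le_trans _ _ (\sum_i (2 * th * g)%:E * P (pattern r e `&` Sel e i))%E).
  apply: lee_sum => i _; under eq_integral do rewrite -sumEFin.
  rewrite ge0_integral_sum//; last 2 first.
  - by move=> s; apply/measurable_EFinP; exact: measurable_funM.
  - by move=> s w _; rewrite lee_fin.
  have bs s : (\int[P]_w (wt s i * (\1_(pattern r e `&` Sel e i) w *
       \prod_x h e (L s) i x (Z x w)))%:E <= (th * g)%:E * P (pattern r e `&` Sel e i))%E.
    under eq_integral do rewrite EFinM.
    rewrite ge0_integralZl_EFin//; last 3 first.
    - by move=> w _; rewrite lee_fin mulr_ge0// prodr_ge0.
    - exact/measurable_EFinP.
    - exact: expR_ge0.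
    have [E hE E1] := hmgf e i (LU s) v0.
    have hJ x : J e x -> h e (L s) i x = cst 1 by case: x => m //= ->.
    have := indep_expectation (proj2 hr) (@sigma_Sel e i) (mh s i) (h0 s i) hJ hE.
    rewrite /Z => ->; rewrite muleCA [leRHS]muleC lee_wpmul2l// -EFinM lee_fin.
    have /andP[E0 E2] := E1; rewrite L2 in E2.
    rewrite /wt /th !expRD.
    set x := expR (- (l * _)); set y := expR (L s * _ * _).
    have -> : y * x * \prod_x0 E x0 = x * (y * \prod_x0 E x0) by ring.
    have -> : expR (n%:R * (l ^+ 2 * v)) * x * g = x * (g * expR (n%:R * (l ^+ 2 * v))).
      by ring.
    by rewrite ler_wpM2l ?expR_ge0// ler_pM ?expR_ge0//; exact: gE.
  rewrite big_bool/=; apply: le_trans (leeD (bs _) (bs _)) _.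
  have /fineK <- : (P (pattern r e `&` Sel e i) \is a fin_num)%E.
    exact: fin_num_measure.
  by rewrite -!EFinM -EFinD lee_fin -subr_ge0 (_ : _ - _ = 0)//; ring.
rewrite -ge0_sume_distrr//.
apply: (@le_trans _ _ ((2 * th * g)%:E * t%:E)%E).
  by apply: lee_wpmul2l; [rewrite lee_fin !mulr_ge0// ?addr_ge0// ?expR_ge0|exact: sum_Sel].
rewrite -EFinM lee_fin -mulrDr -/g -/th -/t le_eqVlt; apply/orP; left.
by apply/eqP; ring.
Qed.

(** Averaging the bounds of the patterns: the last factor becomes
    cosh(l kb / 2)^n, at most exp(n l^2 kb^2 / 4), which is absorbed in the variance
    term by kb^2 <= v and accounts for the constant 5/4. *)
Lemma deviation_probability (l c : R) : 0 <= v -> 0 <= l ->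
  l * (2 * U) <= 3 / 4 -> 0 <= kb <= U -> kb ^+ 2 <= v ->
  (P (deviation_event c) <=
   (4 * expR (5 / 4 * (n%:R * (l ^+ 2 * v)) - l * (c / 2)))%:E)%E.
Proof.
move=> v0 l0 lU /andP[kb0 kbU] kbv.
rewrite (_ : P _ = \int[P]_w (\1_(deviation_event c) w)%:E)%E; last first.
  by rewrite integral_indic// ?setIT//; exact: measurable_deviation_event.
rewrite (pattern_decomposition hr)//; last first.
  by apply: measurable_indic; exact: measurable_deviation_event.
apply: le_trans (lee_sum _ (fun e _ => pattern_bound c e v0 l0 lU)) _.
rewrite sumEFin lee_fin -mulr_sumr big_split/=.
have x34 : `|l * kb / 2| <= 3 / 4.
  rewrite ger0_norm ?divr_ge0 ?mulr_ge0//.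
  have : l * kb <= l * U by rewrite ler_wpM2l.
  by rewrite mulrCA in lU; nra.
have x34' : `|- (l * kb / 2)| <= 3 / 4 by rewrite normrN.
have h1 := sum_pattern_exp n x34; have := sum_pattern_exp n x34'.
rewrite sqrrN => h2.
have h3 : n%:R * (l * kb / 2) ^+ 2 <= 1 / 4 * (n%:R * (l ^+ 2 * v)).
  have -> : n%:R * (l * kb / 2) ^+ 2 = 1 / 4 * (n%:R * (l ^+ 2 * kb ^+ 2)) :> R.
    by field.
  by rewrite ler_wpM2l// ?divr_ge0// ler_wpM2l// ler_wpM2l ?sqr_ge0.
rewrite -ler_expR in h3.
have -> : 5 / 4 * (n%:R * (l ^+ 2 * v)) - l * (c / 2) =
   (n%:R * (l ^+ 2 * v) - l * (c / 2)) + 1 / 4 * (n%:R * (l ^+ 2 * v)) by field.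
rewrite [in leRHS]expRD; have := expR_ge0 (n%:R * (l ^+ 2 * v) - l * (c / 2)).
set A := expR (_ - _) => A0.
have -> : 4 * (A * expR (1 / 4 * (n%:R * (l ^+ 2 * v)))) =
  2 * A * (expR (1 / 4 * (n%:R * (l ^+ 2 * v))) + expR (1 / 4 * (n%:R * (l ^+ 2 * v)))).
  by ring.
by apply: ler_wpM2l; [rewrite mulr_ge0|apply: lerD; [exact: le_trans h1 h3|exact: le_trans h2 h3]].
Qed.

End FiniteClass.

(** * Exponential moments of Rademacher sums *)

Section RademacherMgf.
Context d (T : measurableType d) (R : realType) (P : probability T R).
Context (n : nat) (Y r : 'I_n -> {RV P >-> R}).
Hypothesis hr : rademacher_multipliers Y r.
Context (h : R -> R) (u v : R).
Hypothesis mh : measurable_fun setT h.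
Hypothesis hu : forall y, `|h y| <= u.
Hypothesis hv : forall m, (\int[P]_w (h (Y m w) ^+ 2)%:E <= v%:E)%E.

Let mhY m : measurable_fun setT (fun w => h (Y m w)).
Proof. exact: measurableT_comp. Qed.

Let S w := \sum_m r m w * h (Y m w).

Let mS : measurable_fun setT S.
Proof. by apply: measurable_sum => m; exact: measurable_funM. Qed.

(** Conditionally on a pattern the factors are independent; averaging over the
    patterns symmetrises each factor, which kills the linear term. *)
Lemma rademacher_mgf (l : R) : `|l| * u <= 3 / 4 ->
  (\int[P]_w (expR (l * S w))%:E <= ((1 + l ^+ 2 * v) ^+ n)%:E)%E.
Proof.
move=> lu.
have lh y : `|l * h y| <= 3 / 4.
  by rewrite normrM (le_trans _ lu)// ler_wpM2l.
have mE b m : measurable_fun setT (fun w => expR (l * bsign R b * h (Y m w))).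
  by apply: measurableT_comp => //; exact: measurable_funM.
have iE b m : P.-integrable setT (EFin \o (fun w => expR (l * bsign R b * h (Y m w)))).
  apply: (@bounded_integrable _ _ _ _ _ (expR (3 / 4))) => // w.
  rewrite ger0_norm ?expR_ge0// ler_expR; apply: le_trans (ler_norm _) _.
  rewrite mulrAC normrM (_ : `|bsign R b| = 1) ?mulr1//.
  by rewrite /bsign; case: b; rewrite ?normrN normr1.
pose E m b := (\int[P]_w expR (l * bsign R b * h (Y m w)))%R.
have EE m b : (\int[P]_w (expR (l * bsign R b * h (Y m w)))%:E = (E m b)%:E)%E.
  by rewrite EFin_Rintegral.
have E0 m b : 0 <= E m b by apply: Rintegral_ge0 => w _; exact: expR_ge0.
have Esum m : E m true + E m false <= 2 * (1 + l ^+ 2 * v).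
  have mh2 : measurable_fun setT (fun w => h (Y m w) ^+ 2) by exact: measurable_funX.
  have ih2 : P.-integrable setT (EFin \o (fun w => h (Y m w) ^+ 2)).
    apply: (@bounded_integrable _ _ _ _ _ (u ^+ 2)) => // w.
    by rewrite normrX lerXn2r// nnegrE ?(le_trans _ (hu (Y m w))).
  have i2 : P.-integrable setT (EFin \o (fun w => (2 * l ^+ 2) * h (Y m w) ^+ 2)).
    exact: (integrableZl measurableT (2 * l ^+ 2) ih2).
  have i1 := @finite_measure_integrable_cst _ _ _ P setT (2 : R) measurableT.
  have h2v : (\int[P]_w h (Y m w) ^+ 2)%R <= v by rewrite -lee_fin EFin_Rintegral.
  rewrite /E -RintegralD//.
  apply: (@le_trans _ _ (\int[P]_w (cst 2 w + 2 * l ^+ 2 * h (Y m w) ^+ 2))%R).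
    apply: le_Rintegral => //.
    - exact: (integrableD measurableT (iE true m) (iE false m)).
    - exact: (integrableD measurableT i1 i2).
    move=> w _; rewrite /bsign mulr1 mulrN1 mulNr.
    have := expR_le_quadratic (le_trans (ler_norm _) (lh (Y m w))).
    have : - (l * h (Y m w)) <= 3 / 4.
      by rewrite (le_trans (ler_norm _))// normrN.
    move=> /expR_le_quadratic; rewrite sqrrN exprMn /=.
    by lra.
  rewrite RintegralD// Rintegral_cst//= probability_setT mulr1 RintegralZl//.
  have := ler_wpM2l (sqr_ge0 l) h2v.
  by lra.
rewrite (pattern_decomposition hr); last 2 first.
- by apply: measurableT_comp => //; exact: measurable_funM.
- by move=> w; exact: expR_ge0.
pose J (x : 'I_n + 'I_n) : bool := if x is inr _ then true else false.
have he e : (\int[P]_w (\1_(pattern r e) w * expR (l * S w))%:E =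
    (2^-1 ^+ n * \prod_m E m (e m))%:E)%E.
  pose H (x : 'I_n + 'I_n) : R -> R :=
    match x with inl m => fun y => expR (l * bsign R (e m) * h y) | inr _ => cst 1 end.
  pose E' (x : 'I_n + 'I_n) := match x with inl m => E m (e m) | inr _ => 1 end.
  have sA : <<s cylinders (joint_family Y r) J>> (pattern r e).
    apply: sub_sigma_algebra.
    exists (fun x => match x with inl _ => setT | inr m => [set bsign R (e m)] end); split.
    - by case=> m; [exact: measurableT|exact: measurable_set1].
    - by case.
    - apply/seteqP; split => w hw; last by move=> m; exact: (hw (inr m) I).
      by case=> m _ /=; [exact: I|exact: hw].
  have := @indep_expectation _ _ _ _ _ _ (proj2 hr) J _ H E' sA _ _ _ _.
  rewrite (probability_pattern hr) big_sumType/= [X in _ * X]big1// mulr1 -EFinM => <-.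
  - apply: eq_integral => w _; congr EFin.
    have [we|nwe] := pselect (pattern r e w); last by rewrite indicE memNset// !mul0r.
    have -> : l * S w = \sum_m l * bsign R (e m) * h (Y m w).
      by rewrite /S mulr_sumr; apply: eq_bigr => m _; rewrite we mulrA.
    by rewrite big_sumType/= expR_sum [X in _ * (_ * X)]big1// mulr1.
  - case=> m //=; apply: measurableT_comp => //; exact: measurable_funM.
  - by case=> m y //=; rewrite ?expR_ge0.
  - by case.
  - case=> m /=; first exact: EE.
    rewrite (_ : (fun w => _) = cst (1 : R)%:E)// integral_cst//=.
    by rewrite probability_setT mule1.
under eq_bigr do rewrite he.
rewrite sumEFin lee_fin (sum_pattern_prod E).
rewrite -[X in _ ^+ X]card_ord -prodr_const; apply: ler_prod => m _.
rewrite mulr_ge0 ?invr_ge0 ?addr_ge0//=.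
by have := Esum m; lra.
Qed.

(** The constant 2 is subtracted so that the bound is proportional to v when v is
    small: such bounds can be summed over infinitely many functions. *)
Lemma rademacher_cosh (l : R) : 0 <= v -> `|l| * u <= 3 / 4 ->
  (\int[P]_w (expR (l * S w) + expR (- (l * S w)) - 2)%:E <=
   (2 * ((1 + l ^+ 2 * v) ^+ n - 1))%:E)%E.
Proof.
move=> v0 lu.
have c0 (x : R) : 0 <= expR x + expR (- x) - 2.
  by have := expR_ge1Dx x; have := expR_ge1Dx (- x); lra.
have mE (b : R) : measurable_fun setT (fun w => expR (b * S w)).
  by apply: measurableT_comp => //; exact: measurable_funM.
have mE' : measurable_fun setT (fun w => expR (- (l * S w))).
  by under eq_fun do rewrite -mulNr; exact: mE.
have mC : measurable_fun setT (fun w => expR (l * S w) + expR (- (l * S w)) - 2).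
  by apply: measurable_funB => //; exact: measurable_funD.
rewrite -(@leeD2rE _ 2%:E)//.
have -> : (\int[P]_w (expR (l * S w) + expR (- (l * S w)) - 2)%:E + 2%:E =
   \int[P]_w (expR (l * S w) + expR (- (l * S w)))%:E)%E.
  rewrite -[X in (_ + X)%E](_ : \int[P]_w (cst 2%:E w) = 2%:E)%E; last first.
    by rewrite integral_cst//= probability_setT mule1.
  have mC' : measurable_fun setT (fun w => (expR (l * S w) + expR (- (l * S w)) - 2)%:E).
    exact/measurable_EFinP.
  rewrite -(ge0_integralD P measurableT _ mC' _ (@measurable_cst _ _ _ _ _ 2%:E)).
  - by apply: eq_integral => w _; rewrite -EFinD subrK.
  - by move=> w _; rewrite lee_fin.
  - by move=> w _; rewrite lee_fin.
under eq_integral do rewrite EFinD.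
rewrite ge0_integralD//; try (by move=> w _; rewrite lee_fin expR_ge0);
  try exact/measurable_EFinP.
have h1 := rademacher_mgf lu.
have h2 : (\int[P]_w (expR (- (l * S w)))%:E <= ((1 + l ^+ 2 * v) ^+ n)%:E)%E.
  under eq_integral do rewrite -mulNr.
  by rewrite -(sqrrN l); apply: rademacher_mgf; rewrite normrN.
apply: le_trans (leeD h1 h2) _.
by rewrite -!EFinD lee_fin le_eqVlt; apply/orP; left; apply/eqP; ring.
Qed.

End RademacherMgf.

Lemma expr_sub1_le (R : realType) (x y : R) n : 0 <= x <= y ->
  (1 + x) ^+ n - 1 <= n%:R * x * expR (n%:R * y).
Proof.
move=> /andP[x0 xy].
have h k : (k <= n)%N -> (1 + x) ^+ k - 1 <= k%:R * x * expR (n%:R * y).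
  elim: k => [|k IH] kn; first by rewrite expr0 subrr !mul0r.
  rewrite exprS (_ : _ - 1 = ((1 + x) ^+ k - 1) + x * (1 + x) ^+ k); last by ring.
  rewrite -addn1 natrD !mulrDl mul1r lerD ?IH//; first exact: ltnW.
  rewrite ler_wpM2l// (@le_trans _ _ (expR x ^+ k))//.
    by rewrite lerXn2r ?nnegrE ?addr_ge0 ?expR_ge0 ?expR_ge1Dx.
  rewrite -expRM_natl ler_expR ler_pM// ?ler_nat 1?ltnW//.
exact: h.
Qed.

(** * Symmetrised deviations over a countable class *)

Section CountableClass.
Context d (T : measurableType d) (R : realType) (P : probability T R).

(** The square bound is Jensen's inequality, from (X - k)^2 >= 0. *)
Lemma mean_bounds (X : T -> R) (U k v : R) : measurable_fun setT X ->
  (forall w, `|X w| <= U) -> (\int[P]_w (X w)%:E = k%:E)%E ->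
  (\int[P]_w (X w ^+ 2)%:E <= v%:E)%E -> `|k| <= U /\ k ^+ 2 <= v.
Proof.
move=> mX XU Xk Xv.
have iX := bounded_integrable P mX XU.
have ek : (\int[P]_w X w)%R = k by rewrite /Rintegral Xk.
split.
  rewrite -ek; apply: le_trans (le_normr_Rintegral _ _) _ => //.
  apply: (@le_trans _ _ (\int[P]_w (cst U w))%R).
    apply: le_Rintegral => //.
    - apply: (@bounded_integrable _ _ _ _ _ U); first exact: measurableT_comp.
      by move=> w; rewrite normr_id.
    - exact: finite_measure_integrable_cst.
  by rewrite Rintegral_cst//= probability_setT mulr1.
have iX2 : P.-integrable setT (EFin \o (fun w => X w ^+ 2)).
  apply: (@bounded_integrable _ _ _ _ _ (U ^+ 2)); first exact: measurable_funX.
  by move=> w; rewrite normrX lerXn2r// nnegrE ?(le_trans _ (XU w)).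
have sv : (\int[P]_w X w ^+ 2)%R <= v by rewrite -lee_fin EFin_Rintegral.
apply: le_trans sv.
have i2 := integrableZl measurableT (2 * k) iX.
have ic := @finite_measure_integrable_cst _ _ _ P setT (- k ^+ 2) measurableT.
have i3 := integrableD measurableT i2 ic.
have : (\int[P]_w (2 * k * X w + - k ^+ 2) <= \int[P]_w X w ^+ 2)%R.
  apply: le_Rintegral => // w _.
  by have := sqr_ge0 (X w - k); rewrite sqrrB; lra.
rewrite RintegralD// RintegralZl// ek.
rewrite (_ : (\int[P]__ - k ^+ 2)%R = - k ^+ 2); last first.
  by rewrite Rintegral_cst//= probability_setT mulr1.
by lra.
Qed.

Context (n : nat) (Y r : 'I_n -> {RV P >-> R}).
Hypothesis hr : rademacher_multipliers Y r.
Context (F : nat -> R -> R) (k : nat -> R) (U v : R).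
Hypothesis mF : forall i, measurable_fun setT (F i).
Hypothesis FU : forall i y, `|F i y| <= U.
Hypothesis Fk : forall i m, (\int[P]_w (F i (Y m w))%:E = (k i)%:E)%E.
Hypothesis Fv : forall i m, (\int[P]_w (F i (Y m w) ^+ 2)%:E <= v%:E)%E.
Hypothesis n0 : (0 < n)%N.
Hypothesis U0 : 0 < U.

Let dev i w := `|\sum_m F i (Y m w) - n%:R * k i|.
Let rad i w := `|\sum_m r m w * F i (Y m w)|.

Let mFY i m : measurable_fun setT (fun w => F i (Y m w)).
Proof. exact: measurableT_comp. Qed.

Let v0 : 0 <= v.
Proof.
rewrite -lee_fin; apply: le_trans (Fv 0%N (Ordinal n0)).
by apply: integral_ge0 => w _; rewrite lee_fin sqr_ge0.
Qed.

(** The inner quantifier stands for the supremum of the Rademacher sums, the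
    strict inequality for the deviation exceeding it by c at some index. *)
Definition countable_deviation_event (c : R) : set T :=
  [set w | exists i, forall i', 6 * rad i' w + c < dev i w].

Let mdev i : measurable_fun setT (dev i).
Proof.
apply: measurableT_comp => //; apply: measurable_funB => //.
by apply: measurable_sum => m; exact: mFY.
Qed.

Let mrad i : measurable_fun setT (rad i).
Proof.
apply: measurableT_comp => //; apply: measurable_sum => m.
by apply: measurable_funM => //; exact: mFY.
Qed.

(* The deviation is attained among the first N indices, but the Rademacher sums
   range over all of them: the events increase with N, and each is contained in
   the event of the finite class of the first N functions. *)
Let A c N : set T := \bigcup_(i in [set i | (i < N)%N])
  \bigcap_i' [set w | 6 * rad i' w + c < dev i w].

Let mA c N : measurable (A c N).
Proof.
apply: bigcup_measurable => i _; apply: bigcap_measurableType => i' _.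
apply: measurable_ltr_set => //; apply: measurable_funD => //.
exact: measurable_funM.
Qed.

Let AE c : countable_deviation_event c = \bigcup_N A c N.
Proof.
apply/seteqP; split => w.
  by move=> [i h]; exists i.+1 => //; exists i => //= i' _; exact: h.
by move=> [N _ [i _ h]]; exists i => i'; exact: h.
Qed.

Lemma measurable_countable_deviation_event c :
  measurable (countable_deviation_event c).
Proof. by rewrite AE; exact: bigcup_measurable. Qed.

Let finite_bound (l c : R) N : 0 <= l -> l * (2 * U) <= 3 / 4 ->
  (P (A c N) <= (4 * expR (5 / 4 * (n%:R * (l ^+ 2 * v)) - l * (c / 2)))%:E)%E.
Proof.
move=> l0 lU.
pose kb := Num.min U (Num.sqrt v).
have hk i : `|k i| <= kb.
  have [h1 h2] := mean_bounds (mFY i (Ordinal n0)) (fun w => FU i _)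
    (Fk i (Ordinal n0)) (Fv i (Ordinal n0)).
  by rewrite /kb le_min h1 -sqrtr_sqr ler_wsqrtr.
have kb0 : 0 <= kb <= U.
  by rewrite /kb le_min sqrtr_ge0 (ltW U0) ge_min lexx.
have kbv : kb ^+ 2 <= v.
  rewrite -(sqr_sqrtr v0) lerXn2r ?nnegrE ?sqrtr_ge0//; first by case/andP: kb0.
  by rewrite /kb ge_min lexx orbT.
apply: le_trans (deviation_probability hr (F := fun i : 'I_N => F i)
  (k := fun i : 'I_N => k i) (fun i => mF i) (fun i => FU i) (fun i => Fk i) (fun i => Fv i)
  (fun i => hk i) c v0 l0 lU kb0 kbv).
apply: le_measure; rewrite ?inE//; first exact: measurable_deviation_event.
by move=> w [i /= iN h]; exists (Ordinal iN) => i'; exact: h.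
Qed.

(** The exponent 5/4 n l^2 v - l c / 2 is made at most -2z: by l = sqrt(z / (n v))
    when the range condition 2 l U <= 3/4 allows it, and otherwise by the largest
    allowed l, for which the linear term of c takes over. *)
Lemma countable_deviation_probability (z : R) : ln 2 <= z ->
  (P (countable_deviation_event
        (10 * Num.sqrt v * Num.sqrt (n%:R * z) + 15 * U * z)) <=
   (expR (ln 2 - z))%:E)%E.
Proof.
move=> z2; set c := _ + _.
have ln2 : 0 < ln 2 :> R by rewrite ln_gt0// ltr1n.
have z0 : 0 < z by exact: lt_le_trans z2.
have nR0 : 0 < n%:R :> R by rewrite ltr0n.
pose s := Num.sqrt v; pose q := Num.sqrt (n%:R * z).
have s0 : 0 <= s by exact: sqrtr_ge0.
have q0 : 0 < q by rewrite sqrtr_gt0 mulr_gt0.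
have q2 : q ^+ 2 = n%:R * z by rewrite sqr_sqrtr// mulr_ge0 ?ltW.
have s2 : s ^+ 2 = v by rewrite sqr_sqrtr.
have [l [l0 lU lc]] : exists l, [/\ 0 <= l, l * (2 * U) <= 3 / 4 &
    5 / 4 * (n%:R * (l ^+ 2 * v)) - l * (c / 2) <= - (2 * z)].
  have [h|h] := leP (q * (8 * U)) (3 * s * n%:R).
    have s1 : 0 < s.
      rewrite lt_neqAle s0 andbT; apply/negP => /eqP s00.
      by move: h; rewrite -s00 mulr0 mul0r leNgt mulr_gt0// mulr_gt0.
    exists (q / (n%:R * s)); split.
    - by rewrite divr_ge0 ?mulr_ge0 ?ltW.
    - by rewrite mulrAC ler_pdivrMr ?mulr_gt0//; lra.
    - have -> : n%:R * ((q / (n%:R * s)) ^+ 2 * v) = z.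
        rewrite -s2 exprMn q2; field.
        by rewrite !gt_eqF.
      have : 5 * z <= q / (n%:R * s) * (c / 2).
        apply: (@le_trans _ _ (q / (n%:R * s) * (10 * s * q / 2))).
          rewrite (_ : _ * _ / 2 = 5 * (s * q)); last by field.
          rewrite (_ : _ / _ * _ = 5 * (q ^+ 2 / n%:R)); last first.
            by field; rewrite !gt_eqF.
          by rewrite q2 mulrAC mulfV ?gt_eqF// mul1r.
        apply: ler_wpM2l; first by rewrite divr_ge0 ?mulr_ge0 ?ltW.
        rewrite ler_wpM2r ?invr_ge0//.
        by rewrite /c lerDl !mulr_ge0// ltW.
      by lra.
  exists (3 / (8 * U)); split.
  - by rewrite divr_ge0// mulr_ge0 ?ltW.
  - by rewrite le_eqVlt; apply/orP; left; apply/eqP; field; rewrite gt_eqF.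
  - have lsq : n%:R * ((3 / (8 * U)) ^+ 2 * v) <= 3 / (8 * U) * (s * q).
      have -> : n%:R * ((3 / (8 * U)) ^+ 2 * v) =
          3 / (8 * U) * (s * (3 * s * n%:R / (8 * U))).
        by rewrite -s2; field; rewrite gt_eqF.
      apply: ler_wpM2l; first by rewrite divr_ge0 ?mulr_ge0 ?ltW.
      rewrite ler_wpM2l//.
      by rewrite ler_pdivrMr ?mulr_gt0// ltW.
    have -> : 3 / (8 * U) * (c / 2) = 5 * (3 / (8 * U) * (s * q)) + 45 / 16 * z.
      by rewrite /c -/s -/q; field; rewrite gt_eqF.
    have : 0 <= 3 / (8 * U) * (s * q).
      by apply: mulr_ge0; [rewrite divr_ge0// mulr_ge0// ltW|rewrite mulr_ge0// ltW].
    by lra.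
(* The factor 4 costs 2 ln 2, of which z >= ln 2 pays one half. *)
have bound : 4 * expR (5 / 4 * (n%:R * (l ^+ 2 * v)) - l * (c / 2)) <= expR (ln 2 - z).
  have e4 : 4 = expR (ln 2) * expR (ln 2) :> R.
    by rewrite lnK ?posrE//; ring.
  by rewrite {1}e4 -!expRD ler_expR; lra.
rewrite AE.
have cv : P (A c N) @[N --> \oo] --> P (\bigcup_N A c N).
  apply: nondecreasing_cvg_mu => //; first exact: bigcup_measurable.
  move=> N N' NN'; apply/subsetPset => w [i iN h]; exists i => //.
  exact: leq_trans iN NN'.
rewrite -(cvg_lim _ cv)//; apply: lime_le.
  by apply/cvg_ex; eexists; exact: cv.
apply: nearW => N; apply: le_trans (finite_bound c N l0 lU) _.
by rewrite lee_fin.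
Qed.

End CountableClass.

(** * Expected supremum of a Rademacher process *)

Section ExpectedSup.
Context d (T : measurableType d) (R : realType) (P : probability T R).
Context (n : nat) (Y r : 'I_n -> {RV P >-> R}).
Hypothesis hr : rademacher_multipliers Y r.
Context (h : nat -> R -> R) (u v V : R) (om : nat -> R).
Hypothesis mh : forall i, measurable_fun setT (h i).
Hypothesis hu : forall i y, `|h i y| <= u.
Hypothesis hom : forall i m, (\int[P]_w (h i (Y m w) ^+ 2)%:E <= (om i)%:E)%E.
Hypothesis omv : forall i, 0 <= om i <= v.
Hypothesis omV : forall N, \sum_(i < N) om i <= V.

Let S i w := \sum_m r m w * h i (Y m w).

Let mS i : measurable_fun setT (S i).
Proof.
apply: measurable_sum => m; apply: measurable_funM => //.
exact: measurableT_comp.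
Qed.

Lemma measurable_rademacher_sup : measurable_fun setT
  (fun w => ereal_sup (range (fun i => (`|S i w|)%:E))).
Proof.
rewrite (_ : (fun w => _) = (fun w => ereal_sup [set (`|S i w|)%:E | i in
    [set i | (0 <= i)%N]])).
  apply: (measurable_fun_esups (f := fun i w => (`|S i w|)%:E)) => i.
  by apply/measurable_EFinP; exact: measurableT_comp.
apply/funext => w; congr ereal_sup.
by apply/seteqP; split => x [i _ <-]; exists i.
Qed.

(** For every threshold t, l |s| <= t - 1 + e^(-t) e^(l |s|), by convexity of the
    exponential; the supremum of e^(l |s_i|) is bounded by 2 plus the sum of the
    functions 2 cosh(l s_i) - 2. A supremum over infinitely many i is controlled
    because only the sum V of the variances enters, and it is weighted by e^(-t). *)
Lemma rademacher_sup_expectation (l t : R) : 0 < l -> l * u <= 3 / 4 -> 1 <= t ->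
  (\int[P]_w ereal_sup (range (fun i => (`|S i w|)%:E)) <=
   (l^-1 * (t - 1 + expR (- t) *
     (2 + 2 * (n%:R * l ^+ 2 * V * expR (n%:R * (l ^+ 2 * v))))))%:E)%E.
Proof.
move=> l0 lu t1.
pose C i w := expR (l * S i w) + expR (- (l * S i w)) - 2.
have C0 i w : 0 <= C i w.
  by have := expR_ge1Dx (l * S i w); have := expR_ge1Dx (- (l * S i w)); rewrite /C; lra.
have mC i : measurable_fun setT (C i).
  apply: measurable_funB => //; apply: measurable_funD; apply: measurableT_comp => //.
    exact: measurable_funM.
  by apply: measurableT_comp => //; exact: measurable_funM.
pose K1 := l^-1 * (t - 1 + 2 * expR (- t)); pose K2 := l^-1 * expR (- t).
have K10 : 0 <= K1.
  by rewrite mulr_ge0 ?invr_ge0 ?(ltW l0)// addr_ge0 ?subr_ge0// mulr_ge0// expR_ge0.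
have K20 : 0 <= K2 by rewrite mulr_ge0 ?invr_ge0 ?(ltW l0)// expR_ge0.
pose B N w := K1 + K2 * \sum_(i < N) C i w.
have B0 N w : 0 <= B N w by rewrite addr_ge0// mulr_ge0// sumr_ge0.
have mB N : measurable_fun setT (B N).
  by apply: measurable_funD => //; apply: measurable_funM => //; exact: measurable_sum.
have ndB w : {homo (fun N => (B N w)%:E) : N M / (N <= M)%N >-> (N <= M)%E}.
  move=> N M NM; rewrite lee_fin lerD2l ler_wpM2l//.
  rewrite -(subnKC NM) big_split_ord/= lerDl sumr_ge0//.
have SB i w : `|S i w| <= B i.+1 w.
  have h1 : C i w <= \sum_(i' < i.+1) C i' w.
    by rewrite big_ord_recr/= lerDr sumr_ge0.
  have h2 : expR (l * `|S i w|) <= C i w + 2.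
    rewrite /C subrK; have [s0|s0] := leP 0 (S i w).
      by rewrite ger0_norm// lerDl expR_ge0.
    by rewrite ltr0_norm// mulrN lerDr expR_ge0.
  have h3 : l * `|S i w| <= t - 1 + expR (- t) * expR (l * `|S i w|).
    by rewrite -expRD; have := expR_ge1Dx (- t + l * `|S i w|); lra.
  rewrite -(ler_pM2l l0) (le_trans h3)//.
  have -> : l * B i.+1 w = t - 1 + expR (- t) * (\sum_(i' < i.+1) C i' w + 2).
    by rewrite /B /K1 /K2; field; rewrite gt_eqF.
  rewrite lerD2l ler_wpM2l ?expR_ge0// (le_trans h2)// lerD2r.
  exact: h1.
apply: (@le_trans _ _ (\int[P]_w limn (fun N => (B N w)%:E))%E).
  apply: ge0_le_integral => //.
  - move=> w _; apply: ereal_sup_ge; exists (`|S 0%N w|)%:E; first by exists 0%N.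
    by rewrite lee_fin.
  - exact: measurable_rademacher_sup.
  - apply: (@emeasurable_fun_cvg _ _ _ _ (fun N w => (B N w)%:E)) => //.
      by move=> N; exact/measurable_EFinP.
    by move=> w _; exact: ereal_nondecreasing_is_cvgn.
  - move=> w _; apply: ge_ereal_sup => _ [i _ <-].
    apply: (@le_trans _ _ (B i.+1 w)%:E); first by rewrite lee_fin.
    rewrite (cvg_lim _ (ereal_nondecreasing_cvgn (ndB w)))//.
    by apply: ereal_sup_ubound; exists i.+1.
rewrite monotone_convergence//; last 2 first.
- by move=> N; exact/measurable_EFinP.
- by move=> N w _; rewrite lee_fin.
apply: lime_le.
  apply: ereal_nondecreasing_is_cvgn => N M NM; apply: ge0_le_integral => //.
  - by move=> w _; rewrite lee_fin.
  - exact/measurable_EFinP.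
  - exact/measurable_EFinP.
  - by move=> w _; exact: ndB.
apply: nearW => N.
have -> : (\int[P]_w (B N w)%:E = K1%:E + K2%:E * \sum_(i < N) \int[P]_w (C i w)%:E)%E.
  rewrite -ge0_integral_sum//; last 2 first.
  - by move=> i; exact/measurable_EFinP.
  - by move=> i w _; rewrite lee_fin.
  rewrite -ge0_integralZl_EFin//; last 2 first.
  - by move=> w _; rewrite sumEFin lee_fin sumr_ge0.
  - by apply: emeasurable_sum => i; exact/measurable_EFinP.
  rewrite -[X in (X + _)%E](_ : (\int[P]_w cst K1%:E w)%E = _); last first.
    by rewrite integral_cst//= probability_setT mule1.
  rewrite -ge0_integralD//; last 2 first.
  - by move=> w _; rewrite sumEFin -EFinM lee_fin mulr_ge0// sumr_ge0.
  - apply: (eq_measurable_fun (fun w => (K2 * \sum_(i < N) C i w)%:E)).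
      by move=> w _; rewrite EFinM sumEFin.
    by apply/measurable_EFinP; apply: measurable_funM => //; exact: measurable_sum.
  by apply: eq_integral => w _; rewrite /B EFinD EFinM sumEFin.
have hC (i : 'I_N) : (\int[P]_w (C i w)%:E <=
    (2 * (n%:R * l ^+ 2 * expR (n%:R * (l ^+ 2 * v))) * om i)%:E)%E.
  have /andP[w0 wv] := omv i.
  have lu' : `|l| * u <= 3 / 4 by rewrite gtr0_norm.
  apply: le_trans (rademacher_cosh hr (mh i) (hu i) (hom i) w0 lu') _.
  rewrite lee_fin -mulrA ler_pM2l//.
  have := @expr_sub1_le R (l ^+ 2 * om i) (l ^+ 2 * v) n.
  rewrite mulr_ge0 ?sqr_ge0//= ler_wpM2l ?sqr_ge0// => /(_ isT) /le_trans; apply.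
  by rewrite le_eqVlt; apply/orP; left; apply/eqP; ring.
apply: (@le_trans _ _ (K1%:E + K2%:E * (2 * (n%:R * l ^+ 2 * expR (n%:R * (l ^+ 2 * v))) * V)%:E)%E).
  apply: leeD => //; apply: lee_wpmul2l; first by rewrite lee_fin.
  apply: le_trans (lee_sum _ (fun i _ => hC i)) _.
  rewrite sumEFin lee_fin -mulr_sumr ler_wpM2l//.
    apply: mulr_ge0 => //; apply: mulr_ge0; last exact: expR_ge0.
    by rewrite mulr_ge0 ?sqr_ge0.
  exact: omV.
rewrite -EFinM -EFinD lee_fin le_eqVlt; apply/orP; left; apply/eqP.
by rewrite /K1 /K2; ring.
Qed.

End ExpectedSup.

(** * A Bessel inequality for band-limited integrals *)

Lemma integrable_Rsum d (T : measurableType d) (R : realType)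
    (mu : {measure set T -> \bar R}) (D : set T) (I : Type) (s : seq I)
    (h : I -> T -> R) : measurable D ->
  (forall i, mu.-integrable D (EFin \o h i)) ->
  mu.-integrable D (EFin \o (fun x => \sum_(i <- s) h i x)).
Proof.
move=> mD ih; elim: s => [|i s IH].
  rewrite (_ : _ \o _ = cst 0%E); first exact: integrable0.
  by apply/funext => x /=; rewrite big_nil.
have := integrableD mD (ih i) IH; apply: eq_integrable => // x _.
by rewrite /= big_cons.
Qed.

Lemma Rintegral_sum d (T : measurableType d) (R : realType)
    (mu : {measure set T -> \bar R}) (D : set T) (I : Type) (s : seq I)
    (h : I -> T -> R) : measurable D ->
  (forall i, mu.-integrable D (EFin \o h i)) ->
  (\int[mu]_(x in D) (\sum_(i <- s) h i x))%R =
  \sum_(i <- s) (\int[mu]_(x in D) h i x)%R.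
Proof.
move=> mD ih; elim: s => [|i s IH].
  under eq_Rintegral do rewrite big_nil.
  by rewrite big_nil /Rintegral integral0.
under eq_Rintegral do rewrite big_cons.
rewrite RintegralD//; last exact: integrable_Rsum.
by rewrite IH big_cons.
Qed.

Section Bessel.
Context {R : realType}.
Local Notation mu := (@lebesgue_measure R).
Implicit Types (A B f : R -> R) (Q t x y M : R).

Lemma band_integrable f Q M : measurable_fun setT f -> (forall t, `|f t| <= M) ->
  mu.-integrable `[- Q, Q] (EFin \o f).
Proof.
move=> mf fM; have mD : measurable (`[- Q, Q]%classic : set (measurableTypeR R)).
  exact: measurable_itv.
apply: (@le_integrable _ _ _ _ _ mD _ (EFin \o cst M)).
- by apply/measurable_EFinP; exact: measurable_funTS.
- move=> w _ /=; rewrite lee_fin (le_trans (fM w))//; exact: ler_norm.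
apply/integrableP; split; first exact: (@measurable_cst _ _ _ _ _ M%:E).
have fin : (mu `[(- Q)%R, Q]%classic < +oo)%E.
  by rewrite lebesgue_measure_itv/=; case: ifP => // _; rewrite -EFinB ltry.
by rewrite (_ : (fun x => _) = cst `|M|%:E)// integral_cst// lte_mul_pinfty.
Qed.

Lemma sin_mulpi (n : nat) : sin (n%:R * pi) = 0 :> R.
Proof.
elim: n => [|n IH]; first by rewrite mul0r sin0.
by rewrite -natr1 mulrDl mul1r sinDpi IH oppr0.
Qed.

(** The frequencies b p are multiples of pi N / Q, so that sin vanishes at both
    ends of the band; this is the only place where the spacing of the lattice
    matters. *)
Lemma integral_cos_orthogonal Q (b : R) (p : int) (N : nat) :
  0 < Q -> Q * b = N%:R * pi -> (0 < N)%N ->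
  (\int[mu]_(t in `[- Q, Q]) cos (t * (b * p%:~R)))%R = (2 * Q) *+ (p == 0).
Proof.
move=> Q0 QN N0; have [->|p0] := eqVneq p 0.
  under eq_Rintegral do rewrite mulr0 mulr0 cos0.
  rewrite Rintegral_cst//= lebesgue_measure_itv/= mulr1n mul1r lte_fin.
  by rewrite gtrN//= opprK; ring.
have b0 : b != 0.
  apply: contraTneq isT => b0; move: QN; rewrite b0 mulr0 => /eqP.
  by rewrite eq_sym mulf_eq0 pnatr_eq0 (gtn_eqF N0) gt_eqF ?pi_gt0.
pose k := b * p%:~R.
have k0 : k != 0 by rewrite mulf_neq0// intr_eq0.
pose G t := k^-1 * sin (t * k).
have dG t : is_derive t 1 G (cos (t * k)).
  rewrite /G; apply: trigger_derive.
  by rewrite /GRing.scale/= ; field.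
have cG t : {for t, continuous G}.
  apply: differentiable_continuous; apply/derivable1_diffP.
  by have [] := dG t.
have QQ : - Q < Q by rewrite gtrN.
have sinQ : sin (Q * k) = 0.
  rewrite /k mulrA QN; case: p p0 {k k0 G dG cG} => p _.
    by rewrite -pmulrn mulrAC -natrM sin_mulpi.
  by rewrite NegzE mulrNz mulrN sinN -pmulrn mulrAC -natrM sin_mulpi oppr0.
rewrite /Rintegral (continuous_FTC2 (F := G))//.
- by rewrite /G mulNr sinN sinQ oppr0 mulr0 subee.
- apply: continuous_subspaceT => t.
  apply: continuous_comp; last exact: continuous_cos.
  by apply: cvgMr_tmp.
- split.
  + by move=> t _; have [] := dG t.
  + by apply: cvg_at_right_filter; exact: cG.
  + by apply: cvg_at_left_filter; exact: cG.
- by move=> t _; rewrite derive1E; have [] := dG t.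
Qed.

(** The real part of the integral over [-Q, Q] of (A + iB)(t) e^(itx), that is,
    2 pi times an inverse Fourier transform of a function supported in the band. *)
Definition osc A B Q x : R :=
  (\int[mu]_(t in `[- Q, Q]) (A t * cos (t * x) - B t * sin (t * x)))%R.

Lemma cos_bound M (f : R -> R) x t : `|f t| <= M -> `|f t * cos (t * x)| <= M.
Proof.
move=> fM; rewrite normrM (le_trans _ fM)// ler_piMr//.
by rewrite ler_norml cos_geN1 cos_le1.
Qed.

Lemma sin_bound M (f : R -> R) x t : `|f t| <= M -> `|f t * sin (t * x)| <= M.
Proof.
move=> fM; rewrite normrM (le_trans _ fM)// ler_piMr//.
by rewrite ler_norml sin_geN1 sin_le1.
Qed.

Lemma measurable_cosM x : measurable_fun setT (fun t : R => cos (t * x)).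
Proof.
apply: continuous_measurable_fun => t.
by apply: continuous_comp; [exact: cvgMr_tmp|exact: continuous_cos].
Qed.

Lemma measurable_sinM x : measurable_fun setT (fun t : R => sin (t * x)).
Proof.
apply: continuous_measurable_fun => t.
by apply: continuous_comp; [exact: cvgMr_tmp|exact: continuous_sin].
Qed.

Lemma sqr_le_norm (x K : R) : `|x| <= K -> x ^+ 2 <= K ^+ 2.
Proof.
by move=> xK; rewrite -real_normK ?num_real// lerXn2r ?nnegrE ?(le_trans _ xK).
Qed.

Section BesselInequality.
Variables (A B : R -> R) (Q M : R).
Hypothesis mA : measurable_fun setT A.
Hypothesis mB : measurable_fun setT B.
Hypothesis AM : forall t, `|A t| <= M.
Hypothesis BM : forall t, `|B t| <= M.

Let M0 : 0 <= M. Proof. exact: le_trans (AM 0). Qed.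

Lemma measurable_osc_integrand x :
  measurable_fun setT (fun t => A t * cos (t * x) - B t * sin (t * x)).
Proof.
by apply: measurable_funB; apply: measurable_funM => //;
  [exact: measurable_cosM|exact: measurable_sinM].
Qed.

Lemma osc_integrand_bound x t : `|A t * cos (t * x) - B t * sin (t * x)| <= M + M.
Proof.
by rewrite (le_trans (ler_normB _ _))// lerD//; [exact: cos_bound|exact: sin_bound].
Qed.

Let iosc x : mu.-integrable `[- Q, Q]
  (EFin \o (fun t => A t * cos (t * x) - B t * sin (t * x))).
Proof.
exact: band_integrable (measurable_osc_integrand x) (osc_integrand_bound x).
Qed.

Definition energy : R := (\int[mu]_(t in `[- Q, Q]) (A t ^+ 2 + B t ^+ 2))%R.

Lemma integrable_energy :
  mu.-integrable `[- Q, Q] (EFin \o (fun t => A t ^+ 2 + B t ^+ 2)).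
Proof.
apply: (@band_integrable _ _ (M ^+ 2 + M ^+ 2)).
  by apply: measurable_funD; exact: measurable_funX.
move=> t; rewrite ger0_norm ?addr_ge0 ?sqr_ge0//.
by apply: lerD; exact: sqr_le_norm.
Qed.

(** With I_l the terms and c + id the trigonometric polynomial with coefficients
    I_l, the sum of the I_l^2 is the pairing of (A, B) with (c, -d), and the
    square norm of (c, d) is 2Q times the same sum, by orthogonality. The
    inequality of the means 2 u w <= u^2 + w^2, scaled to absorb half of the sum,
    replaces Bessel's inequality in an abstract Hilbert space. *)
Lemma bessel (y tau : R) (N : nat) (s : seq int) : 0 < Q ->
  Q * tau = N%:R * pi -> (0 < N)%N -> uniq s ->
  \sum_(l <- s) osc A B Q (y + tau * l%:~R) ^+ 2 <= 2 * Q * energy.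
Proof.
move=> Q0 QN N0 us.
pose X l := y + tau * l%:~R; pose I l := osc A B Q (X l).
pose c t := \sum_(l <- s) I l * cos (t * X l).
pose d t := \sum_(l <- s) I l * sin (t * X l).
pose G := \sum_(l <- s) I l ^+ 2.
rewrite -/G.
have mc : measurable_fun setT c.
  by apply: measurable_sum => l; apply: measurable_funM => //; exact: measurable_cosM.
have md : measurable_fun setT d.
  by apply: measurable_sum => l; apply: measurable_funM => //; exact: measurable_sinM.
pose K := \sum_(l <- s) `|I l|.
have cK t : `|c t| <= K.
  rewrite (le_trans (ler_norm_sum _ _ _))// ler_sum// => l _.
  exact: (@cos_bound _ (cst (I l))).
have dK t : `|d t| <= K.
  rewrite (le_trans (ler_norm_sum _ _ _))// ler_sum// => l _.
  exact: (@sin_bound _ (cst (I l))).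
have K0 : 0 <= K by exact: le_trans (cK 0).
have GE : G = (\int[mu]_(t in `[- Q, Q]) (A t * c t - B t * d t))%R.
  transitivity (\int[mu]_(t in `[- Q, Q])
      (\sum_(l <- s) I l * (A t * cos (t * X l) - B t * sin (t * X l))))%R.
    rewrite Rintegral_sum//; last first.
      by move=> l; exact: (integrableZl _ (I l) (iosc (X l))).
    apply: eq_bigr => l _; rewrite RintegralZl// expr2//.
  apply: eq_Rintegral => t _; rewrite /c /d !mulr_sumr -sumrB.
  by apply: eq_bigr => l _; ring.
have cd2 : (\int[mu]_(t in `[- Q, Q]) (c t ^+ 2 + d t ^+ 2))%R = 2 * Q * G.
  transitivity (\int[mu]_(t in `[- Q, Q]) (\sum_(l <- s) \sum_(l' <- s)
      (I l * I l') * cos (t * (tau * (l - l')%:~R))))%R.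
    apply: eq_Rintegral => t _.
    rewrite !expr2 /c /d !mulr_suml -big_split/=; apply: eq_bigr => l _.
    rewrite !mulr_sumr -big_split/=; apply: eq_bigr => l' _.
    have -> : t * (tau * (l - l')%:~R) = t * X l - t * X l' by rewrite /X rmorphB/=; ring.
    by rewrite cosB; ring.
  have icos l l' : mu.-integrable `[- Q, Q]
      (EFin \o (fun t => (I l * I l') * cos (t * (tau * (l - l')%:~R)))).
    apply: (@band_integrable _ _ `|I l * I l'|).
      by apply: measurable_funM => //; exact: measurable_cosM.
    by move=> t; exact: (@cos_bound _ (cst (I l * I l'))).
  have icos1 l l' : mu.-integrable `[- Q, Q]
      (EFin \o (fun t => cos (t * (tau * (l - l')%:~R)))).
    apply: (@band_integrable _ _ 1); first exact: measurable_cosM.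
    by move=> t; rewrite ler_norml cos_geN1 cos_le1.
  rewrite Rintegral_sum//; last by move=> l; exact: integrable_Rsum.
  rewrite /G mulr_sumr; apply: eq_big_seq => l ls.
  rewrite Rintegral_sum// (bigD1_seq l)//= RintegralZl//.
  rewrite (integral_cos_orthogonal _ Q0 QN N0) subrr eqxx mulr1n.
  rewrite big1 ?addr0; first by ring.
  move=> l' ll'; rewrite RintegralZl// (integral_cos_orthogonal _ Q0 QN N0).
  by rewrite subr_eq0 eq_sym (negbTE ll') mulr0n mulr0.
have i1 : mu.-integrable `[- Q, Q] (EFin \o (fun t => Q * (A t ^+ 2 + B t ^+ 2))).
  exact: (integrableZl _ Q integrable_energy).
have icd : mu.-integrable `[- Q, Q] (EFin \o (fun t => c t ^+ 2 + d t ^+ 2)).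
  apply: (@band_integrable _ _ (K ^+ 2 + K ^+ 2)).
    by apply: measurable_funD; exact: measurable_funX.
  move=> t; rewrite ger0_norm ?addr_ge0 ?sqr_ge0//.
  by apply: lerD; exact: sqr_le_norm.
have i2 : mu.-integrable `[- Q, Q] (EFin \o (fun t => (4 * Q)^-1 * (c t ^+ 2 + d t ^+ 2))).
  exact: (integrableZl _ (4 * Q)^-1 icd).
have iACBD : mu.-integrable `[- Q, Q] (EFin \o (fun t => A t * c t - B t * d t)).
  apply: (@band_integrable _ _ (M * K + M * K)).
    by apply: measurable_funB; exact: measurable_funM.
  by move=> t; rewrite (le_trans (ler_normB _ _))// lerD// normrM ler_pM.
(* The weight 1/(4Q) makes the second term exactly G/2. *)
have : G <= Q * energy + (4 * Q)^-1 * (2 * Q * G).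
  rewrite -cd2 /energy {1}GE -RintegralZl//; last exact: integrable_energy.
  rewrite -[X in _ <= _ + X]RintegralZl// -RintegralD//.
  apply: le_Rintegral => //; first exact: (integrableD _ i1 i2).
  move=> t _.
  rewrite -subr_ge0 (_ : _ - _ = Q * ((A t - (2 * Q)^-1 * c t) ^+ 2 + (B t + (2 * Q)^-1 * d t) ^+ 2)).
    by rewrite mulr_ge0 ?(ltW Q0)// addr_ge0// sqr_ge0.
  by field; rewrite gt_eqF.
have -> : (4 * Q)^-1 * (2 * Q * G) = G / 2 by field; rewrite gt_eqF.
by lra.
Qed.

End BesselInequality.
End Bessel.

(** * Lebesgue measure folded over a lattice *)

(** An enumeration of the integers: it turns families over the integers into
    sequences, on which monotone limits and countable suprema act. *)
Definition zenum (i : nat) : int := if odd i then Negz i./2 else Posz i./2.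

Lemma zenum_inj : injective zenum.
Proof.
move=> i j; have := odd_double_half i; have := odd_double_half j.
rewrite /zenum; case: (odd i); case: (odd j) => // hj hi [h];
  by rewrite -hi -hj h.
Qed.

Lemma zenum_surj (l : int) : exists i, zenum i = l.
Proof.
case: l => l; first by exists l.*2; rewrite /zenum odd_double doubleK.
by exists l.*2.+1; rewrite /zenum/= odd_double/= uphalf_double.
Qed.

Section Translation.
Context {R : realType}.
Local Notation mu := (@lebesgue_measure R).
Local Open Scope ereal_scope.

Let madd (c : R) : measurable_fun setT ((fun x => x + c)%R : R -> measurableTypeR R).
Proof. exact: measurable_funD. Qed.

Lemma lebesgue_measureD (c : R) (A : set R) : measurable A ->
  pushforward mu ((fun x => x + c)%R : R -> measurableTypeR R) A = mu A.
Proof.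
move=> mA.
pose phi : measurableTypeR R -> measurableTypeR R := fun x => (x + c)%R.
have mphi : measurable_fun setT phi by exact: madd.
apply/esym; have := @lebesgue_measure_unique R (pushforward mu phi) _ A mA.
apply => _ [[a b]] _ <-.
transitivity (mu [set` `](a - c)%R, (b - c)%R]]).
  rewrite !lebesgue_measure_itv/= !lte_fin ltrD2r.
  by case: ifP => // _; rewrite -!EFinB; congr EFin; ring.
rewrite /pushforward; congr (mu _); apply/seteqP; split => x;
by rewrite /phi /= !in_itv/= ltrBlDr lerBrDr.
Qed.

Lemma ge0_integral_translation (c : R) (D : set R) (f : R -> \bar R) :
  measurable D -> measurable_fun D f -> (forall x, 0 <= f x) ->
  \int[mu]_(x in D) f x = \int[mu]_(x in [set x | D (x + c)%R]) f (x + c)%R.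
Proof.
move=> mD mf f0.
rewrite (_ : [set x | D (x + c)%R] =
  ((fun x => x + c)%R : R -> measurableTypeR R) @^-1` D)//.
have := @ge0_integral_pushforward _ _ (measurableTypeR R) (measurableTypeR R) R
  _ (madd c) lebesgue_measure D f mD mf (fun y _ => f0 y).
move=> <-; apply: eq_measure_integral => [|mphi A mA _]; first exact: madd.
exact/esym/lebesgue_measureD.
Qed.

(** Cutting the line into the intervals [tau k, tau k + tau[ and translating them
    all to the first one turns the integral into that of a periodised sum. *)
Lemma ge0_integral_fold (tau K : R) (f : R -> \bar R) : (0 < tau)%R ->
  measurable_fun setT f -> (forall x, 0 <= f x) ->
  (forall x N, \sum_(i < N) f (x + tau * (zenum i)%:~R)%R <= K%:E) ->
  \int[mu]_x f x <= (tau * K)%:E.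
Proof.
move=> tau0 mf f0 fK.
pose F i : set R := `[(tau * (zenum i)%:~R)%R, (tau * (zenum i)%:~R + tau)%R[%classic.
have FP i x : F i x <-> Num.floor (x / tau)%R = zenum i.
  rewrite /F /= in_itv/=; split => [/andP[h1 h2]|h].
    apply: floor_def; rewrite intrD mulr1z.
    by rewrite ler_pdivlMr// ltr_pdivrMr// mulrDl mul1r !(mulrC _ tau) h1.
  have := floor_itv (x / tau)%R; rewrite h intrD mulr1z.
  by rewrite ler_pdivlMr// ltr_pdivrMr// mulrDl mul1r !(mulrC _ tau).
have UF : \bigcup_i F i = setT.
  apply/seteqP; split => // x _.
  have [i hi] := zenum_surj (Num.floor (x / tau)%R).
  by exists i => //; apply/FP.
have mF i : measurable (F i) by exact: measurable_itv.
have tF : trivIset setT F.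
  apply/trivIsetP => i j _ _ ij; apply/seteqP; split => // x [/FP hi /FP hj].
  by move: ij; rewrite -(inj_eq zenum_inj) -hi -hj eqxx.
rewrite -UF ge0_integral_bigcup//; last by apply: measurable_funTS.
apply: lime_le; first by apply: is_cvg_nneseries => n _ _; exact: integral_ge0.
apply: nearW => N; rewrite big_mkord.
have FE i : \int[mu]_(x in F i) f x =
    \int[mu]_(x in `[0%R, tau[) f (x + tau * (zenum i)%:~R)%R.
  rewrite (ge0_integral_translation (tau * (zenum i)%:~R))//; last first.
    exact: measurable_funTS.
  congr (integral _ _ _); apply/seteqP; split => x; rewrite /F /= !in_itv/=.
    by rewrite lerDr addrC ltrD2l.
  by rewrite lerDr addrC ltrD2l.
under eq_bigr do rewrite FE.
have mft i : measurable_fun setT (fun x : R => f (x + tau * (zenum i)%:~R)%R).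
  by apply: measurableT_comp => //; exact: madd.
rewrite -ge0_integral_sum//; last first.
  move=> i.
  by apply: measurable_funTS; exact: mft.
apply: (@le_trans _ _ (\int[mu]_(x in `[0%R, tau[) cst K%:E x)).
  apply: ge0_le_integral => //.
  - by move=> x _; exact: sume_ge0.
  - by apply: emeasurable_sum => i; apply: measurable_funTS; exact: mft.
rewrite integral_cst//= lebesgue_measure_itv/= lte_fin tau0 sube0.
by rewrite -EFinM mulrC.
Qed.

End Translation.

(** * Band-limited integrals and real Fourier transforms *)

Section Plancherel.
Context {R : realType}.
Local Notation mu := (@lebesgue_measure R).
Variables (A B : R -> R) (Q M : R).
Hypothesis mA : measurable_fun setT A.
Hypothesis mB : measurable_fun setT B.
Hypothesis AM : forall t, `|A t| <= M.
Hypothesis BM : forall t, `|B t| <= M.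

(** Dominated convergence; the purpose is measurability. *)
Lemma continuous_osc : continuous (osc A B Q).
Proof.
move=> a.
have mD : measurable (`[- Q, Q]%classic : set (measurableTypeR R)).
  exact: measurable_itv.
have aI : a \in (`]a - 1, a + 1[%classic : set R).
  by rewrite inE /= in_itv/=; apply/andP; split; lra.
apply: (@continuity_under_integral R _ _ mu
  (fun x t => A t * cos (t * x) - B t * sin (t * x)) `[- Q, Q] mD (a - 1) (a + 1)
  _ _ (cst (M + M))) aI.
- move=> x _; exact: (band_integrable Q (measurable_osc_integrand mA mB x)
    (osc_integrand_bound AM BM x)).
- apply: aeW => t _ x _.
  have c1 : continuous (fun x' : R => cos (t * x')).
    by move=> y; apply: continuous_comp; [exact: cvgMl_tmp|exact: continuous_cos].
  have c2 : continuous (fun x' : R => sin (t * x')).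
    by move=> y; apply: continuous_comp; [exact: cvgMl_tmp|exact: continuous_sin].
  apply: cvgB; apply: cvgM; try exact: cvg_cst.
  + exact: c1.
  + exact: c2.
- exact: (@band_integrable _ (cst (M + M)) _ `|M + M|).
- move=> x _; apply: aeW => t _ /=; exact: osc_integrand_bound.
Qed.

Lemma measurable_osc : measurable_fun setT (osc A B Q).
Proof. by apply: continuous_measurable_fun => x; exact: continuous_osc. Qed.

(** Folding over the period pi / (s Q): the sampled values of osc then form the
    progression for which Bessel's inequality holds with N = 1. *)
Lemma plancherel_osc (s : R) : 0 < s -> 0 < Q ->
  (\int[mu]_x (osc A B Q (s * x) ^+ 2)%:E <= (2 * pi / s * energy A B Q)%:E)%E.
Proof.
move=> s0 Q0.
have -> : 2 * pi / s * energy A B Q = pi / (s * Q) * (2 * Q * energy A B Q).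
  by field; rewrite !gt_eqF.
apply: ge0_integral_fold.
- by rewrite divr_gt0 ?pi_gt0// mulr_gt0.
- apply/measurable_EFinP/measurable_funX.
  apply: measurableT_comp; first exact: measurable_osc.
  exact: measurable_funM.
- by move=> x; rewrite lee_fin sqr_ge0.
- move=> x N; rewrite sumEFin lee_fin.
  have us : uniq [seq zenum i | i <- iota 0 N].
    by rewrite (map_inj_uniq zenum_inj) iota_uniq.
  have Qpi : Q * (pi / Q) = 1%:R * pi by field; rewrite gt_eqF.
  have := bessel mA mB AM BM (s * x) Q0 Qpi isT us.
  rewrite big_map -{1}(subn0 N) -/(index_iota 0 N) big_mkord.
  apply: le_trans; rewrite le_eqVlt; apply/orP; left; apply/eqP.
  apply: eq_bigr => i _; congr (osc _ _ _ _ ^+ 2).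
  by field; rewrite !gt_eqF.
Qed.

Lemma osc_bound x : 0 <= Q -> `|osc A B Q x| <= 2 * Q * (M + M).
Proof.
move=> Q0; rewrite /osc.
have mD : measurable (`[- Q, Q]%classic : set (measurableTypeR R)).
  exact: measurable_itv.
have i1 := band_integrable Q (measurable_osc_integrand mA mB x)
    (osc_integrand_bound AM BM x).
apply: le_trans (le_normr_Rintegral _ _) _ => //.
have i2 : mu.-integrable `[- Q, Q] (EFin \o cst (M + M)).
  exact: (@band_integrable _ (cst (M + M)) _ `|M + M|).
apply: (@le_trans _ _ (\int[mu]_(t in `[- Q, Q]) (cst (M + M) t))%R).
  apply: le_Rintegral => //; last by move=> t _; exact: osc_integrand_bound.
  apply: (@band_integrable _ _ _ (M + M)).
    by apply: measurableT_comp => //; exact: measurable_osc_integrand.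
  by move=> t; rewrite normr_id; exact: osc_integrand_bound.
rewrite Rintegral_cst//= lebesgue_measure_itv/= lte_fin.
case: ifPn => [_|]; first by rewrite /= opprK mulrC; lra.
rewrite -leNgt => QN; have -> : Q = 0 by lra.
by rewrite /= !mulr0 mul0r.
Qed.

End Plancherel.

Section RealIntegral.
Context {R : realType}.
Local Notation mu := (@lebesgue_measure R).

Lemma integral_translation (f : R -> R) (c : R) : measurable_fun setT f ->
  (\int[mu]_x (f (x + c))%:E = \int[mu]_x (f x)%:E)%E.
Proof.
move=> mf; rewrite [RHS]integralE [LHS]integralE.
have mE : measurable_fun setT (fun x => (f x)%:E) by exact/measurable_EFinP.
have h (g : R -> \bar R) : measurable_fun setT g -> (forall x, 0 <= g x)%E ->
    (\int[mu]_x g (x + c)%R = \int[mu]_x g x)%E.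
  by move=> mg g0; rewrite [RHS](ge0_integral_translation c).
congr (_ - _)%E.
- rewrite -(h (fun x => (f x)%:E)^\+%E); last 2 first.
  + exact: measurable_funepos.
  + by move=> x; exact: funepos_ge0.
  by apply: eq_integral => x _; rewrite !funepos.unlock.
- rewrite -(h (fun x => (f x)%:E)^\-%E); last 2 first.
  + exact: measurable_funeneg.
  + by move=> x; exact: funeneg_ge0.
  by apply: eq_integral => x _; rewrite !funeneg.unlock.
Qed.

Lemma integrable_translation (f : R -> R) (c : R) :
  mu.-integrable setT (EFin \o f) ->
  mu.-integrable setT (EFin \o (fun x => f (x + c))).
Proof.
move=> /integrableP[mf fi].
have mf' : measurable_fun setT f by exact/measurable_EFinP.
apply/integrableP; split.
  apply/measurable_EFinP; apply: measurableT_comp => //; exact: measurable_funD.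
suff : (\int[mu]_x (`|f (x + c)|)%:E < +oo)%E by [].
rewrite (integral_translation (f := fun x => `|f x|))//.
exact: measurableT_comp.
Qed.

End RealIntegral.

Section FourierReal.
Context {R : realType}.
Local Notation mu := (@lebesgue_measure R).
Implicit Types (h : R -> R) (t x c : R).

Let mT := @measurableT _ (measurableTypeR R).

Definition fcos h t : R := (\int[mu]_x (h x * cos (t * x)))%R.
Definition fsin h t : R := (\int[mu]_x (h x * sin (t * x)))%R.
Definition norm1 h : R := (\int[mu]_x `|h x|)%R.

Let mcos t : measurable_fun setT (fun x : R => cos (t * x)).
Proof.
by apply: (eq_measurable_fun _ _ (measurable_cosM t)) => x _; rewrite mulrC.
Qed.

Let msin t : measurable_fun setT (fun x : R => sin (t * x)).
Proof.
by apply: (eq_measurable_fun _ _ (measurable_sinM t)) => x _; rewrite mulrC.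
Qed.

Let cos1 x : `|cos x| <= 1 :> R. Proof. by rewrite ler_norml cos_geN1 cos_le1. Qed.
Let sin1 x : `|sin x| <= 1 :> R. Proof. by rewrite ler_norml sin_geN1 sin_le1. Qed.

Lemma integrable_mul_bounded h (b : R -> R) (M : R) :
  mu.-integrable setT (EFin \o h) -> measurable_fun setT b ->
  (forall x, `|b x| <= M) ->
  mu.-integrable setT (EFin \o (fun x => h x * b x)).
Proof.
move=> ih mb bM.
have mh : measurable_fun setT h by have /integrableP[/measurable_EFinP] := ih.
apply: (@le_integrable _ _ _ _ _ mT _ (EFin \o (fun x => M * h x))).
- by apply/measurable_EFinP; exact: measurable_funM.
- move=> x _ /=; rewrite lee_fin !normrM mulrC ler_wpM2r//.
  by rewrite (le_trans (bM x))// ler_norm.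
- exact: (integrableZl mT M ih).
Qed.

Lemma Rintegral_translation h c : measurable_fun setT h ->
  (\int[mu]_x h (x + c))%R = (\int[mu]_x h x)%R.
Proof. by move=> mh; rewrite /Rintegral integral_translation. Qed.

Section Integrable.
Variable h : R -> R.
Hypothesis ih : mu.-integrable setT (EFin \o h).

Let mh : measurable_fun setT h.
Proof. by have /integrableP[/measurable_EFinP] := ih. Qed.

Let ihc t : mu.-integrable setT (EFin \o (fun x => h x * cos (t * x))).
Proof. by apply: (integrable_mul_bounded (M := 1)). Qed.

Let ihs t : mu.-integrable setT (EFin \o (fun x => h x * sin (t * x))).
Proof. by apply: (integrable_mul_bounded (M := 1)). Qed.

Lemma fourier_realE t : fourier_real h t = (fcos h t +i* - fsin h t)%C.
Proof.
rewrite /fourier_real /fourier /cintegral; congr (_ +i* _)%C.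
  apply: eq_Rintegral => x _ /=.
  by rewrite cosN mul0r subr0.
rewrite -[RHS]mulN1r /fsin -RintegralZl//; apply: eq_Rintegral => x _ /=.
by rewrite sinN mul0r addr0 mulrN mulN1r.
Qed.

Let inorm : mu.-integrable setT (EFin \o (fun x => `|h x|)).
Proof.
apply: (@le_integrable _ _ _ _ _ mT _ (EFin \o h)) => //.
  by apply/measurable_EFinP; exact: measurableT_comp.
by move=> x _ /=; rewrite normr_id.
Qed.

Lemma norm1_ge0 : 0 <= norm1 h. Proof. exact: Rintegral_ge0. Qed.

(** The pair (fcos, fsin) is paired with itself under the integral sign, and
    (a cos + b sin)^2 <= a^2 + b^2. *)
Lemma fourier_sqr_le t : fcos h t ^+ 2 + fsin h t ^+ 2 <= norm1 h ^+ 2.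
Proof.
set a := fcos h t; set b := fsin h t.
pose q := Num.sqrt (a ^+ 2 + b ^+ 2).
have ab0 : 0 <= a ^+ 2 + b ^+ 2 by rewrite addr_ge0 ?sqr_ge0.
have q0 : 0 <= q by exact: sqrtr_ge0.
have q2 : q ^+ 2 = a ^+ 2 + b ^+ 2 by rewrite sqr_sqrtr.
have ia := integrableZl mT a (ihc t).
have ib := integrableZl mT b (ihs t).
have : a ^+ 2 + b ^+ 2 <= q * norm1 h.
  have -> : a ^+ 2 + b ^+ 2 = (\int[mu]_x (a * (h x * cos (t * x)) + b * (h x * sin (t * x))))%R.
    by rewrite RintegralD// !RintegralZl// !expr2.
  rewrite /norm1 -RintegralZl//; apply: le_Rintegral => //.
  - exact: (integrableD mT ia ib).
  - exact: (integrableZl mT q inorm).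
  move=> x _.
  have -> : a * (h x * cos (t * x)) + b * (h x * sin (t * x)) =
    (a * cos (t * x) + b * sin (t * x)) * h x by ring.
  rewrite (le_trans (ler_norm _))// normrM ler_wpM2r//.
  rewrite -(ger0_norm q0) -ler_sqr ?nnegrE// !real_normK ?num_real// q2.
  have := cos2Dsin2 (t * x); set u := cos _; set v := sin _ => uv.
  rewrite -subr_ge0.
  have -> : a ^+ 2 + b ^+ 2 - (a * u + b * v) ^+ 2 =
    (a ^+ 2 + b ^+ 2) * (1 - (u ^+ 2 + v ^+ 2)) + (a * v - b * u) ^+ 2 by ring.
  by rewrite uv subrr mulr0 add0r sqr_ge0.
rewrite -q2 expr2; have [->|qn0] := eqVneq q 0.
  by rewrite !mul0r sqr_ge0.
rewrite ler_pM2l ?lt_neqAle 1?eq_sym ?qn0// => qn.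
by rewrite -expr2 lerXn2r ?nnegrE ?norm1_ge0.
Qed.

Lemma fcos_le t : `|fcos h t| <= norm1 h.
Proof.
rewrite -ler_sqr ?nnegrE ?norm1_ge0// real_normK ?num_real//.
by apply: le_trans (fourier_sqr_le t); rewrite lerDl sqr_ge0.
Qed.

Lemma fsin_le t : `|fsin h t| <= norm1 h.
Proof.
rewrite -ler_sqr ?nnegrE ?norm1_ge0// real_normK ?num_real//.
by apply: le_trans (fourier_sqr_le t); rewrite lerDr sqr_ge0.
Qed.

Let continuous_transform (g : R -> R) : continuous g -> (forall x, `|g x| <= 1) ->
  continuous (fun t => (\int[mu]_x (h x * g (t * x)))%R).
Proof.
move=> cg g1 a.
have aI : a \in (`]a - 1, a + 1[%classic : set R).
  by rewrite inE /= in_itv/=; apply/andP; split; lra.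
have cgx (x : R) : continuous (fun t => g (t * x)).
  by move=> y; apply: continuous_comp; [exact: cvgMr_tmp|exact: cg].
apply: (@continuity_under_integral R _ _ mu
  (fun t x => h x * g (t * x)) setT mT (a - 1) (a + 1)
  _ _ (fun x => `|h x|)) aI => //.
- move=> x _; apply: (integrable_mul_bounded (M := 1)) => //.
  apply: continuous_measurable_fun => y.
  by apply: continuous_comp; [exact: cvgMl_tmp|exact: cg].
- apply: aeW => x _ t _; apply: cvgM; first exact: cvg_cst.
  exact: cgx.
- move=> t _; apply: aeW => x _ /=.
  by rewrite normrM ler_piMr.
Qed.

Lemma continuous_fcos : continuous (fcos h).
Proof. by apply: continuous_transform => //; exact: continuous_cos. Qed.

Lemma continuous_fsin : continuous (fsin h).
Proof. by apply: continuous_transform => //; exact: continuous_sin. Qed.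

Lemma fcos_translation c t : fcos (fun x => h (x - c)) t =
  cos (t * c) * fcos h t - sin (t * c) * fsin h t.
Proof.
rewrite /fcos -(Rintegral_translation c); last first.
  apply: measurable_funM => //; apply: measurableT_comp => //.
  exact: measurable_funB.
rewrite -!RintegralZl// -RintegralB//; last 2 first.
- exact: (integrableZl mT _ (ihc t)).
- exact: (integrableZl mT _ (ihs t)).
apply: eq_Rintegral => x _; rewrite addrK mulrDr cosD; ring.
Qed.

Lemma fsin_translation c t : fsin (fun x => h (x - c)) t =
  cos (t * c) * fsin h t + sin (t * c) * fcos h t.
Proof.
rewrite /fsin -(Rintegral_translation c); last first.
  apply: measurable_funM => //; apply: measurableT_comp => //.
  exact: measurable_funB.
rewrite -!RintegralZl// -RintegralD//; last 2 first.
- exact: (integrableZl mT _ (ihs t)).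
- exact: (integrableZl mT _ (ihc t)).
apply: eq_Rintegral => x _; rewrite addrK mulrDr sinD; ring.
Qed.

End Integrable.
End FourierReal.

(** * The energy of a Fourier transform, by duality *)

Lemma integral_indicM d (T : measurableType d) (R : realType)
    (mu : {measure set T -> \bar R}) (D : set T) (f : T -> R) :
  (\int[mu]_t (\1_D t * f t)%:E = \int[mu]_(t in D) (f t)%:E)%E.
Proof.
rewrite [RHS]integral_mkcond; apply: eq_integral => t _.
by rewrite patchE indicE; case: ifP => _; rewrite ?mul1r ?mul0r.
Qed.

Lemma half_absorb (R : realFieldType) (x y z : R) :
  x <= y / 2 * z + x / 2 -> x <= y * z.
Proof. by lra. Qed.

Section Duality.
Context {R : realType}.
Local Notation mu := (@lebesgue_measure R).
Let mT := @measurableT _ (measurableTypeR R).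

Variables (h : R -> R) (s Q E : R).
Hypothesis ih : mu.-integrable setT (EFin \o h).
Hypothesis h2 : (\int[mu]_x (h x ^+ 2)%:E <= E%:E)%E.
Hypothesis s0 : 0 < s.
Hypothesis Q0 : 0 < Q.

Let mh : measurable_fun setT h.
Proof. by have /integrableP[/measurable_EFinP] := ih. Qed.

Let A t := fcos h (s * t).
Let B t := - fsin h (s * t).

Let mA : measurable_fun setT A.
Proof.
apply: continuous_measurable_fun => t; rewrite /A.
by apply: continuous_comp; [exact: cvgMl_tmp|exact: continuous_fcos].
Qed.

Let mB : measurable_fun setT B.
Proof.
apply: measurableT_comp => //.
apply: continuous_measurable_fun => t.
by apply: (@continuous_comp _ _ _ (fun t => s * t) (fsin h)); [exact: cvgMl_tmp|exact: continuous_fsin].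
Qed.

Let AM t : `|A t| <= norm1 h. Proof. exact: fcos_le. Qed.
Let BM t : `|B t| <= norm1 h. Proof. by rewrite normrN; exact: fsin_le. Qed.

Let L0 : 0 <= norm1 h. Proof. exact: norm1_ge0. Qed.

Let D : set R := `[- Q, Q]%classic.
Let mD : measurable (D : set (measurableTypeR R)). Proof. exact: measurable_itv. Qed.

(* The integrand of the pairing of h with the band-limited integral of its own
   Fourier transform, over the band times the line. *)
Let G (p : R * R) : R := \1_D p.1 *
  (h p.2 * (A p.1 * cos (p.1 * (s * p.2)) - B p.1 * sin (p.1 * (s * p.2)))).

Let mG : measurable_fun setT (G : measurableTypeR R * measurableTypeR R -> R).
Proof.
have m1 : measurable_fun setT (fst : measurableTypeR R * measurableTypeR R -> R).
  exact: measurable_fst.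
have m2 : measurable_fun setT (snd : measurableTypeR R * measurableTypeR R -> R).
  exact: measurable_snd.
have mp : measurable_fun setT
   (fun p : measurableTypeR R * measurableTypeR R => p.1 * (s * p.2) : R).
  by apply: measurable_funM => //; exact: measurable_funM.
apply: measurable_funM.
  by apply: measurableT_comp m1; exact: measurable_indic.
apply: measurable_funM; first exact: measurableT_comp.
apply: measurable_funB; apply: measurable_funM.
- exact: (measurableT_comp mA m1).
- by apply: measurableT_comp mp; apply: continuous_measurable_fun; exact: continuous_cos.
- exact: (measurableT_comp mB m1).
- by apply: measurableT_comp mp; apply: continuous_measurable_fun; exact: continuous_sin.
Qed.

Let iG : (mu \x mu)%E.-integrable setT (EFin \o G).
Proof.
apply/integrable12ltyP; first exact/measurable_EFinP.
pose K := 2 * norm1 h.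
have inorm : mu.-integrable setT (EFin \o (fun x => `|h x|)).
  apply: (@le_integrable _ _ _ _ _ mT _ (EFin \o h)) => //.
    by apply/measurable_EFinP; exact: measurableT_comp.
  by move=> x _ /=; rewrite normr_id.
have NE : (\int[mu]_x (`|h x|)%:E = (norm1 h)%:E)%E.
  by rewrite /norm1 /Rintegral fineK//; exact: (integrable_fin_num mT inorm).
have mnG : measurable_fun setT
    (fun p : measurableTypeR R * measurableTypeR R => (`|G p|)%:E).
  by apply/measurable_EFinP; exact: measurableT_comp.
have K0 : 0 <= K by rewrite mulr_ge0.
apply: (@le_lt_trans _ _ (\int[mu]_t (K * norm1 h * \1_D t)%:E)%E).
  apply: ge0_le_integral => //.
  - by move=> t _; apply: integral_ge0.
  - apply: (@measurable_fun_fubini_tonelli_F _ _ (measurableTypeR R) (measurableTypeR R) R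
      mu (fun p => (`|G p|)%:E)) => // p; exact: normr_ge0.
  - by apply/measurable_EFinP; apply: measurable_funM => //; exact: measurable_indic.
  move=> t _.
  apply: (@le_trans _ _ (\int[mu]_x ((K * \1_D t) * `|h x|)%:E)%E).
    apply: ge0_le_integral => //.
    - exact: (measurable_fun_pair2 (t : measurableTypeR R) mnG).
    - by apply/measurable_EFinP; apply: measurable_funM => //; exact: measurableT_comp.
    move=> x _; rewrite /= lee_fin /G normrM ger0_norm// [K * _]mulrC -mulrA.
    rewrite ler_wpM2l// normrM mulrC ler_wpM2r//.
    rewrite (le_trans (osc_integrand_bound AM BM (s * x) t))//.
    by rewrite /K mulr2n mulrDl mul1r.
  under eq_integral do rewrite EFinM.
  rewrite ge0_integralZl_EFin//; last 2 first.
  - by apply/measurable_EFinP; exact: measurableT_comp.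
  - by rewrite mulr_ge0.
  by rewrite NE -EFinM lee_fin le_eqVlt; apply/orP; left; apply/eqP; ring.
under eq_integral do rewrite EFinM.
rewrite ge0_integralZl_EFin//; last 2 first.
- by apply/measurable_EFinP; exact: measurable_indic.
- by rewrite mulr_ge0.
rewrite integral_indic// setIT lte_mul_pinfty ?lee_fin ?mulr_ge0//.
have muD : (mu D < +oo)%E.
  by rewrite /D lebesgue_measure_itv/= lte_fin gtrN// -EFinB ltry.
exact: muD.
Qed.

Let eta x := osc A B Q (s * x).

Let meta : measurable_fun setT eta.
Proof.
apply: measurableT_comp; first exact: measurable_osc mA mB AM BM.
exact: measurable_funM.
Qed.

Let etaM x : `|eta x| <= 2 * Q * (norm1 h + norm1 h).
Proof. by apply: osc_bound => //; exact: ltW. Qed.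

Let J := energy A B Q.

(* Integrating G in one order gives the energy of the Fourier transform of h on
   the band, in the other the pairing of h with eta. *)
Let duality : (\int[mu]_x (h x * eta x))%R = J.
Proof.
have mD' : measurable (D : set (measurableTypeR R)) by [].
have ig x := band_integrable Q (measurable_osc_integrand mA mB x)
  (osc_integrand_bound AM BM x).
have F1 t : (\int[mu]_x (EFin \o G) (t, x) = (\1_D t * (A t ^+ 2 + B t ^+ 2))%:E)%E.
  have ic : mu.-integrable setT (EFin \o (fun x => h x * cos (s * t * x))).
    apply: (integrable_mul_bounded (M := 1)) => //.
      by apply: (eq_measurable_fun _ _ (measurable_cosM (s * t))) => x _; rewrite mulrC.
    by move=> x; rewrite ler_norml cos_geN1 cos_le1.
  have isn : mu.-integrable setT (EFin \o (fun x => h x * sin (s * t * x))).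
    apply: (integrable_mul_bounded (M := 1)) => //.
      by apply: (eq_measurable_fun _ _ (measurable_sinM (s * t))) => x _; rewrite mulrC.
    by move=> x; rewrite ler_norml sin_geN1 sin_le1.
  have i1 := integrableZl mT (A t) ic.
  have i2 := integrableZl mT (B t) isn.
  have i3 := integrableB mT i1 i2.
  have i4 := integrableZl mT (\1_D t) i3.
  have -> : (\int[mu]_x (EFin \o G) (t, x) =
    \int[mu]_x ((\1_D t)%:E * (A t * (h x * cos (s * t * x)) -
      B t * (h x * sin (s * t * x)))%:E))%E.
    apply: eq_integral => x _; rewrite /= -EFinM; congr EFin; rewrite /G /=.
    have -> : t * (s * x) = s * t * x by ring.
    by ring.
  rewrite integralZl// EFinM; congr (_ * _)%E.
  rewrite (_ : A t ^+ 2 + B t ^+ 2 = (\int[mu]_x (A t * (h x * cos (s * t * x)) -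
      B t * (h x * sin (s * t * x))))%R).
    by rewrite /Rintegral fineK//; exact: (integrable_fin_num mT i3).
  by rewrite RintegralB// !RintegralZl// -/(fcos h (s * t)) -/(fsin h (s * t)) /B /A; ring.
have F2 x : (\int[mu]_t (EFin \o G) (t, x) = (h x * eta x)%:E)%E.
  rewrite (integral_indicM mu D (fun t => h x * (A t * cos (t * (s * x)) -
     B t * sin (t * (s * x))))).
  under eq_integral do rewrite EFinM.
  rewrite (integralZl mD' (ig (s * x))) EFinM; congr (_ * _)%E.
  by rewrite /eta /osc /Rintegral fineK//; exact: (integrable_fin_num mD' (ig (s * x))).
have := Fubini iG.
under eq_integral do rewrite F1.
under [in RHS]eq_integral do rewrite F2.
rewrite integral_indicM => FE.
by rewrite /J /energy /Rintegral FE.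
Qed.

(** The energy J equals the integral of h times eta, and the integral of eta^2 is
    at most 2 pi J / s. The inequality of the means bounds J by pi/s times the
    square integral of h plus J/2, and J is finite. *)
Lemma fourier_energy_le :
  (\int[mu]_(t in `[- Q, Q]) (fcos h (s * t) ^+ 2 + fsin h (s * t) ^+ 2))%R
    <= 2 * pi / s * E.
Proof.
rewrite (_ : (\int[mu]_(_ in _) _)%R = J); last first.
  by apply: eq_Rintegral => t _; rewrite /B sqrrN.
have pl : (\int[mu]_x (eta x ^+ 2)%:E <= (2 * pi / s * J)%:E)%E.
  by have := plancherel_osc mA mB AM BM s0 Q0.
pose k := 2 * pi / s.
have k0 : 0 < k by rewrite divr_gt0// mulr_gt0// pi_gt0.
have ihe : mu.-integrable setT (EFin \o (fun x => h x * eta x)).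
  exact: integrable_mul_bounded etaM.
have ih2 : mu.-integrable setT (EFin \o (fun x => h x ^+ 2)).
  apply/integrableP; split; first by apply/measurable_EFinP; exact: measurable_funX.
  under eq_integral do rewrite /= ger0_norm ?sqr_ge0//.
  by rewrite (le_lt_trans h2)// ltry.
have ie2 : mu.-integrable setT (EFin \o (fun x => eta x ^+ 2)).
  apply/integrableP; split; first by apply/measurable_EFinP; exact: measurable_funX.
  under eq_integral do rewrite /= ger0_norm ?sqr_ge0//.
  by rewrite (le_lt_trans pl)// ltry.
have i1 := integrableZl mT (k / 2) ih2.
have i2 := integrableZl mT (2 * k)^-1 ie2.
have h2' : (\int[mu]_x (h x ^+ 2))%R <= E.
  by rewrite -lee_fin /Rintegral fineK//; exact: (integrable_fin_num mT ih2).
have e2' : (\int[mu]_x (eta x ^+ 2))%R <= k * J.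
  by rewrite -lee_fin /Rintegral fineK//; exact: (integrable_fin_num mT ie2).
have : J <= (k / 2) * (\int[mu]_x (h x ^+ 2))%R + (2 * k)^-1 * (\int[mu]_x (eta x ^+ 2))%R.
  rewrite -duality -!RintegralZl// -RintegralD//.
  apply: le_Rintegral => //; first exact: (integrableD mT i1 i2).
  move=> x _; rewrite -subr_ge0.
  have -> : k / 2 * h x ^+ 2 + (2 * k)^-1 * eta x ^+ 2 - h x * eta x =
    (k / 2) * (h x - eta x / k) ^+ 2 by field; rewrite gt_eqF.
  by rewrite mulr_ge0 ?sqr_ge0// divr_ge0// ltW.
have h3 : (k / 2) * (\int[mu]_x (h x ^+ 2))%R <= (k / 2) * E.
  by rewrite ler_wpM2l// divr_ge0// ltW.
have h4 : (2 * k)^-1 * (\int[mu]_x (eta x ^+ 2))%R <= J / 2.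
  rewrite (_ : J / 2 = (2 * k)^-1 * (k * J)); last by field; rewrite gt_eqF.
  by rewrite ler_wpM2l// invr_ge0 mulr_ge0// ltW.
move=> h5; have := le_trans h5 (lerD h3 h4).
exact: half_absorb.
Qed.

End Duality.

(** * The Fourier transform of the error law *)

Section LawTransform.
Context {R : realType}.
Variable nu : probability (measurableTypeR R) R.

Definition lcos (t : R) : R := (\int[nu]_x cos (t * x))%R.
Definition lsin (t : R) : R := (\int[nu]_x sin (t * x))%R.

Let mT := @measurableT _ (measurableTypeR R).

Let mtrig (g : R -> R) t : continuous g ->
  measurable_fun (setT : set (measurableTypeR R)) (fun x => g (t * x)).
Proof.
move=> cg; apply: continuous_measurable_fun => x.
by apply: continuous_comp; [exact: cvgMl_tmp|exact: cg].
Qed.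

Let itrig (g : R -> R) t : continuous g -> (forall x, `|g x| <= 1) ->
  nu.-integrable setT (EFin \o (fun x => g (t * x))).
Proof.
move=> cg g1; apply: (@bounded_integrable _ _ _ nu (fun x => g (t * x)) 1) => //.
exact: mtrig.
Qed.

Let cos1 x : `|cos x| <= 1 :> R. Proof. by rewrite ler_norml cos_geN1 cos_le1. Qed.
Let sin1 x : `|sin x| <= 1 :> R. Proof. by rewrite ler_norml sin_geN1 sin_le1. Qed.

Lemma fourier_lawE t : fourier_law nu t = (lcos t +i* - lsin t)%C.
Proof.
rewrite /fourier_law /cintegral; congr (_ +i* _)%C.
  by apply: eq_Rintegral => x _ /=; rewrite cosN.
rewrite -[RHS]mulN1r /lsin -RintegralZl//.
  by apply: eq_Rintegral => x _ /=; rewrite sinN mulN1r.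
by apply: itrig => //; exact: continuous_sin.
Qed.

Let continuous_law (g : R -> R) : continuous g -> (forall x, `|g x| <= 1) ->
  continuous (fun t : R => (\int[nu]_x (g (t * x)))%R).
Proof.
move=> cg g1 a.
have aI : a \in (`]a - 1, a + 1[%classic : set R).
  by rewrite inE /= in_itv/=; apply/andP; split; lra.
apply: (@continuity_under_integral R _ _ nu
  (fun t x => g (t * x)) setT mT (a - 1) (a + 1) _ _ (cst 1)) aI => //.
- by move=> x _; exact: itrig.
- apply: aeW => x _ t _.
  by apply: continuous_comp; [exact: cvgMr_tmp|exact: cg].
- exact: finite_measure_integrable_cst.
- by move=> t _; apply: aeW => x _ /=.
Qed.

Lemma continuous_lcos : continuous lcos.
Proof. by apply: continuous_law => //; exact: continuous_cos. Qed.

Lemma continuous_lsin : continuous lsin.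
Proof. by apply: continuous_law => //; exact: continuous_sin. Qed.

Lemma cabs_law t : cabs (fourier_law nu t) = Num.sqrt (lcos t ^+ 2 + lsin t ^+ 2).
Proof. by rewrite fourier_lawE /cabs /= sqrrN. Qed.

Lemma continuous_cabs_law : continuous (fun t => cabs (fourier_law nu t)).
Proof.
rewrite (_ : (fun t => _) = fun t => Num.sqrt (lcos t ^+ 2 + lsin t ^+ 2)); last first.
  by apply/funext => t; exact: cabs_law.
move=> t; apply: continuous_comp; last exact: sqrt_continuous.
apply: cvgD; rewrite expr2; apply: cvgM.
- exact: continuous_lcos.
- exact: continuous_lcos.
- exact: continuous_lsin.
- exact: continuous_lsin.
Qed.

Variables (j : nat) (a : R).
Hypothesis a0 : 0 < a.
Hypothesis law_pos : forall t, t \in `[- (2 ^+ j * a), 2 ^+ j * a] ->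
  0 < cabs (fourier_law nu t).

(** A continuous function attains its minimum on the band. *)
Lemma delta_gt0 : 0 < delta nu j a.
Proof.
have Q0 : 0 < 2 ^+ j * a by rewrite mulr_gt0// exprn_gt0.
have QQ : - (2 ^+ j * a) <= 2 ^+ j * a by rewrite (le_trans _ (ltW Q0))// oppr_le0 ltW.
have [t0 t0Q tmin] := EVT_min QQ (continuous_subspaceT continuous_cabs_law).
apply: lt_le_trans (law_pos t0Q) _.
apply: lb_le_inf.
  by exists (cabs (fourier_law nu t0)); exists t0.
by move=> _ [t tQ <-]; exact: tmin.
Qed.

Lemma delta_le t : t \in `[- (2 ^+ j * a), 2 ^+ j * a] ->
  delta nu j a <= cabs (fourier_law nu t).
Proof.
move=> tQ; apply: ge_inf; last by exists t.
by exists 0 => _ [u _ <-]; rewrite cabs_law sqrtr_ge0.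
Qed.

End LawTransform.

(** * Size of the deconvolved scaling functions *)

Lemma phitilde_constant (R : realFieldType) (r p x y : R) :
  0 < r -> 0 < p -> 0 < x -> 0 < y ->
  (2 * p)^-1 * ((x * y * r * (2 * p / (y * x ^+ 2)) +
    2 * (y * (r ^+ 2 * p)) / (x * y * r)) / 2) = r / x.
Proof. by move=> r0 p0 x0 y0; field; rewrite !gt_eqF. Qed.

Lemma phitilde_sqr_constant (R : realFieldType) (b l p x y : R) :
  0 < p -> 0 < x -> 0 < y ->
  (2 * p)^-1 ^+ 2 * (2 * p * (2 * b * l ^+ 2 / (y * x ^+ 2))) =
  b / p * l ^+ 2 / (y * x ^+ 2).
Proof. by move=> p0 x0 y0; field; rewrite !gt_eqF. Qed.

Lemma phitilde_sum_constant (R : realFieldType) (b l p x y n : R) :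
  0 < p -> 0 < x -> 0 < y ->
  (2 * p)^-1 ^+ 2 * (2 * (y * (n * p)) * (2 * b * l ^+ 2 / (y * x ^+ 2))) =
  n * b * l ^+ 2 / (p * x ^+ 2).
Proof. by move=> p0 x0 y0; field; rewrite !gt_eqF. Qed.

Section Phitilde.
Context {R : realType}.
Local Notation mu := (@lebesgue_measure R).
Let mT := @measurableT _ (measurableTypeR R).
Variables (phi : R -> R) (nu : probability (measurableTypeR R) R) (j : nat) (a : R).
Hypothesis iphi : mu.-integrable setT (EFin \o phi).
Hypothesis phi2 : (\int[mu]_x (phi x ^+ 2)%:E <= 1%:E)%E.
Hypothesis phisupp : supp (fourier_real phi) `<=` `[- a, a].
Hypothesis a0 : 0 < a.
Hypothesis law_pos : forall t, t \in `[- (2 ^+ j * a), 2 ^+ j * a] ->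
  0 < cabs (fourier_law nu t).

Local Notation q := (2 ^+ j : R).
Local Notation s := (2 ^- j : R).
Local Notation Q := (2 ^+ j * a).
Local Notation dl := (delta nu j a).
Local Notation L := (norm1 phi).

Let q0 : 0 < q. Proof. by rewrite exprn_gt0. Qed.
Let s0 : 0 < s. Proof. by rewrite invr_gt0. Qed.
Let Q0 : 0 < Q. Proof. by rewrite mulr_gt0. Qed.
Let d0 : 0 < dl. Proof. exact: delta_gt0. Qed.

Let mphi : measurable_fun setT phi.
Proof. by have /integrableP[/measurable_EFinP] := iphi. Qed.

Lemma fourier_vanish t : a < `|t| -> fcos phi t = 0 /\ fsin phi t = 0.
Proof.
move=> at0.
have : ~ supp (fourier_real phi) t.
  move=> /phisupp; rewrite /= in_itv/= -ler_norml => h.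
  by move: at0; rewrite ltNge h.
rewrite /supp => nt.
have : fourier_real phi t = 0.
  by apply/eqP; apply: contra_notT nt => h; apply: subset_closure.
by rewrite (fourier_realE iphi) => -[-> /eqP]; rewrite oppr_eq0 => /eqP.
Qed.

(** Real and imaginary parts of F[phi](2^-j t) / (2^j conj F[nu](t)). *)
Definition ratio_re (t : R) : R :=
  (fcos phi (s * t) * lcos nu t - fsin phi (s * t) * lsin nu t) /
  (q * (lcos nu t ^+ 2 + lsin nu t ^+ 2)).
Definition ratio_im (t : R) : R :=
  - (fcos phi (s * t) * lsin nu t + fsin phi (s * t) * lcos nu t) /
  (q * (lcos nu t ^+ 2 + lsin nu t ^+ 2)).

Let mlc : measurable_fun setT (lcos nu).
Proof. by apply: continuous_measurable_fun; exact: continuous_lcos. Qed.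
Let mls : measurable_fun setT (lsin nu).
Proof. by apply: continuous_measurable_fun; exact: continuous_lsin. Qed.
Let mfc : measurable_fun setT (fun t => fcos phi (s * t)).
Proof.
apply: continuous_measurable_fun => t.
by apply: (@continuous_comp _ _ _ (fun t => s * t) (fcos phi)); [exact: cvgMl_tmp|exact: continuous_fcos].
Qed.
Let mfs : measurable_fun setT (fun t => fsin phi (s * t)).
Proof.
apply: continuous_measurable_fun => t.
by apply: (@continuous_comp _ _ _ (fun t => s * t) (fsin phi)); [exact: cvgMl_tmp|exact: continuous_fsin].
Qed.

Let minv : measurable_fun setT (fun t => (q * (lcos nu t ^+ 2 + lsin nu t ^+ 2))^-1).
Proof.
rewrite (_ : (fun t => _) = (@powR R ^~ (-1)) \o
    (fun t => q * (lcos nu t ^+ 2 + lsin nu t ^+ 2))); last first.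
  by apply/funext => t /=; rewrite powR_inv1// mulr_ge0 ?(ltW q0)// addr_ge0 ?sqr_ge0.
apply: measurableT_comp; first exact: measurable_powR.
by apply: measurable_funM => //; apply: measurable_funD; exact: measurable_funX.
Qed.

Lemma measurable_ratio_re : measurable_fun setT ratio_re.
Proof. by apply: measurable_funM => //; apply: measurable_funB; exact: measurable_funM. Qed.

Lemma measurable_ratio_im : measurable_fun setT ratio_im.
Proof.
apply: measurable_funM => //; apply: measurableT_comp => //.
by apply: measurable_funD; exact: measurable_funM.
Qed.

Lemma ratio_vanish t : Q < `|t| -> ratio_re t = 0 /\ ratio_im t = 0.
Proof.
move=> Qt; have [] := @fourier_vanish (s * t).
  by rewrite normrM (gtr0_norm s0) -ltr_pdivrMl// invrK.
by rewrite /ratio_re /ratio_im => -> ->; rewrite !mul0r subrr addr0 oppr0 mul0r.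
Qed.

(** Inside the band the denominator is at least delta; outside it both sides are
    nonnegative and the ratio vanishes with F[phi]. *)
Lemma ratio_sqr_le t : ratio_re t ^+ 2 + ratio_im t ^+ 2 <=
  (fcos phi (s * t) ^+ 2 + fsin phi (s * t) ^+ 2) / (q * dl) ^+ 2.
Proof.
have [Qt|tQ] := ltP Q `|t|.
  have [-> ->] := ratio_vanish Qt.
  by rewrite expr0n/= addr0 divr_ge0 ?addr_ge0 ?sqr_ge0.
have tI : t \in `[- Q, Q] by rewrite in_itv/= -ler_norml.
have := delta_le nu tI; rewrite cabs_law => dt.
set D := lcos nu t ^+ 2 + lsin nu t ^+ 2 in dt.
have D0 : 0 <= D by rewrite addr_ge0 ?sqr_ge0.
have dD : dl ^+ 2 <= D.
  by rewrite -[leRHS]sqr_sqrtr// lerXn2r ?nnegrE ?sqrtr_ge0// ltW.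
have D1 : 0 < D by rewrite (lt_le_trans _ dD)// exprn_gt0.
rewrite /ratio_re /ratio_im -/D.
set C := fcos _ _; set S := fsin _ _; set u := lcos nu t; set w := lsin nu t.
have -> : ((C * u - S * w) / (q * D)) ^+ 2 + (- (C * w + S * u) / (q * D)) ^+ 2 =
  (C ^+ 2 + S ^+ 2) / (q ^+ 2 * D).
  have DE : D = u ^+ 2 + w ^+ 2 by [].
  apply: (@mulIf _ ((q * D) ^+ 2)); first by rewrite expf_neq0// mulf_neq0 ?gt_eqF.
  transitivity ((C * u - S * w) ^+ 2 + (C * w + S * u) ^+ 2).
    by field; rewrite !gt_eqF.
  transitivity ((C ^+ 2 + S ^+ 2) * D); last by field; rewrite !gt_eqF.
  by rewrite DE; ring.
rewrite ler_wpM2l ?addr_ge0 ?sqr_ge0// exprMn lef_pV2 ?posrE ?mulr_gt0 ?exprn_gt0//.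
by rewrite ler_pM2l ?exprn_gt0.
Qed.

Let M := L / (q * dl).
Let M0 : 0 <= M. Proof. by rewrite divr_ge0 ?norm1_ge0// mulr_ge0 ?ltW. Qed.

Lemma ratio_sqr_bound t : ratio_re t ^+ 2 + ratio_im t ^+ 2 <= M ^+ 2.
Proof.
apply: le_trans (ratio_sqr_le t) _.
by rewrite /M expr_div_n ler_wpM2r ?invr_ge0 ?sqr_ge0// fourier_sqr_le.
Qed.

Lemma ratio_re_bound t : `|ratio_re t| <= M.
Proof.
rewrite -ler_sqr ?nnegrE// real_normK ?num_real//.
by apply: le_trans (ratio_sqr_bound t); rewrite lerDl sqr_ge0.
Qed.

Lemma ratio_im_bound t : `|ratio_im t| <= M.
Proof.
rewrite -ler_sqr ?nnegrE// real_normK ?num_real//.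
by apply: le_trans (ratio_sqr_bound t); rewrite lerDr sqr_ge0.
Qed.

Lemma integral_band (g : R -> R) (Q' : R) : Q <= Q' -> (forall t, Q < `|t| -> g t = 0) ->
  (\int[mu]_t g t)%R = (\int[mu]_(t in `[- Q', Q']) g t)%R.
Proof.
move=> QQ' g0; rewrite [RHS]Rintegral_mkcond; apply: eq_Rintegral => t _.
rewrite patchE; case: ifPn => // /negP tQ; apply: g0.
rewrite (le_lt_trans QQ')// ltNge; apply/negP => h; apply: tQ.
by rewrite inE /= in_itv/= -ler_norml.
Qed.

(** By phitildeE this is 2 pi times phitilde_0, and the phitilde_k are its
    translates. *)
Definition eta (y : R) : R := osc ratio_re ratio_im Q y.

(** The ratio vanishes outside the band, so that the band may be enlarged; this is
    used to make its width commensurable with the translations. *)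
Lemma eta_window Q' y : Q <= Q' -> eta y = osc ratio_re ratio_im Q' y.
Proof.
move=> QQ'; rewrite /eta /osc -!integral_band// => t /ratio_vanish[-> ->];
by rewrite !mul0r subrr.
Qed.

Lemma energy_window Q' : Q <= Q' ->
  energy ratio_re ratio_im Q = energy ratio_re ratio_im Q'.
Proof.
move=> QQ'; rewrite /energy -!integral_band// => t /ratio_vanish[-> ->];
by rewrite expr0n/= addr0.
Qed.

(* When the denominator vanishes both sides are 0, by the convention on inverses. *)
Let complex_ratio (C S u w : R) :
  ((C +i* - S) / (q%:C * (u +i* - w)^*) =
   ((C * u - S * w) / (q * (u ^+ 2 + w ^+ 2)) +i*
    (- (C * w + S * u) / (q * (u ^+ 2 + w ^+ 2)))))%C.
Proof.
have [D0|Dn0] := eqVneq (u ^+ 2 + w ^+ 2) 0.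
  have := D0 => /eqP; rewrite paddr_eq0 ?sqr_ge0// !sqrf_eq0 => /andP[/eqP -> /eqP ->].
  rewrite expr0n/= addr0 !mulr0 !invr0 !mulr0 /=.
  have -> : (q%:C * (0 +i* - 0)^*)%C = 0.
    by apply/eqP; rewrite eq_complex /=; apply/andP; split; apply/eqP; ring.
  by rewrite invr0 mulr0.
have qn0 : q != 0 by rewrite gt_eqF.
apply/eqP; rewrite eq_complex; apply/andP; split; apply/eqP => /=.
all: rewrite opprK !mul0r subr0 addr0.
all: have -> : (q * u) ^+ 2 + (q * w) ^+ 2 = q ^+ 2 * (u ^+ 2 + w ^+ 2) by ring.
all: by field; rewrite Dn0.
Qed.

(** Translating phi by k multiplies F[phi](2^-j t) by e^(-i 2^-j k t). *)
Lemma phitildeE k y : complex.Re (phitilde phi nu j k y) =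
  (2 * pi)^-1 * eta (y - s * k%:~R).
Proof.
pose C t := fcos (translates phi k) (s * t).
pose S t := fsin (translates phi k) (s * t).
pose X t := (C t * lcos nu t - S t * lsin nu t) / (q * (lcos nu t ^+ 2 + lsin nu t ^+ 2)).
pose Y t := - (C t * lsin nu t + S t * lcos nu t) / (q * (lcos nu t ^+ 2 + lsin nu t ^+ 2)).
have XY : (fun t => fourier_real (translates phi k) (s * t) /
    (q%:C%C * (fourier_law nu t)^*%C)) = (fun t => (X t +i* Y t)%C).
  apply/funext => t.
  rewrite (fourier_realE (integrable_translation (- k%:~R) iphi)) fourier_lawE.
  by rewrite complex_ratio.
rewrite /phitilde XY.
rewrite /inv_fourier /cintegral /= mul0r subr0; congr (_ * _).
rewrite /eta /osc -integral_band//; last first.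
  by move=> t /ratio_vanish[-> ->]; rewrite !mul0r subrr.
apply: eq_Rintegral => t _.
have CE : C t = cos (s * t * k%:~R) * fcos phi (s * t) - sin (s * t * k%:~R) * fsin phi (s * t).
  exact: fcos_translation.
have SE : S t = cos (s * t * k%:~R) * fsin phi (s * t) + sin (s * t * k%:~R) * fcos phi (s * t).
  exact: fsin_translation.
rewrite /X /Y CE SE /ratio_re /ratio_im.
set c := fcos _ _; set d := fsin _ _; set u := lcos nu t; set w := lsin nu t.
have -> : s * t * k%:~R = t * (s * k%:~R) by ring.
rewrite (mulrBr t y) cosB sinB; ring.
Qed.

Let iratio : mu.-integrable `[- Q, Q]
  (EFin \o (fun t => ratio_re t ^+ 2 + ratio_im t ^+ 2)).
Proof.
exact: integrable_energy measurable_ratio_re measurable_ratio_im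
  ratio_re_bound ratio_im_bound.
Qed.

Let mband : measurable (`[- Q, Q]%classic : set (measurableTypeR R)).
Proof. exact: measurable_itv. Qed.

Let muband : fine (mu `[- Q, Q]%classic) = 2 * Q.
Proof. by rewrite lebesgue_measure_itv/= lte_fin gtrN//= opprK; ring. Qed.

Let icst (c : R) : mu.-integrable `[- Q, Q] (EFin \o cst c).
Proof. exact: (@band_integrable _ (cst c) _ `|c|). Qed.

(** From the sup bound of F[phi] by the L^1 norm of phi, which is how that norm
    enters D1. *)
Lemma energy_ratio_le1 :
  energy ratio_re ratio_im Q <= 2 * a * L ^+ 2 / (q * dl ^+ 2).
Proof.
apply: (@le_trans _ _ (\int[mu]_(t in `[- Q, Q]) cst (M ^+ 2) t)%R).
  by apply: le_Rintegral => // t _; exact: ratio_sqr_bound.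
rewrite Rintegral_cst// muband le_eqVlt; apply/orP; left; apply/eqP.
by rewrite /M; field; rewrite !gt_eqF.
Qed.

(** From the square integral of F[phi], independently of the L^1 norm of phi. This
    is the bound behind the constant D2, which does not contain that norm. *)
Lemma energy_ratio_le2 : energy ratio_re ratio_im Q <= 2 * pi / (q * dl ^+ 2).
Proof.
have mD := mband.
pose g t := fcos phi (s * t) ^+ 2 + fsin phi (s * t) ^+ 2.
have ig : mu.-integrable `[- Q, Q] (EFin \o g).
  apply: (@band_integrable _ _ _ (L ^+ 2)).
    by apply: measurable_funD; exact: measurable_funX.
  by move=> t; rewrite ger0_norm ?addr_ge0 ?sqr_ge0// fourier_sqr_le.
have i2 := integrableZl mD ((q * dl) ^- 2) ig.
apply: (@le_trans _ _ (\int[mu]_(t in `[- Q, Q]) ((q * dl) ^- 2 * g t))%R).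
  by apply: le_Rintegral => // t _; rewrite mulrC; exact: ratio_sqr_le.
rewrite RintegralZl//.
have := fourier_energy_le iphi phi2 s0 Q0; rewrite mulr1 => h.
apply: (@le_trans _ _ ((q * dl) ^- 2 * (2 * pi / s))).
  by rewrite ler_wpM2l// invr_ge0 sqr_ge0.
rewrite invrK le_eqVlt; apply/orP; left; apply/eqP.
by field; rewrite !gt_eqF.
Qed.

(* The Cauchy-Schwarz inequality in its additive form; k is chosen in
   phitilde_bound to balance the two terms. *)
Let eta_le (k : R) y : 0 < k ->
  `|eta y| <= (k * energy ratio_re ratio_im Q + 2 * Q / k) / 2.
Proof.
move=> k0; have mD := mband.
have i1 := band_integrable Q (measurable_osc_integrand measurable_ratio_re
  measurable_ratio_im y) (osc_integrand_bound ratio_re_bound ratio_im_bound y).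
have i2 := integrableZl mD k iratio.
have i3 := integrableD mD i2 (icst k^-1).
have i4 := integrableZl mD 2^-1 i3.
apply: le_trans (le_normr_Rintegral _ _) _ => //.
apply: (@le_trans _ _ (\int[mu]_(t in `[- Q, Q])
   (2^-1 * (k * (ratio_re t ^+ 2 + ratio_im t ^+ 2) + k^-1)))%R).
  apply: le_Rintegral => //.
    exact: integrable_norm.
  move=> t _; set A := ratio_re t; set B := ratio_im t.
  have cs := cos2Dsin2 (t * y); set c := cos _ in cs *; set d := sin _ in cs *.
  rewrite ler_norml; apply/andP; split; rewrite -subr_ge0.
    have -> : A * c - B * d - - (2^-1 * (k * (A ^+ 2 + B ^+ 2) + k^-1)) =
      k / 2 * ((A + c / k) ^+ 2 + (B - d / k) ^+ 2) + (1 - (c ^+ 2 + d ^+ 2)) / (2 * k).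
      by field; rewrite gt_eqF.
    by rewrite cs subrr mul0r addr0 mulr_ge0 ?divr_ge0 ?(ltW k0)// addr_ge0 ?sqr_ge0.
  have -> : 2^-1 * (k * (A ^+ 2 + B ^+ 2) + k^-1) - (A * c - B * d) =
      k / 2 * ((A - c / k) ^+ 2 + (B + d / k) ^+ 2) + (1 - (c ^+ 2 + d ^+ 2)) / (2 * k).
    by field; rewrite gt_eqF.
  by rewrite cs subrr mul0r addr0 mulr_ge0 ?divr_ge0 ?(ltW k0)// addr_ge0 ?sqr_ge0.
rewrite RintegralZl// RintegralD//; last exact: icst.
rewrite RintegralZl// Rintegral_cst// muband /energy le_eqVlt.
by apply/orP; left; apply/eqP; field; rewrite gt_eqF.
Qed.

Let meta : measurable_fun setT eta.
Proof.
exact: (measurable_osc Q measurable_ratio_re measurable_ratio_im ratio_re_bound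
  ratio_im_bound).
Qed.

Lemma measurable_phitilde k :
  measurable_fun setT (fun y => complex.Re (phitilde phi nu j k y)).
Proof.
rewrite (_ : (fun y => _) = fun y => (2 * pi)^-1 * eta (y - s * k%:~R)); last first.
  by apply/funext => y; exact: phitildeE.
apply: measurable_funM => //.
apply: (measurableT_comp meta); exact: measurable_funB.
Qed.

(** With k = 2^j delta sqrt(a/pi) in eta_le the two terms are equal. *)
Lemma phitilde_bound k y :
  `|complex.Re (phitilde phi nu j k y)| <= Num.sqrt (a / pi) / dl.
Proof.
have pi0 : 0 < pi :> R := pi_gt0 R.
rewrite phitildeE normrM (ger0_norm (_ : 0 <= (2 * pi)^-1)); last first.
  by rewrite invr_ge0 mulr_ge0 ?(ltW pi0).
pose r := Num.sqrt (a / pi).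
have r0 : 0 < r by rewrite sqrtr_gt0 divr_gt0.
have r2 : a = r ^+ 2 * pi by rewrite sqr_sqrtr ?divr_ge0 ?ltW// divfK// gt_eqF.
have k0 : 0 < dl * q * r by rewrite !mulr_gt0.
apply: (@le_trans _ _ ((2 * pi)^-1 *
   ((dl * q * r * (2 * pi / (q * dl ^+ 2)) + 2 * Q / (dl * q * r)) / 2))).
  rewrite ler_wpM2l ?invr_ge0 ?mulr_ge0 ?(ltW pi0)//.
  apply: le_trans (eta_le _ k0) _.
  by rewrite ler_wpM2r// lerD2r ler_wpM2l ?(ltW k0)//; exact: energy_ratio_le2.
rewrite -/r le_eqVlt; apply/orP; left; apply/eqP.
rewrite (_ : 2 * Q = 2 * (q * (r ^+ 2 * pi))); last by rewrite -r2.
exact: phitilde_constant.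
Qed.

Lemma phitilde_sqr_integral k :
  (\int[mu]_y (complex.Re (phitilde phi nu j k y) ^+ 2)%:E <=
   (a / pi * L ^+ 2 / (q * dl ^+ 2))%:E)%E.
Proof.
have pi0 : 0 < pi :> R := pi_gt0 R.
under eq_integral do rewrite phitildeE exprMn EFinM.
rewrite ge0_integralZl_EFin//; last 3 first.
- by move=> y _; rewrite lee_fin sqr_ge0.
- apply/measurable_EFinP; apply: measurable_funX.
  by apply: (measurableT_comp meta); exact: measurable_funB.
- by rewrite sqr_ge0.
rewrite (integral_translation (f := fun y => eta y ^+ 2)); last exact: measurable_funX.
have := plancherel_osc measurable_ratio_re measurable_ratio_im ratio_re_bound
  ratio_im_bound ltr01 Q0.
under eq_integral do rewrite mul1r.
rewrite divr1 => h.
apply: (@le_trans _ _ (((2 * pi)^-1 ^+ 2)%:E * (2 * pi * energy ratio_re ratio_im Q)%:E)%E).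
  by apply: lee_wpmul2l => //; rewrite lee_fin sqr_ge0.
rewrite -EFinM lee_fin.
apply: (@le_trans _ _ ((2 * pi)^-1 ^+ 2 * (2 * pi * (2 * a * L ^+ 2 / (q * dl ^+ 2))))).
  rewrite ler_wpM2l ?sqr_ge0// ler_wpM2l ?mulr_ge0 ?(ltW pi0)//.
  exact: energy_ratio_le1.
by rewrite phitilde_sqr_constant.
Qed.

(** The translations have step 2^-j, and Bessel's inequality wants Q 2^-j = a to
    be a multiple of pi: the band is first enlarged to half-width 2^j N' pi. *)
Lemma phitilde_sqr_sum (N' N : nat) y : a <= N'%:R * pi ->
  \sum_(i < N) complex.Re (phitilde phi nu j (zenum i) y) ^+ 2 <=
  N'%:R * a * L ^+ 2 / (pi * dl ^+ 2).
Proof.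
move=> aN.
have pi0 : 0 < pi :> R := pi_gt0 R.
have N0 : (0 < N')%N.
  by rewrite lt0n; apply/negP => /eqP N0; move: aN; rewrite N0 mul0r leNgt a0.
have NR0 : 0 < N'%:R :> R by rewrite ltr0n.
(* The enlarged half-width is commensurable with the step of the translations. *)
pose Q' := q * (N'%:R * pi).
have QQ' : Q <= Q' by rewrite ler_wpM2l// ltW.
have Q'0 : 0 < Q' by exact: lt_le_trans QQ'.
have Q's : Q' * s = N'%:R * pi by rewrite /Q' mulrC mulKf// gt_eqF.
(* Increasing k moves the argument of eta to the left: the progression is run
   backwards. *)
have us : uniq [seq - zenum i | i <- iota 0 N].
  by rewrite (map_comp -%R zenum) (map_inj_uniq oppr_inj) (map_inj_uniq zenum_inj) iota_uniq.
have := bessel measurable_ratio_re measurable_ratio_im ratio_re_bound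
  ratio_im_bound y Q'0 Q's N0 us.
rewrite big_map -{1}(subn0 N) -/(index_iota 0 N) big_mkord -energy_window// => h.
apply: (@le_trans _ _ ((2 * pi)^-1 ^+ 2 * (2 * Q' * energy ratio_re ratio_im Q))).
  apply: le_trans (_ : (2 * pi)^-1 ^+ 2 * (\sum_(i < N)
     osc ratio_re ratio_im Q' (y + s * (- zenum i)%:~R) ^+ 2) <= _).
    rewrite le_eqVlt; apply/orP; left; apply/eqP; rewrite mulr_sumr.
    apply: eq_bigr => i _; rewrite phitildeE exprMn (eta_window _ QQ').
    by rewrite mulrNz mulrN.
  by rewrite ler_wpM2l ?sqr_ge0.
apply: (@le_trans _ _ ((2 * pi)^-1 ^+ 2 * (2 * Q' * (2 * a * L ^+ 2 / (q * dl ^+ 2))))).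
  rewrite ler_wpM2l ?sqr_ge0//; apply: ler_wpM2l; first by rewrite mulr_ge0 ?(ltW Q'0).
  exact: energy_ratio_le1.
by rewrite /Q' phitilde_sum_constant.
Qed.

End Phitilde.

(** * Truncation of absolutely summable families *)

Section Zsum.
Context {R : realType}.
Implicit Types (c b : int -> R) (s : seq int).

Definition abs_tail c s : \bar R := \esum_(k in ~` [set` s]) (`|c k|)%:E.

Lemma esum_seq s (w : int -> R) : uniq s -> (forall k, 0 <= w k) ->
  \esum_(k in [set` s]) (w k)%:E = (\sum_(k <- s) w k)%:E.
Proof.
move=> us w0; rewrite esum_fset//; last by move=> i _; rewrite lee_fin.
  by rewrite -fsbig_seq// sumEFin.
exact: finite_seq.
Qed.

Lemma esum_split s (w : int -> R) : uniq s -> (forall k, 0 <= w k) ->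
  (\esum_(k in [set: int]) (w k)%:E =
   (\sum_(k <- s) w k)%:E + \esum_(k in ~` [set` s]) (w k)%:E)%E.
Proof.
move=> us w0; rewrite (esumID [set` s]); last by move=> k _; rewrite lee_fin.
by rewrite !setTI esum_seq.
Qed.

(** The complement of a finite set whose partial sum is within e of the total. *)
Lemma exists_small_tail c (e : R) : 0 < e ->
  (\esum_(k in [set: int]) (`|c k|)%:E < +oo)%E ->
  exists2 s, uniq s & (abs_tail c s <= e%:E)%E.
Proof.
move=> e0 cfin.
have c0 : (0 <= \esum_(k in [set: int]) (`|c k|)%:E)%E.
  by apply: esum_ge0 => k _; rewrite lee_fin.
have cnum : (\esum_(k in [set: int]) (`|c k|)%:E \is a fin_num)%E.
  by rewrite ge0_fin_numE.
have [_ [X [finX _] <-] hX] := ub_ereal_sup_adherent e0 cnum.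
have [s0 Xs] := (iffLR (finite_seqP X)) finX.
pose s := undup s0; have us : uniq s by exact: undup_uniq.
have {}Xs : X = [set` s] by rewrite Xs; apply/seteqP; split => k /=; rewrite mem_undup.
exists s => //.
rewrite Xs -fsbig_seq// sumEFin -/(esum setT (fun k => (`|c k|)%:E)) in hX.
rewrite (esum_split us) // -/(abs_tail c s) in hX.
move: hX; set S := \sum_(k <- s) _; case: (abs_tail c s) => [t| |] /=.
- by rewrite -!EFinD !lte_fin lee_fin; lra.
- by rewrite addeC.
- by rewrite leNye.
Qed.

(** The error does not depend on b, apart from its bound M: for families c x in
    place of c this makes the truncation uniform in the second variable. Positive
    and negative parts of the tail are both at most M e, so their difference is. *)
Lemma zsum_approx c b s (M e : R) : uniq s -> (abs_tail c s <= e%:E)%E ->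
  (forall k, `|b k| <= M) ->
  `|zsum (fun k => c k * b k) - \sum_(k <- s) c k * b k| <= M * e.
Proof.
move=> us tail bM.
have M0 : 0 <= M by exact: le_trans (bM 0).
have tb (w : int -> R) : (forall k, 0 <= w k <= M * `|c k|) ->
    exists2 t, (\esum_(k in ~` [set` s]) (w k)%:E = t%:E)%E & 0 <= t <= M * e.
  move=> wM.
  have t0 : (0 <= \esum_(k in ~` [set` s]) (w k)%:E)%E.
    by apply: esum_ge0 => k _; rewrite lee_fin; case/andP: (wM k).
  have tM : (\esum_(k in ~` [set` s]) (w k)%:E <= (M * e)%:E)%E.
    apply: ge_ereal_sup => _ [X [finX Xs] <-].
    apply: (@le_trans _ _ (\sum_(k \in X) (M%:E * (`|c k|)%:E)%E)).
      by apply: lee_fsum => // k _; rewrite -EFinM lee_fin; case/andP: (wM k).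
    rewrite -ge0_mule_fsumr; last by move=> k; rewrite lee_fin.
    rewrite EFinM lee_wpmul2l ?lee_fin//; apply: le_trans tail.
    by apply: esum_ge; exists X.
  exists (fine (\esum_(k in ~` [set` s]) (w k)%:E)).
    by rewrite fineK// ge0_fin_numE// (le_lt_trans tM)// ltry.
  by rewrite fine_ge0//= -lee_fin fineK// ge0_fin_numE// (le_lt_trans tM)// ltry.
pose p k := Num.max (c k * b k) 0; pose m k := Num.max (- (c k * b k)) 0.
have cbM k : `|c k * b k| <= M * `|c k| by rewrite normrM mulrC ler_wpM2r.
have p0 k : 0 <= p k by rewrite le_max lexx orbT.
have m0 k : 0 <= m k by rewrite le_max lexx orbT.
have [tp tpE /andP[tp0 tpM]] : exists2 t,
    (\esum_(k in ~` [set` s]) (p k)%:E = t%:E)%E & 0 <= t <= M * e.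
  apply: tb => k; rewrite p0/= ge_max mulr_ge0// andbT.
  by rewrite (le_trans (ler_norm _))// cbM.
have [tm tmE /andP[tm0 tmM]] : exists2 t,
    (\esum_(k in ~` [set` s]) (m k)%:E = t%:E)%E & 0 <= t <= M * e.
  apply: tb => k; rewrite m0/= ge_max mulr_ge0// andbT.
  by rewrite (le_trans (ler_norm _))// normrN cbM.
have -> : zsum (fun k => c k * b k) =
    \sum_(k <- s) p k + tp - (\sum_(k <- s) m k + tm).
  rewrite /zsum.
  rewrite (_ : \esum_(k in setT) (EFin \o (fun k => (c k * b k)%R))^\+%E k =
      (\sum_(k <- s) p k + tp)%:E); last first.
    rewrite EFinD -tpE -esum_split//; apply: eq_esum => k _.
    by rewrite funepos.unlock /= EFin_max.
  rewrite (_ : \esum_(k in setT) (EFin \o (fun k => (c k * b k)%R))^\-%E k =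
      (\sum_(k <- s) m k + tm)%:E); last first.
    rewrite EFinD -tmE -esum_split//; apply: eq_esum => k _.
    by rewrite funeneg.unlock /= EFin_max.
  by [].
have -> : \sum_(k <- s) p k + tp - (\sum_(k <- s) m k + tm) - \sum_(k <- s) c k * b k = tp - tm.
  have : \sum_(k <- s) p k - \sum_(k <- s) m k = \sum_(k <- s) c k * b k.
    rewrite -sumrB; apply: eq_bigr => k _; rewrite /p /m.
    have [h|h] := leP (c k * b k) 0.
      by rewrite max_l ?oppr_ge0//; ring.
    by rewrite max_r ?oppr_le0 ?(ltW h)//; ring.
  by move=> <-; ring.
by rewrite ler_norml; apply/andP; split; lra.
Qed.

End Zsum.

(** * Classes of absolutely summable series *)

Section SeriesClass.
Context {R : realType} (X : pointedType).
Variables (c : X -> int -> R) (B : int -> R -> R) (C M : R).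
Hypothesis cC : forall x, (\esum_(k in [set: int]) (`|c x k|)%:E <= C%:E)%E.
Hypothesis mB : forall k, measurable_fun setT (B k).
Hypothesis BM : forall k y, `|B k y| <= M.

Definition series_class x y : R := zsum (fun k => c x k * B k y).
Local Notation Z := series_class.

Let M0 : 0 <= M. Proof. exact: le_trans (BM 0 0). Qed.

Let C0 : 0 <= C.
Proof.
rewrite -lee_fin; apply: le_trans (cC point).
by apply: esum_ge0 => k _; rewrite lee_fin.
Qed.

Let cfin x : (\esum_(k in [set: int]) (`|c x k|)%:E < +oo)%E.
Proof. by rewrite (le_lt_trans (cC x))// ltry. Qed.

Let sum_le x s : uniq s -> \sum_(k <- s) `|c x k| <= C.
Proof.
move=> us; rewrite -lee_fin; apply: le_trans (cC x).
rewrite (esum_split us)// leeDl//.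
by apply: esum_ge0 => k _; rewrite lee_fin.
Qed.

Let approx x (e : R) : 0 < e -> exists2 s, uniq s &
  forall y, `|Z x y - \sum_(k <- s) c x k * B k y| <= M * e.
Proof.
move=> e0; have [s us tl] := exists_small_tail e0 (cfin x).
by exists s => // y; exact: zsum_approx.
Qed.

Let partial_le x s y (S : R) : uniq s -> (forall k, `|B k y| <= S) ->
  `|\sum_(k <- s) c x k * B k y| <= C * S.
Proof.
move=> us BS; have S0 : 0 <= S by exact: le_trans (BS 0).
apply: le_trans (ler_norm_sum _ _ _) _.
apply: (@le_trans _ _ (\sum_(k <- s) `|c x k| * S)).
  by apply: ler_sum => k _; rewrite normrM ler_wpM2l.
by rewrite -mulr_suml ler_wpM2r// sum_le.
Qed.

Lemma series_class_bound x y : `|Z x y| <= C * M.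
Proof.
apply/ler_addgt0Pr => e e0.
have M1 : 0 < M + 1 by rewrite ltr_wpDl.
have [s us h] := approx x (divr_gt0 e0 M1).
rewrite -[Z x y](subrK (\sum_(k <- s) c x k * B k y)).
rewrite (le_trans (ler_normD _ _))// addrC lerD//; first exact: partial_le.
rewrite (le_trans (h y))// mulrCA ler_piMr ?(ltW e0)//.
by rewrite ler_pdivrMr// mul1r lerDl.
Qed.

Lemma measurable_series_class x : measurable_fun setT (Z x).
Proof.
have /choice[s hs] : forall i : nat, exists s, uniq s /\
    forall y, `|Z x y - \sum_(k <- s) c x k * B k y| <= M * i.+1%:R^-1.
  by move=> i; have [//|s us h] := approx x (e := i.+1%:R^-1); exists s.
apply: (@measurable_fun_cvg _ _ _ _ (fun i y => \sum_(k <- s i) c x k * B k y)).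
  by move=> i; apply: measurable_sum => k; exact: measurable_funM.
move=> y _; apply/cvgrPdist_le => e e0.
have M1 : 0 < M + 1 by rewrite ltr_wpDl.
have e1 : 0 < e / (M + 1) by rewrite divr_gt0.
have := near_infty_natSinv_lt (PosNum e1); apply: filterS => i /= hi.
have [_ /(_ y) h] := hs i; apply: le_trans h _.
apply: (@le_trans _ _ (M * (e / (M + 1)))); first by rewrite ler_wpM2l// ltW.
by rewrite mulrA mulrAC ler_piMl ?(ltW e0)// ler_pdivrMr// mul1r lerDl.
Qed.

(** The Cauchy-Schwarz inequality with the weights |c x k|, whose total mass is at
    most C, is applied to a finite truncation whose error is at most t. *)
Lemma series_class_sqr d (T : measurableType d) (P : probability T R)
    (Y : T -> R) (v : R) x : measurable_fun setT Y ->
  (forall k, (\int[P]_w (B k (Y w) ^+ 2)%:E <= v%:E)%E) ->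
  (\int[P]_w (Z x (Y w) ^+ 2)%:E <= (C ^+ 2 * v)%:E)%E.
Proof.
move=> mY Bv.
have v0 : 0 <= v.
  rewrite -lee_fin; apply: le_trans (Bv 0).
  by apply: integral_ge0 => w _; rewrite lee_fin sqr_ge0.
apply/lee_addgt0Pr => e e0.
pose K := 2 * M * (C * M) + M ^+ 2 + 1.
have K0 : 0 < K.
  by rewrite ltr_wpDl// addr_ge0 ?sqr_ge0// !mulr_ge0.
pose t := Num.min 1 (e / K).
have t0 : 0 < t by rewrite lt_min ltr01 divr_gt0.
have tK : t * K <= e by rewrite -ler_pdivlMr// ge_min lexx orbT.
have t1 : t <= 1 by rewrite ge_min lexx.
have [s us h] := approx x t0.
pose S y := \sum_(k <- s) c x k * B k y.
have S2 y : S y ^+ 2 <= C * \sum_(k <- s) `|c x k| * B k y ^+ 2.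
  have Sk k : 2 * C * S y * (c x k * B k y) <=
      C ^+ 2 * (`|c x k| * B k y ^+ 2) + S y ^+ 2 * `|c x k|.
    have h1 : 2 * C * S y * (c x k * B k y) <= `|c x k| * (2 * (`|C * B k y| * `|S y|)).
      apply: le_trans (ler_norm _) _; rewrite !normrM (ger0_norm (ler0n _ 2)).
      by rewrite [leLHS](_ : _ = `|c x k| * (2 * (`|C| * `|B k y| * `|S y|))); last ring.
    apply: le_trans h1 _.
    have h2 : 2 * (`|C * B k y| * `|S y|) <= (C * B k y) ^+ 2 + S y ^+ 2.
      have := sqr_ge0 (`|C * B k y| - `|S y|).
      by rewrite sqrrB !real_normK ?num_real// -mulr_natl; lra.
    apply: le_trans (ler_wpM2l (normr_ge0 _) h2) _.
    by rewrite [leLHS](_ : _ = C ^+ 2 * (`|c x k| * B k y ^+ 2) + S y ^+ 2 * `|c x k|); last ring.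
  have h3 : 2 * C * S y * (\sum_(k <- s) c x k * B k y) <=
      C ^+ 2 * (\sum_(k <- s) `|c x k| * B k y ^+ 2) + S y ^+ 2 * \sum_(k <- s) `|c x k|.
    move: (S y) Sk => q Sk; rewrite !mulr_sumr -big_split/=.
    by apply: ler_sum => k _; exact: Sk.
  have h4 : S y ^+ 2 * \sum_(k <- s) `|c x k| <= S y ^+ 2 * C.
    by rewrite ler_wpM2l ?sqr_ge0// sum_le.
  move: C0; rewrite le_eqVlt => /orP[/eqP C00|Cp].
    have : `|S y| <= C * M by exact: partial_le.
    rewrite -C00 mul0r.
    by rewrite normr_le0 => /eqP ->; rewrite expr0n mul0r.
  rewrite -(ler_pM2l Cp).
  move: h3 h4; set Q := \sum_(k <- s) `|c x k| * _; set W := \sum_(k <- s) _ => h3 h4.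
  have := le_trans h3 (lerD (lexx _) h4).
  rewrite -/(S y); have -> : 2 * C * S y * S y = 2 * (C * S y ^+ 2) by ring.
  have -> : C * (C * Q) = C ^+ 2 * Q by ring.
  by rewrite (mulrC (S y ^+ 2) C); lra.
have Zle y : Z x y ^+ 2 <= C * (\sum_(k <- s) `|c x k| * B k y ^+ 2) + t * K.
  have hS : `|S y| <= C * M by exact: partial_le.
  have hD : `|Z x y - S y| <= M * t by exact: h.
  have -> : Z x y ^+ 2 = S y ^+ 2 + (2 * S y * (Z x y - S y) + (Z x y - S y) ^+ 2) by ring.
  rewrite lerD//.
  apply: (@le_trans _ _ (2 * (C * M) * (M * t) + (M * t) ^+ 2)).
    rewrite lerD//.
      apply: le_trans (ler_norm _) _; rewrite !normrM (ger0_norm (ler0n _ 2)) -!mulrA.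
      by rewrite ler_wpM2l// mulrA; apply: ler_pM.
    by rewrite -[leLHS]real_normK ?num_real// lerXn2r// nnegrE mulr_ge0// ltW.
  have : t * t <= t * 1 by rewrite ler_wpM2l// ltW.
  move=> /(ler_wpM2l (sqr_ge0 M)); rewrite mulr1 /K => h5.
  have -> : (M * t) ^+ 2 = M ^+ 2 * (t * t) by ring.
  have -> : t * (2 * M * (C * M) + M ^+ 2 + 1) =
     2 * (C * M) * (M * t) + M ^+ 2 * t + t by ring.
  by rewrite -addrA lerD2l ler_wpDr// ltW.
have mB2 k : measurable_fun setT (fun w => B k (Y w) ^+ 2).
  by apply: measurable_funX; exact: measurableT_comp.
apply: (@le_trans _ _ (\int[P]_w (C%:E * \sum_(k <- s) (`|c x k|)%:E * (B k (Y w) ^+ 2)%:E + e%:E))%E).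
  apply: ge0_le_integral => //=.
  - by move=> w _; rewrite lee_fin sqr_ge0.
  - by apply/measurable_EFinP/measurable_funX; apply: measurableT_comp => //; exact: measurable_series_class.
  - apply: emeasurable_funD => //; apply: emeasurable_funM => //.
    by apply: emeasurable_sum => k; apply: emeasurable_funM => //; exact/measurable_EFinP.
  - move=> w _; rewrite sumEFin -EFinM -EFinD lee_fin.
    by apply: le_trans (Zle _) _; rewrite lerD2l.
have t0' w k : (0 <= (`|c x k|)%:E * (B k (Y w) ^+ 2)%:E)%E.
  by rewrite mule_ge0// lee_fin// sqr_ge0.
have mt k : measurable_fun setT (fun w => (`|c x k|)%:E * (B k (Y w) ^+ 2)%:E)%E.
  by apply: emeasurable_funM => //; exact/measurable_EFinP.
rewrite ge0_integralD//=; last first.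
- by rewrite lee_fin ltW.
- by apply: emeasurable_funM => //; exact: emeasurable_sum.
- by move=> w _; rewrite mule_ge0 ?lee_fin//; exact: sume_ge0.
have -> : (\int[P]__ e%:E = e%:E)%E by rewrite integral_cst//= [X in (_ * X)%E]probability_setT mule1.
rewrite leeD2r//.
rewrite ge0_integralZl//=; last first.
- by move=> w _; exact: sume_ge0.
- exact: emeasurable_sum.
rewrite ge0_integral_sum//.
rewrite expr2 -mulrA EFinM lee_wpmul2l ?lee_fin//.
apply: (@le_trans _ _ (\sum_(k <- s) (`|c x k| * v)%:E)%E).
  apply: lee_sum => k _; rewrite ge0_integralZl//=.
  - by rewrite EFinM lee_wpmul2l ?lee_fin.
  - exact/measurable_EFinP.
  - by move=> w _; rewrite lee_fin sqr_ge0.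
by rewrite sumEFin lee_fin -mulr_suml ler_wpM2r// sum_le.
Qed.

(** A finite list of integer positions with rational values that approximates c x
    in l^1. There are countably many such lists, and two points with the same list
    have close series. *)
Definition close_to (L : seq (int * rat)) (e : R) x : Prop :=
  [/\ uniq (unzip1 L), (abs_tail (c x) (unzip1 L) <= e%:E)%E &
      \sum_(p <- L) `|c x p.1 - ratr p.2| <= e].

Let close_diff L e x x' y : close_to L e x -> close_to L e x' ->
  `|Z x y - Z x' y| <= 4 * (M * e).
Proof.
move=> [us tx rx] [_ tx' rx'].
have h1 := zsum_approx us tx (fun k => BM k y).
have h2 := zsum_approx us tx' (fun k => BM k y).
have h3 : `|\sum_(k <- unzip1 L) c x k * B k y -
   \sum_(k <- unzip1 L) c x' k * B k y| <= M * e + M * e.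
  rewrite !big_map -sumrB.
  apply: (@le_trans _ _ (\sum_(p <- L) (M * `|c x p.1 - ratr p.2| +
       M * `|c x' p.1 - ratr p.2|))).
    apply: le_trans (ler_norm_sum _ _ _) _; apply: ler_sum => p _.
    rewrite -mulrBl normrM mulrC -mulrDr; apply: ler_pM => //.
    have -> : c x p.1 - c x' p.1 = (c x p.1 - ratr p.2) - (c x' p.1 - ratr p.2) by ring.
    exact: ler_normB.
  by rewrite big_split/= -!mulr_sumr lerD// ler_wpM2l.
rewrite /series_class in h1 h2 *.
set a := zsum _ in h1 *; set b := zsum _ in h2 *.
set a' := \sum_(k <- _) _ in h1 h3; set b' := \sum_(k <- _) c x' k * _ in h2 h3.
move: h1 h2 h3; rewrite !ler_norml => /andP[p1 p2] /andP[p3 p4] /andP[p5 p6].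
by apply/andP; split; lra.
Qed.

Let close_exists e x : 0 < e -> exists L, close_to L e x.
Proof.
move=> e0; have [s us tl] := exists_small_tail e0 (cfin x).
(* An equal share of the error for each of the finitely many positions. *)
pose d := e / (size s).+1%:R.
have d0 : 0 < d by rewrite divr_gt0.
have /choice[rho hrho] : forall k, exists q : rat, `|c x k - ratr q| <= d.
  move=> k; have : c x k - d < c x k + d by rewrite ltrD2l gtrN.
  move=> /rat_in_itvoo[q]; rewrite in_itv/= => /andP[q1 q2]; exists q.
  by rewrite ler_distlC; apply/andP; split; lra.
exists [seq (k, rho k) | k <- s].
have s1 : unzip1 [seq (k, rho k) | k <- s] = s by rewrite /unzip1 -map_comp map_id.
split; rewrite ?s1//.
rewrite big_map; apply: (@le_trans _ _ (\sum_(k <- s) d)).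
  by apply: ler_sum => k _; exact: hrho.
rewrite big_const_seq count_predT iter_addr_0 -mulr_natr /d -mulrA.
by rewrite ler_piMr ?(ltW e0)// ler_pdivrMl// mulr1 ler_nat.
Qed.

(** The sequences of coefficients lie in l^1, which is separable, although the
    index set need not be; one point is chosen for each approximating list. *)
Lemma series_class_dense : exists xi : nat -> X, forall x (e : R), 0 < e ->
  exists i, forall y, `|Z x y - Z (xi i) y| <= e.
Proof.
pose xi (i : nat) : X :=
  if unpickle i is Some (L, n) then
    get [set x | close_to L n.+1%:R^-1 x] else point.
exists xi => x e e0.
have M1 : 0 < 4 * M + 1 by rewrite ltr_wpDl// mulr_ge0.
pose n := Num.truncn ((4 * M + 1) / e).
have n1 : n.+1%:R^-1 <= e / (4 * M + 1).
  rewrite -[leRHS]invf_div lef_pV2 ?posrE ?divr_gt0//.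
  by rewrite ltW// truncnS_gt.
have n0 : 0 < n.+1%:R^-1 :> R by rewrite invr_gt0.
have [L hL] := close_exists x n0.
exists (pickle (L, n)) => y; rewrite /xi pickleK.
have hg : close_to L n.+1%:R^-1 (get [set x | close_to L n.+1%:R^-1 x]).
  exact: (@getI _ [set x | close_to L n.+1%:R^-1 x] x hL).
apply: le_trans (close_diff y hL hg) _.
have h1 : M * n.+1%:R^-1 <= M * (e / (4 * M + 1)) by rewrite ler_wpM2l.
apply: (@le_trans _ _ (4 * (M * (e / (4 * M + 1))))); first by rewrite ler_wpM2l.
have -> : 4 * (M * (e / (4 * M + 1))) = (4 * M) * e / (4 * M + 1) by ring.
by rewrite ler_pdivrMr// mulrC ler_wpM2l ?(ltW e0)// lerDl.
Qed.

(** Each series is in C times the closed convex hull of the functions B k and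
    their opposites, over which a linear form does not increase its supremum. *)
Lemma series_class_lincomb (n : nat) (r y : 'I_n -> R) x (S : R) :
  (forall k, `|\sum_m r m * B k (y m)| <= S) ->
  `|\sum_m r m * Z x (y m)| <= C * S.
Proof.
move=> BS; apply/ler_addgt0Pr => e e0.
have S0 : 0 <= S by exact: le_trans (BS 0).
pose K := \sum_m `|r m| * M.
have K0 : 0 <= K by apply: sumr_ge0 => m _; rewrite mulr_ge0.
have K1 : 0 < K + 1 by rewrite ltr_wpDl.
have [s us h] := approx x (divr_gt0 e0 K1).
have -> : \sum_m r m * Z x (y m) =
   \sum_m r m * (\sum_(k <- s) c x k * B k (y m)) +
   \sum_m r m * (Z x (y m) - \sum_(k <- s) c x k * B k (y m)).
  by rewrite -big_split/=; apply: eq_bigr => m _; ring.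
rewrite (le_trans (ler_normD _ _))// lerD//.
  have -> : \sum_m r m * (\sum_(k <- s) c x k * B k (y m)) =
     \sum_(k <- s) c x k * (\sum_m r m * B k (y m)).
    under eq_bigr do rewrite mulr_sumr.
    rewrite exchange_big/=; apply: eq_bigr => k _; rewrite mulr_sumr.
    by apply: eq_bigr => m _; ring.
  apply: le_trans (ler_norm_sum _ _ _) _.
  apply: (@le_trans _ _ (\sum_(k <- s) `|c x k| * S)).
    by apply: ler_sum => k _; rewrite normrM ler_wpM2l.
  by rewrite -mulr_suml ler_wpM2r// sum_le.
apply: le_trans (ler_norm_sum _ _ _) _.
apply: (@le_trans _ _ (\sum_m `|r m| * M * (e / (K + 1)))).
  by apply: ler_sum => m _; rewrite normrM -mulrA ler_wpM2l.
rewrite -mulr_suml -/K mulrA mulrAC ler_piMl ?(ltW e0)//.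
by rewrite ler_pdivrMr// mul1r lerDl.
Qed.

End SeriesClass.

(** * Consequences of the wavelet condition *)

Section WaveletFacts.
Context {R : realType}.
Local Notation mu := (@lebesgue_measure R).
Variables (phi psi : R -> R) (a' a : R).
Hypothesis hw : wavelet_condition phi psi a' a.

Lemma wavelet_measurable : measurable_fun setT phi.
Proof.
have [_ [/(_ 1%E (lexx _))[h _] _]] := hw.
by move: (sub_Lfun_mfun h); rewrite inE.
Qed.

Lemma wavelet_integrable : mu.-integrable setT (EFin \o phi).
Proof.
have [_ [/(_ 1%E (lexx _))[h _] _]] := hw.
apply/integrableP; split; first by apply: measurableT_comp => //; exact: wavelet_measurable.
by move: (sub_Lfun_finLfun h); rewrite inE/= /finite_norm Lnorm1.
Qed.

Lemma wavelet_norm1 : fine 'N[mu]_1[EFin \o phi] = norm1 phi.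
Proof. by rewrite Lnorm1. Qed.

(** phi is its own translate by 0, an element of an orthonormal family. *)
Lemma wavelet_sqr_integral : (\int[mu]_x (phi x ^+ 2)%:E = 1%:E)%E.
Proof.
have [[V [[_ [_ [_ [_ [_ [_ /(_ 0 0) ob _]]]]]] _]] _] := hw.
have : dot2 phi phi = 1.
  rewrite -[RHS]ob /dot2; congr (Rintegral _ _ _); apply/funext => x.
  by rewrite /translates subr0.
rewrite /dot2 /Rintegral; under eq_integral do rewrite -expr2.
by case: (integral _ _ _) => [r /= ->//| |] /= /eqP; rewrite eq_sym oner_eq0.
Qed.

(** Otherwise phi would vanish identically, against its unit norm. *)
Lemma csum_gt0 : 0 < fine (csum phi).
Proof.
have [_ [_ [_ [_ [_ [cy _]]]]]] := hw.
have c0 : (0 <= csum phi)%E.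
  apply: le_trans (ereal_sup_ubound _ ); last by exists 0.
  by apply: esum_ge0.
rewrite lt_neqAle fine_ge0// andbT; apply/eqP => cE.
have c00 : csum phi = 0%E by rewrite -[csum phi]fineK ?ge0_fin_numE// -cE.
have phi0 x : phi x = 0.
  apply/eqP; rewrite -normr_le0 -lee_fin -[0%:E]/0%E -c00.
  apply: le_trans (ereal_sup_ubound _ ); last by exists x.
  apply: esum_ge; exists [set 0]; first by split => //; exact: finite_set1.
  by rewrite fsbig_set1 subr0.
have := wavelet_sqr_integral; rewrite (eq_integral (fun=> 0%E)) ?integral0.
  by move=> [] /eqP; rewrite eq_sym oner_eq0.
by move=> x _; rewrite phi0 expr0n.
Qed.

Lemma csum_dilated (s x : R) :
  (\esum_(k in [set: int]) (`|phi (s * x - k%:~R)|)%:E <= (fine (csum phi))%:E)%E.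
Proof.
have [_ [_ [_ [_ [_ [cy _]]]]]] := hw.
rewrite fineK; first by apply: ereal_sup_ubound; exists (s * x).
rewrite ge0_fin_numE//; apply: le_trans (ereal_sup_ubound _ ); last by exists 0.
exact: esum_ge0.
Qed.

End WaveletFacts.

(** * The law of the observations *)

Section SameLaw.
Context {R : realType} d (T : measurableType d) (P : probability T R).
Local Notation mT := (measurableTypeR R).
Variables Z S : T -> mT.
Hypotheses (mZ : measurable_fun setT Z) (mS : measurable_fun setT S).
Hypothesis lawZS : forall A : set mT, measurable A -> P (Z @^-1` A) = P (S @^-1` A).
Local Open Scope ereal_scope.

Let S_mixin := isMeasurableFun.Build _ _ _ _ _ mS.
Let S_rv : {mfun T >-> mT} := HB.pack S S_mixin.

Lemma ge0_integral_same_law (h : mT -> R) : measurable_fun setT h ->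
  (forall x, 0 <= h x)%R ->
  \int[P]_w (h (Z w))%:E = \int[P]_w (h (S w))%:E.
Proof.
move=> mh h0.
have h0E (y : mT) : 0 <= (h y)%:E by rewrite lee_fin.
have mhE : measurable_fun setT (EFin \o h : mT -> \bar R).
  exact/(@measurable_EFinP _ mT).
apply: etrans (ge0_integral_distribution S_rv mhE h0E).
have := @ge0_integral_weight _ _ _ _ R P (distribution P S_rv) (fun=> 1%R)
   Z 1%R (measurable_cst _) (fun=> ler01) mZ ler01 _ h mh h0.
under eq_integral do rewrite mul1r.
rewrite mul1e; apply => B mB.
under eq_integral do rewrite mul1r.
rewrite mul1e; apply: etrans (lawZS mB).
have mB' : measurable [set w | B (Z w)].
  by rewrite -[X in measurable X]setTI; exact: mZ.
by rewrite -[X in _ = P X]setIT -integral_indic.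
Qed.

(** Adding the bound M makes h nonnegative. *)
Lemma bounded_integral_same_law (h : mT -> R) (M : R) : measurable_fun setT h ->
  (forall x, `|h x| <= M)%R ->
  \int[P]_w (h (Z w))%:E = \int[P]_w (h (S w))%:E.
Proof.
move=> mh hM.
have shift (V : T -> mT) : measurable_fun setT V ->
    \int[P]_w (h (V w) + M)%:E = \int[P]_w (h (V w))%:E + M%:E.
  move=> mV; rewrite -[X in _ = _ + X](_ : \int[P]_w M%:E = _); last first.
    by rewrite integral_cst//= [X in _ * X]probability_setT mule1.
  rewrite -integralD//.
  - by apply: (@bounded_integrable _ _ _ _ _ M) => //; exact: measurableT_comp.
  - by apply: (@bounded_integrable _ _ _ _ _ `|M|).
have := @ge0_integral_same_law (fun x => h x + M)%R.
rewrite (shift Z)// (shift S)// => E.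
rewrite -[LHS](@addeK _ M%:E)// E ?addeK//; first exact: measurable_funD.
by move=> x; rewrite -lerBlDr sub0r; have := hM x; rewrite ler_norml => /andP[].
Qed.

End SameLaw.

Section SumLaw.
Context {R : realType} d (T : measurableType d) (P : probability T R).
Local Notation mu := (@lebesgue_measure R).
Local Notation mT := (measurableTypeR R).
Variables (f : R -> R) (nu : probability mT R) (X e : {RV P >-> R}).
Hypothesis hm : deconvolution_model f nu X e.
Local Open Scope ereal_scope.

Let mf : measurable_fun setT (f : mT -> mT).
Proof. by have [[]] := hm. Qed.

Let f0 x : (0 <= f x)%R.
Proof. by have [[]] := hm. Qed.

Let mpair : measurable_fun setT (fun w => (X w, e w) : mT * mT).
Proof. by apply: measurable_fun_pair; [exact: (@measurable_funPT _ _ _ _ X)|exact: (@measurable_funPT _ _ _ _ e)]. Qed.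

Let pair_mixin := isMeasurableFun.Build _ _ _ _ _ mpair.
Let pair_rv : {mfun T >-> (mT * mT)%type} := HB.pack (fun w => (X w, e w) : mT * mT) pair_mixin.

Let mX : measurable_fun setT (X : T -> mT).
Proof. exact: (@measurable_funPT _ _ _ _ X). Qed.

Let X_mixin := isMeasurableFun.Build _ _ _ _ _ mX.
Let X_rv : {mfun T >-> mT} := HB.pack (X : T -> mT) X_mixin.
Let law_rv : probability mT R := distribution P X_rv.

(** Independence says that the two measures agree on rectangles. *)
Lemma joint_law (A : set (mT * mT)) : measurable A ->
  (law_rv \x nu) A = P [set w | A (X w, e w)].
Proof.
move=> mA.
apply: (@product_measure_unique _ _ mT mT R (law_rv) nu
  (pushforward P pair_rv) _ A mA) => B C mB mC.
have [_ _ lawe ind] := hm.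
change (P (X @^-1` B `&` e @^-1` C) = P (X @^-1` B) * nu C).
by rewrite ind// lawe.
Qed.

Lemma density_integral (g : mT -> R) : measurable_fun setT g -> (forall x, 0 <= g x)%R ->
  \int[mu]_x (f x * g x)%:E = \int[law_rv]_x (g x)%:E.
Proof.
move=> mg g0.
rewrite (@ge0_integral_weight _ _ _ _ R mu (law_rv) f id 1%R)// ?mul1e//.
move=> B mB; rewrite mul1e.
have [[_ _ dX] _ _ _] := hm.
change (\int[mu]_x (f x * \1_B x)%:E = P (X @^-1` B)).
by under eq_integral do rewrite mulrC; rewrite integral_indicM dX.
Qed.

(** X + e has the convolution of f and nu as density: the joint law is a product,
    and Tonelli's theorem exchanges the two integrals after a translation. *)
Lemma sum_expectation (h : R -> R) : measurable_fun setT h -> (forall x, 0 <= h x)%R ->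
  \int[P]_w (h (X w + e w)%R)%:E =
  \int[mu]_y ((h y)%:E * \int[nu]_u (f (y - u)%R)%:E).
Proof.
move=> mh h0.
have madd : measurable_fun setT (fun z : mT * mT => h (z.1 + z.2)%R).
  by apply: measurableT_comp => //; exact: measurable_funD.
have -> : \int[P]_w (h (X w + e w)%R)%:E =
    \int[law_rv \x nu]_z (h (z.1 + z.2)%R)%:E.
  have := @ge0_integral_weight _ _ _ _ R P (law_rv \x nu) (fun=> 1%R)
     (fun w => (X w, e w) : mT * mT) 1%R (measurable_cst _) (fun=> ler01) mpair ler01 _
     (fun z => h (z.1 + z.2)%R) madd.
  under eq_integral do rewrite mul1r.
  rewrite mul1e; apply => // B mB.
  under eq_integral do rewrite mul1r.
  rewrite mul1e; apply: etrans (esym (joint_law mB)).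
  have mB' : measurable [set w | B (X w, e w)].
    by rewrite -[X in measurable X]setTI; exact: mpair.
  by rewrite -[X in P X]setIT -integral_indic.
rewrite fubini_tonelli2//=; last 2 first.
- exact/measurable_EFinP.
- by move=> z; rewrite lee_fin.
transitivity (\int[nu]_u \int[mu]_y (f (y - u)%R * h y)%:E).
  apply: eq_integral => u _; rewrite /fubini_G/=.
  rewrite -density_integral//; last first.
    by apply: measurableT_comp => //; exact: measurable_funD.
  rewrite (@ge0_integral_translation _ u setT (fun y => (f (y - u)%R * h y)%:E))//.
  - by apply: eq_integral => x _; rewrite addrK.
  - apply/measurable_EFinP/measurable_funM => //.
    by apply: measurableT_comp => //; exact: measurable_funB.
  - by move=> x; rewrite lee_fin mulr_ge0.
rewrite -(@fubini_tonelli _ _ _ _ _ mu nu (fun z => (f (z.1 - z.2)%R * h z.1)%:E))/=; last 2 first.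
- apply/measurable_EFinP/measurable_funM; last exact: measurableT_comp.
  by apply: measurableT_comp => //; exact: measurable_funB.
- by move=> z; rewrite lee_fin mulr_ge0.
apply: eq_integral => y _.
rewrite -ge0_integralZl//; last 3 first.
- apply/measurable_EFinP; apply: measurableT_comp => //; exact: measurable_funB.
- by move=> u _; rewrite lee_fin.
- by rewrite lee_fin.
by apply: eq_integral => u _; rewrite mulrC EFinM.
Qed.

(** The convolution is bounded since f is; its essential supremum is therefore
    finite, and taking the finite part in linfty_norm loses nothing. *)
Lemma convolution_le : \forall y \ae mu,
  \int[nu]_u (f (y - u)%R)%:E <= (linfty_norm (convolution nu f))%:E.
Proof.
have [_ [M fM] _ _] := hm.
have cE y : (convolution nu f y)%:E = \int[nu]_u (f (y - u)%R)%:E.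
  rewrite /convolution EFin_Rintegral//; apply: (@bounded_integrable _ _ _ _ _ M) => //.
  by apply: measurableT_comp => //; exact: measurable_funB.
have c0 y : (0 <= convolution nu f y)%R by apply: Rintegral_ge0.
have mu0 : 0 < mu setT.
  apply: (@lt_le_trans _ _ (mu `[0%R, 1%R])).
    by rewrite lebesgue_measure_itv/= lte_fin ltr01 oppr0 adde0.
  by apply: le_measure; rewrite ?inE.
have cM y : (convolution nu f y)%:E <= M%:E.
  rewrite cE; apply: (@le_trans _ _ (\int[nu]_u M%:E)).
    apply: ge0_le_integral => //.
    - by move=> u _; rewrite lee_fin.
    - by apply/measurable_EFinP; apply: measurableT_comp => //; exact: measurable_funB.
    - by move=> u _; rewrite lee_fin (le_trans (ler_norm _)).
  by rewrite integral_cst// [X in _ * X]probability_setT mule1.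
have -> : (linfty_norm (convolution nu f))%:E = ess_sup mu (abse \o (EFin \o convolution nu f)).
  rewrite /linfty_norm Lnorm.unlock mu0 fineK// ge0_fin_numE; last first.
    by apply: ess_sup_gee => //; apply: aeW => y /=.
  apply: (@le_lt_trans _ _ M%:E); last exact: ltry.
  by apply/ess_supP; apply: aeW => y /=; rewrite ger0_norm.
apply: filterS (ess_sup_ge mu (abse \o (EFin \o convolution nu f))) => y.
by rewrite /= ger0_norm// cE.
Qed.

Let mS : measurable_fun setT (fun w => (X w + e w)%R : mT).
Proof.
apply: measurable_funD; first exact: mX.
exact: (@measurable_funPT _ _ _ _ e).
Qed.

Lemma linfty_norm_ge0 (g : R -> R) : (0 <= linfty_norm g)%R.
Proof. by rewrite /linfty_norm fine_ge0// Lnorm_ge0. Qed.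

Lemma copy_expectation (Z : T -> R) (h : R -> R) : measurable_fun setT Z ->
  (forall A : set R, measurable A -> P (Z @^-1` A) = P ((X \+ e)%R @^-1` A)) ->
  measurable_fun setT h -> (forall x, 0 <= h x)%R ->
  \int[P]_w (h (Z w))%:E <=
  (linfty_norm (convolution nu f))%:E * \int[mu]_y (h y)%:E.
Proof.
move=> mZ lZ mh h0.
have -> : \int[P]_w (h (Z w))%:E = \int[P]_w (h (X w + e w)%R)%:E.
  exact: (ge0_integral_same_law mZ mS lZ).
rewrite sum_expectation// -ge0_integralZl//; last 3 first.
- exact/(@measurable_EFinP _ mT).
- by move=> y _; rewrite lee_fin.
- by rewrite lee_fin linfty_norm_ge0.
apply: ae_ge0_le_integral => //.
- by move=> y _; rewrite mule_ge0 ?lee_fin//; apply: integral_ge0 => u _; rewrite lee_fin.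
- apply: emeasurable_funM; first exact/measurable_EFinP.
  apply: (@measurable_fun_fubini_tonelli_F _ _ mT mT _ nu (fun z => (f (z.1 - z.2)%R)%:E)).
    apply/measurable_EFinP; apply: measurableT_comp => //; exact: measurable_funB.
  by move=> z; rewrite lee_fin.
- by move=> y _; rewrite mule_ge0 ?lee_fin// linfty_norm_ge0.
- by apply: emeasurable_funM => //; exact/measurable_EFinP.
- have [N [mN N0 sN]] := convolution_le; exists N; split => // y /= hy.
  apply: sN => /= hle; apply: hy => _.
  by rewrite [leRHS]muleC lee_wpmul2l// lee_fin.
Qed.

End SumLaw.

(** * Constants and rates *)

Lemma pow2_le_expR {R : realType} (j : nat) : 2 ^+ j <= expR j%:R :> R.
Proof.
rewrite -[j%:R]mulr1 expRM_natl lerXn2r ?nnegrE ?expR_ge0//.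
by have := expR_ge1Dx (1 : R).
Qed.

(** The l making n l^2 v equal to j balances both terms, unless the range u forces
    a smaller one. Then the sum of the variances contributes at most
    N 2^j j e^j <= N e^(3j), which the threshold t = 3j + 1 cancels. *)
Lemma cosh_sum_optimum {R : realType} (u v V : R) (n j N : nat) :
  0 < u -> 0 < v -> (1 <= n)%N -> (1 <= j)%N -> 0 <= V -> V <= N%:R * (2 ^+ j * v) ->
  exists l t : R, [/\ 0 < l, l * u <= 3 / 4, 1 <= t &
    l^-1 * (t - 1 + expR (- t) * (2 + 2 * (n%:R * l ^+ 2 * V * expR (n%:R * (l ^+ 2 * v)))))
    <= (5 + 2 * N%:R) * (Num.sqrt (n%:R * v * j%:R) + 4 / 3 * u * j%:R)].
Proof.
move=> u0 v0 n1 j1 V0 VN.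
have n0 : 0 < n%:R :> R by rewrite ltr0n.
have j0 : 0 < j%:R :> R by rewrite ltr0n.
have j1R : 1 <= j%:R :> R by rewrite ler1n.
have nv0 : 0 < n%:R * v := mulr_gt0 n0 v0.
have jnv0 := ltW (divr_gt0 j0 nv0).
pose l1 := Num.sqrt (j%:R / (n%:R * v)); pose l2 := 3 / (4 * u).
have l10 : 0 < l1 by rewrite sqrtr_gt0 divr_gt0 ?mulr_gt0.
have l20 : 0 < l2 by rewrite divr_gt0 ?mulr_gt0.
pose l := Num.min l1 l2.
have l0 : 0 < l by rewrite lt_min l10.
exists l, (3 * j%:R + 1); split => //.
- apply: (@le_trans _ _ (l2 * u)); first by rewrite ler_wpM2r ?(ltW u0)// ge_min lexx orbT.
  by rewrite /l2 le_eqVlt; apply/orP; left; apply/eqP; field; rewrite gt_eqF.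
- by rewrite lerDr mulr_ge0.
have sj : n%:R * (l ^+ 2 * v) <= j%:R.
  have : l ^+ 2 <= l1 ^+ 2 by rewrite lerXn2r ?nnegrE ?(ltW l0) ?(ltW l10)// ge_min lexx.
  rewrite sqr_sqrtr// ler_pdivlMr//.
  by rewrite mulrCA mulrA.
have li : l^-1 <= Num.sqrt (n%:R * v / j%:R) + 4 / 3 * u.
  have h1 : l1^-1 = Num.sqrt (n%:R * v / j%:R).
    by rewrite /l1 -sqrtrV// invf_div.
  have h2 : l2^-1 = 4 / 3 * u by rewrite /l2 invf_div; ring.
  rewrite -h1 -h2 /l; case: (leP l1 l2) => _.
    by rewrite lerDl invr_ge0 ltW.
  by rewrite lerDr invr_ge0 ltW.
have jsq : j%:R * Num.sqrt (n%:R * v / j%:R) = Num.sqrt (n%:R * v * j%:R).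
  rewrite -[X in X * _](ger0_norm (ltW j0)) -sqrtr_sqr -sqrtrM ?sqr_ge0//.
  by congr Num.sqrt; field; rewrite gt_eqF.
have X : n%:R * l ^+ 2 * V * expR (n%:R * (l ^+ 2 * v)) <= N%:R * expR (3 * j%:R).
  have h1 : n%:R * l ^+ 2 * V <= N%:R * (expR j%:R * expR j%:R).
    apply: (@le_trans _ _ (n%:R * l ^+ 2 * (N%:R * (2 ^+ j * v)))).
      by rewrite ler_wpM2l// mulr_ge0 ?sqr_ge0// ltW.
    have -> : n%:R * l ^+ 2 * (N%:R * (2 ^+ j * v)) = N%:R * (2 ^+ j * (n%:R * (l ^+ 2 * v))) by ring.
    rewrite ler_wpM2l//; apply: ler_pM => //; rewrite ?exprn_ge0//.
    - exact: mulr_ge0 (ltW n0) (mulr_ge0 (sqr_ge0 l) (ltW v0)).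
    - exact: pow2_le_expR.
    - apply: le_trans sj _; apply: le_trans (expR_ge1Dx _); by rewrite lerDr.
  have -> : N%:R * expR (3 * j%:R) = N%:R * (expR j%:R * expR j%:R) * expR j%:R :> R.
    by rewrite -!mulrA -!expRD; congr (_ * expR _); ring.
  apply: ler_pM => //; rewrite ?expR_ge0//; last by rewrite ler_expR.
  exact: mulr_ge0 (mulr_ge0 (ltW n0) (sqr_ge0 l)) V0.
have bracket : 3 * j%:R + 1 - 1 + expR (- (3 * j%:R + 1)) * (2 + 2 *
    (n%:R * l ^+ 2 * V * expR (n%:R * (l ^+ 2 * v)))) <= (5 + 2 * N%:R) * j%:R.
  have e1 : expR (- (3 * j%:R + 1)) <= 1 :> R.
    by rewrite -[leRHS]expR0 ler_expR oppr_le0 addr_ge0 ?mulr_ge0.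
  have e2 : expR (- (3 * j%:R + 1)) * expR (3 * j%:R) <= 1 :> R.
    rewrite -expRD -[leRHS]expR0 ler_expR; lra.
  apply: (@le_trans _ _ (3 * j%:R + (2 + 2 * N%:R))).
    rewrite addrK lerD2l mulrDr; apply: lerD.
      by rewrite -[leRHS]mul1r ler_wpM2r.
    apply: (@le_trans _ _ (expR (- (3 * j%:R + 1)) * (2 * (N%:R * expR (3 * j%:R))))).
      by rewrite ler_wpM2l ?expR_ge0// ler_wpM2l.
    have -> : expR (- (3 * j%:R + 1)) * (2 * (N%:R * expR (3 * j%:R))) =
      2 * N%:R * (expR (- (3 * j%:R + 1)) * expR (3 * j%:R)) :> R by ring.
    by rewrite ler_piMr ?mulr_ge0.
  have -> : (5 + 2 * N%:R) * j%:R = 3 * j%:R + (2 + 2 * N%:R) * j%:R :> R by ring.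
  by rewrite lerD2l ler_peMr// addr_ge0 ?mulr_ge0.
apply: (@le_trans _ _ (l^-1 * ((5 + 2 * N%:R) * j%:R))).
  by rewrite ler_wpM2l// invr_ge0 ltW.
rewrite mulrCA ler_wpM2l ?addr_ge0 ?mulr_ge0//.
rewrite -jsq mulrC -[X in _ <= _ + X]mulrC -mulrDr ler_wpM2l//.
Qed.

(** With b = a/pi and N1 the L^1 norm of phi, the square root term of the deviation
    is exactly the one given by D1. *)
Lemma variance_constant {R : realType} (b l p q G z n N1 C : R) :
  0 <= b -> 0 < q -> 0 <= G -> 0 <= z -> 0 < n -> 0 <= N1 -> 0 < l -> 0 <= C ->
  10 * Num.sqrt (q ^+ 2 * (C ^+ 2 * (G * (b * N1 ^+ 2 / (q * l ^+ 2))))) *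
    Num.sqrt (n * z) =
  n * (10 * C * N1 * Num.sqrt b / l * Num.sqrt (q * G * z / n)).
Proof.
move=> b0 q0 G0 z0 n0 N0 l0 C0.
have -> : q ^+ 2 * (C ^+ 2 * (G * (b * N1 ^+ 2 / (q * l ^+ 2)))) =
    (C * N1 / l) ^+ 2 * (b * (q * G)).
  by field; rewrite !gt_eqF.
have -> : q * G * z / n = n^-1 ^+ 2 * ((q * G) * (n * z)) by field; rewrite gt_eqF.
have w0 : 0 <= C * N1 / l by rewrite divr_ge0 ?mulr_ge0// ltW.
have qG0 : 0 <= q * G by rewrite mulr_ge0// ltW.
have i0 : 0 <= n^-1 by rewrite invr_ge0 ltW.
rewrite (sqrtrM (b * (q * G)) (sqr_ge0 (C * N1 / l))) sqrtr_sqr (ger0_norm w0).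
rewrite (sqrtrM (q * G) b0) (sqrtrM (q * G * (n * z)) (sqr_ge0 n^-1)).
rewrite sqrtr_sqr (ger0_norm i0) (sqrtrM (n * z) qG0).
by field; rewrite !gt_eqF.
Qed.

Lemma range_ratio (R : realFieldType) (a p c : R) : 0 < a -> 0 < p ->
  (c * (a / p) * (2 * p ^+ 2 / a) = c * (2 * p)) *
  (c * (a / (2 * p ^+ 2)) * (2 * p ^+ 2 / a) = c).
Proof. by move=> a0 p0; split; field; rewrite !gt_eqF. Qed.

Lemma range_numeral (R : realFieldType) (p : R) : p < 4 -> 15 ^+ 2 * (2 * p) < 44 ^+ 2.
Proof. by rewrite !expr2 => p4; lra. Qed.

(** The linear term of the deviation is smaller than the one given by D2, strictly,
    because pi < 4. The strict inequality is what allows the event to be written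
    with a weak inequality. *)
Lemma range_constant {R : realType} (a : R) : 0 < a ->
  15 * Num.sqrt (a / pi) < 44 * Num.sqrt (a / (2 * pi ^+ 2)).
Proof.
move=> a0; have p0 : 0 < pi :> R by exact: pi_gt0.
have p4 : pi < 4 :> R.
  by have := @pihalf_lt2 R; rewrite ltr_pdivrMr// -natrM.
rewrite -[15]ger0_norm// -[44]ger0_norm// -!sqrtr_sqr -!sqrtrM ?sqr_ge0//.
rewrite ltr_sqrt; last first.
  by rewrite mulr_gt0 ?exprn_gt0 ?divr_gt0 ?mulr_gt0 ?exprn_gt0.
rewrite -(ltr_pM2r (_ : 0 < 2 * pi ^+ 2 / a)); last first.
  by rewrite divr_gt0 ?mulr_gt0 ?exprn_gt0.
rewrite !range_ratio//.
exact: range_numeral.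
Qed.

Lemma range_scaling (R : realFieldType) (s t q C l z n : R) :
  0 < q -> 0 < C -> 0 < l -> 0 < z -> 0 < n -> 15 * s < 44 * t ->
  15 * (q * (C * (s / l))) * z < n * (44 * C * t / l * (q * z / n)).
Proof.
move=> q0 C0 l0 z0 n0 st; have w0 : 0 < q * C * z / l by rewrite divr_gt0 ?mulr_gt0.
have -> : n * (44 * C * t / l * (q * z / n)) = (q * C * z / l) * (44 * t).
  by field; rewrite !gt_eqF.
have -> : 15 * (q * (C * (s / l))) * z = (q * C * z / l) * (15 * s).
  by field; rewrite gt_eqF.
by rewrite ltr_pM2l.
Qed.

Lemma coefficient_energy_total (R : realFieldType) (N a k p l q G : R) :
  0 <= N -> 0 < a -> 0 <= k -> 0 < p -> 0 < l -> 0 < q -> 0 <= G ->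
  N * a * k / (p * l ^+ 2) <= N * (q * ((G + 1) * (a / p * (k + 1) / (q * l ^+ 2)))).
Proof.
move=> N0 a0 k0 p0 l0 q0 G0.
have -> : N * (q * ((G + 1) * (a / p * (k + 1) / (q * l ^+ 2)))) =
    N * a / (p * l ^+ 2) * ((G + 1) * (k + 1)).
  by field; rewrite !gt_eqF.
have -> : N * a * k / (p * l ^+ 2) = N * a / (p * l ^+ 2) * k.
  by field; rewrite !gt_eqF.
rewrite ler_wpM2l ?divr_ge0 ?(mulr_ge0 N0 (ltW a0)) ?(mulr_ge0 (ltW p0) (sqr_ge0 l))//.
by rewrite -[X in X <= _]mul1r; apply: ler_pM; rewrite ?lerDl ?lerDr.
Qed.

Lemma rademacher_term_rate {R : realType} (N C l q n j b k G : R) :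
  0 < n -> 0 < q -> 0 < l -> 0 <= j -> 0 <= b -> 0 <= k -> 0 <= G ->
  n^-1 * (q * C) * ((5 + 2 * N) * (Num.sqrt (n * ((G + 1) * (b * k / (q * l ^+ 2))) * j) +
     4 / 3 * (Num.sqrt b / l) * j)) =
  (5 + 2 * N) * C / l * (Num.sqrt ((G + 1) * (b * k)) * Num.sqrt (q * j / n) +
     4 / 3 * Num.sqrt b * (q * j / n)).
Proof.
move=> n0 q0 l0 j0 b0 k0 G0.
have c0 : 0 <= n / (q * l) by rewrite divr_ge0 ?mulr_ge0 ?ltW.
have w0 : 0 <= (G + 1) * (b * k) by rewrite !mulr_ge0// addr_ge0.
have -> : n * ((G + 1) * (b * k / (q * l ^+ 2))) * j =
    (n / (q * l)) ^+ 2 * (((G + 1) * (b * k)) * (q * j / n)).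
  by field; rewrite !gt_eqF.
rewrite (sqrtrM _ (sqr_ge0 (n / (q * l)))) sqrtr_sqr (ger0_norm c0) (sqrtrM _ w0).
by field; rewrite !gt_eqF.
Qed.

Lemma width_rate (R : realFieldType) (N C w s l X Y d1 d2 g z A c1 c2 : R) :
  0 <= N -> 0 <= C -> 0 <= w -> 0 <= s -> 0 < l -> 0 <= X -> 0 <= Y -> 0 <= d1 ->
  0 <= d2 -> 0 <= g -> 0 <= z ->
  A <= (5 + 2 * N) * C / l * (w * X + 4 / 3 * s * Y) ->
  c1 <= d1 / l * (g * X) -> c2 <= d2 / l * (z * Y) ->
  2 * (6 * A + (c1 + c2)) <=
  2 * (6 * ((5 + 2 * N) * C * (w + 4 / 3 * s)) + d1 * g + d2 * z) * l^-1 * (X + Y).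
Proof.
move=> N0 C0 w0 s0 l0 X0 Y0 d10 d20 g0 z0 hA h1 h2.
have i0 : 0 <= l^-1 by rewrite invr_ge0 ltW.
have N5 : 0 <= 5 + 2 * N by rewrite addr_ge0 ?mulr_ge0.
rewrite -subr_ge0.
set D := (X in 0 <= X).
have r1 : 0 <= (5 + 2 * N) * C / l * (w * Y + 4 / 3 * s * X).
  by rewrite mulr_ge0 ?(mulr_ge0 (mulr_ge0 N5 C0) i0)// addr_ge0 ?mulr_ge0.
have r2 : 0 <= d1 / l * (g * Y) by rewrite !mulr_ge0.
have r3 : 0 <= d2 / l * (z * X) by rewrite !mulr_ge0.
have -> : D = 2 * (6 * ((5 + 2 * N) * C / l * (w * X + 4 / 3 * s * Y) - A) +
    (d1 / l * (g * X) - c1) + (d2 / l * (z * Y) - c2)) +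
    2 * (6 * ((5 + 2 * N) * C / l * (w * Y + 4 / 3 * s * X)) +
     d1 / l * (g * Y) + d2 / l * (z * X)).
  by rewrite /D; field; rewrite gt_eqF.
by lra.
Qed.

(** The three terms come from the Rademacher supremum, D1 and D2; N is any
    natural number with a <= N pi. The level j and the sample size do not occur. *)
Definition width_constant {R : realType} (phi : R -> R) (a G z N : R) : R :=
  2 * (6 * ((5 + 2 * N) * fine (csum phi) *
         (Num.sqrt ((G + 1) * (a / pi * (norm1 phi ^+ 2 + 1))) +
          4 / 3 * Num.sqrt (a / pi))) +
       D1 phi a * Num.sqrt (G * (z + ln 2)) + D2 phi a * (z + ln 2)).

(** * The deconvolution kernel and its confidence band *)

(** Density is required at the level of the values H x, which is all that a
    supremum sees. *)
Lemma ereal_sup_dense {R : realType} (X : Type) (H : X -> R) (xi : nat -> X) :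
  (forall x e, 0 < e -> exists i, `|H x - H (xi i)| <= e) ->
  ereal_sup (range (fun x => (`|H x|)%:E)) =
  ereal_sup (range (fun i => (`|H (xi i)|)%:E)).
Proof.
move=> dense; apply/eqP; rewrite eq_le; apply/andP; split; last first.
  by apply: ge_ereal_sup => _ [i _ <-]; apply: ereal_sup_ubound; exists (xi i).
apply: ge_ereal_sup => _ [x _ <-]; apply/lee_addgt0Pr => e e0.
have [i hi] := dense x e e0.
apply: (@le_trans _ _ ((`|H (xi i)|)%:E + e%:E)%E).
  rewrite -EFinD lee_fin -[H x](subrK (H (xi i))) addrC.
  by rewrite (le_trans (ler_normD _ _))// lerD2l.
by rewrite leeD2r//; apply: ereal_sup_ubound; exists i.
Qed.

(** The two edges of the band belong to it and are at distance 2 s. *)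
Lemma diameter_band {R : realType} (g : R -> R) (s : \bar R) (t : R) :
  0 <= t -> s = t%:E ->
  diameter [set h : R -> R | forall x, ((g x)%:E - s <= (h x)%:E)%E /\
     ((h x)%:E <= (g x)%:E + s)%E] = (2%:E * s)%E.
Proof.
move=> t0 ->; apply/eqP; rewrite eq_le; apply/andP; split.
  apply: ge_ereal_sup => _ [[h1 h2] [/= b1 b2] <-].
  apply: ge_ereal_sup => _ [x _ <-].
  have [] := b1 x; have [] := b2 x; rewrite -!EFinB -!EFinD !lee_fin /= => p1 p2 p3 p4.
  by rewrite ler_norml; apply/andP; split; lra.
pose hp x := g x + t; pose hm0 x := g x - t.
apply: (@le_trans _ _ (sup_norm (hp \- hm0))).
  apply: (@le_trans _ _ (`|(hp \- hm0) 0|)%:E); last by apply: ereal_sup_ubound; exists 0.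
  by rewrite -EFinM lee_fin (le_trans _ (ler_norm _))//= /hp /hm0; lra.
apply: ereal_sup_ubound; exists (hp, hm0) => //; split => /= x;
  by rewrite -EFinB -EFinD !lee_fin /hp /hm0; split; lra.
Qed.

Section Kernel.
Context {R : realType}.
Local Notation mu := (@lebesgue_measure R).
Local Notation mT := (measurableTypeR R).
Variables (phi psi : R -> R) (a' a : R).
Hypothesis hw : wavelet_condition phi psi a' a.
Variables (nu : probability mT R) (j : nat).
Hypothesis law_pos : forall t, t \in `[- (2 ^+ j * a), 2 ^+ j * a] ->
  0 < cabs (fourier_law nu t).

Let q : R := 2 ^+ j.
Let q0 : 0 < q. Proof. exact: exprn_gt0. Qed.
Let C := fine (csum phi).
Let C0 : 0 < C. Proof. exact: csum_gt0 hw. Qed.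
Let a0 : 0 < a.
Proof. by have [_ [_ [[h1 h2] _]]] := hw; exact: lt_trans h2. Qed.
Let phisupp : supp (fourier_real phi) `<=` `[- a, a].
Proof. by have [_ [_ [_ [h _]]]] := hw. Qed.
Let l := delta nu j a.
Let l0 : 0 < l. Proof. exact: delta_gt0. Qed.
Let M := Num.sqrt (a / pi) / l.
Let B k y := complex.Re (phitilde phi nu j k y).
Let iphi := wavelet_integrable hw.

Let BM k y : `|B k y| <= M.
Proof.
by apply: phitilde_bound => //; rewrite (wavelet_sqr_integral hw).
Qed.

Let mB k : measurable_fun setT (B k).
Proof. exact: (measurable_phitilde iphi phisupp a0 law_pos). Qed.

Let cC x := csum_dilated hw q x.

Let KstarE x y :
  Kstar phi nu j x y = q * series_class (fun x k => phi (q * x - k%:~R)) B x y.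
Proof. by []. Qed.

Lemma measurable_Kstar x : measurable_fun setT (Kstar phi nu j x).
Proof. by apply: measurable_funM => //; exact: (measurable_series_class cC mB BM). Qed.

Lemma Kstar_bound x y : `|Kstar phi nu j x y| <= q * (C * M).
Proof.
rewrite KstarE normrM (gtr0_norm q0) ler_wpM2l ?(ltW q0)//.
exact: (series_class_bound cC).
Qed.

Lemma Kstar_dense : exists xi : nat -> R, forall x (e : R), 0 < e ->
  exists i, forall y, `|Kstar phi nu j x y - Kstar phi nu j (xi i) y| <= e.
Proof.
have [xi h] := series_class_dense cC BM; exists xi => x e e0.
have [i hi] := h x (e / q) (divr_gt0 e0 q0); exists i => y.
rewrite !KstarE -mulrBr normrM (gtr0_norm q0) mulrC -ler_pdivlMr//.
Qed.

Lemma Kstar_lincomb (n : nat) (r y : 'I_n -> R) x (S : R) :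
  (forall k, `|\sum_m r m * complex.Re (phitilde phi nu j k (y m))| <= S) ->
  `|\sum_m r m * Kstar phi nu j x (y m)| <= q * (C * S).
Proof.
move=> h; under eq_bigr do rewrite KstarE mulrCA.
rewrite -mulr_sumr normrM (gtr0_norm q0) ler_wpM2l ?(ltW q0)//.
exact: (series_class_lincomb cC BM).
Qed.

Section Sample.
Context d (T : measurableType d) (P : probability T R).
Variables (f : R -> R) (X e : {RV P >-> R}) (n : nat) (Y r : 'I_n -> {RV P >-> R}).
Hypothesis hm : deconvolution_model f nu X e.
Hypothesis hY : iid_copies (X \+ e) Y.
Hypothesis hr : rademacher_multipliers Y r.
Hypothesis n1 : (1 <= n)%N.

Let G := linfty_norm (convolution nu f).
Let N1 := norm1 phi.
Let v0 := a / pi * N1 ^+ 2 / (q * l ^+ 2).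
Let nR0 : 0 < n%:R :> R. Proof. by rewrite ltr0n. Qed.

Let mY m : measurable_fun setT (Y m : T -> mT).
Proof. exact: (@measurable_funPT _ _ _ _ (Y m)). Qed.

Let lawY m := hY.2 m.

Lemma phitilde_copy_sqr k m :
  (\int[P]_w (complex.Re (phitilde phi nu j k (Y m w)) ^+ 2)%:E <= (G * v0)%:E)%E.
Proof.
apply: le_trans (copy_expectation hm (h := fun y => B k y ^+ 2) (mY m) (lawY m) _ _) _.
- exact: measurable_funX.
- by move=> y; exact: sqr_ge0.
- rewrite EFinM lee_wpmul2l ?lee_fin ?linfty_norm_ge0//.
  exact: (phitilde_sqr_integral iphi phisupp a0 law_pos).
Qed.

Lemma Kstar_copy_sqr x m :
  (\int[P]_w (Kstar phi nu j x (Y m w) ^+ 2)%:E <= (q ^+ 2 * (C ^+ 2 * (G * v0)))%:E)%E.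
Proof.
have := series_class_sqr cC mB BM x (mY m) (fun k => phitilde_copy_sqr k m).
move=> /(lee_wpmul2l (_ : (0 <= (q ^+ 2)%:E)%E)).
rewrite lee_fin sqr_ge0 -EFinM => /(_ isT); apply: le_trans.
rewrite -ge0_integralZl//.
- rewrite (_ : (fun w => _) = (fun w => ((q ^+ 2)%:E * (series_class (fun x k => phi (q * x - k%:~R)) B x (Y m w) ^+ 2)%:E)%E))//.
  by apply/funext => w; rewrite KstarE exprMn.
- apply/measurable_EFinP/measurable_funX; apply: measurableT_comp (mY m).
  exact: (measurable_series_class cC mB BM).
- by move=> w _; rewrite lee_fin sqr_ge0.
- by rewrite lee_fin sqr_ge0.
Qed.

Let mKY x m : measurable_fun setT (fun w => Kstar phi nu j x (Y m w)).
Proof. by apply: measurableT_comp (mY m); exact: measurable_Kstar. Qed.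

Lemma Kstar_copy_mean x m :
  (\int[P]_w (Kstar phi nu j x (Y m w))%:E = (mean_estimator phi nu j Y x)%:E)%E.
Proof.
pose k x m := (\int[P]_w (Kstar phi nu j x (Y m w)))%R.
have intK m' : P.-integrable setT (EFin \o (fun w => Kstar phi nu j x (Y m' w))).
  by apply: (@bounded_integrable _ _ _ _ _ (q * (C * M))) => // w; exact: Kstar_bound.
have same m' : (\int[P]_w (Kstar phi nu j x (Y m' w))%:E =
    \int[P]_w (Kstar phi nu j x (Y m w))%:E)%E.
  apply: (@bounded_integral_same_law _ _ _ _ _ _ (mY m') (mY m) _ _ (q * (C * M))).
  - by move=> A mA; rewrite (lawY m')// (lawY m).
  - exact: measurable_Kstar.
  - by move=> y; exact: Kstar_bound.
rewrite /mean_estimator unlock.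
have iS m' : P.-integrable setT (fun w => (Kstar phi nu j x (Y m' w))%:E) by exact: intK.
have -> : (\int[P]_w (estimator phi nu j Y x w)%:E =
    (n%:R^-1)%:E * \sum_m' \int[P]_w (Kstar phi nu j x (Y m' w))%:E)%E.
  rewrite -integral_sum// -integralZl//=; last exact: integrable_sum.
  by apply: eq_integral => w _; rewrite sumEFin.
under eq_bigr do rewrite same -(EFin_Rintegral (intK m)).
rewrite -(EFin_Rintegral (intK m)) sumEFin sumr_const card_ord -EFinM/=.
by rewrite -[X in _ * X]mulr_natl mulrA mulVf ?mul1r// gt_eqF.
Qed.

Lemma measurable_dense_sup (H : R -> T -> R) (xi : nat -> R) :
  (forall x, measurable_fun setT (H x)) ->
  (forall w x e, 0 < e -> exists i, `|H x w - H (xi i) w| <= e) ->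
  measurable_fun setT (fun w => ereal_sup (range (fun x => (`|H x w|)%:E))).
Proof.
move=> mH dense.
under eq_fun do rewrite (ereal_sup_dense (dense _)).
rewrite (_ : (fun w => _) = (fun w => ereal_sup [set (`|H (xi i) w|)%:E | i in
    [set i | (0 <= i)%N]])).
  apply: (measurable_fun_esups (f := fun i w => (`|H (xi i) w|)%:E)) => i.
  by apply/measurable_EFinP; exact: measurableT_comp.
apply/funext => w; congr ereal_sup.
by apply/seteqP; split => x [i _ <-]; exists i.
Qed.

Let rad_avg x w := n%:R^-1 * \sum_m r m w * Kstar phi nu j x (Y m w).
Let dev x w := estimator phi nu j Y x w - mean_estimator phi nu j Y x.

Let close x x' (t : R) :=
  forall y, `|Kstar phi nu j x y - Kstar phi nu j x' y| <= t.

Let avg_close x x' t (b : 'I_n -> R) (y : 'I_n -> R) : close x x' t ->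
  `|n%:R^-1 * (\sum_m b m * Kstar phi nu j x (y m)) -
    n%:R^-1 * (\sum_m b m * Kstar phi nu j x' (y m))| <=
  n%:R^-1 * (\sum_m `|b m|) * t.
Proof.
move=> xx'; rewrite -mulrBr -sumrB normrM ger0_norm ?invr_ge0 ?ler0n// -mulrA.
rewrite ler_wpM2l ?invr_ge0 ?ler0n// mulr_suml.
apply: le_trans (ler_norm_sum _ _ _) _; apply: ler_sum => m _.
by rewrite -mulrBr normrM ler_wpM2l.
Qed.

(* The mean inherits the uniform closeness of the kernels, so that one countable
   set serves both suprema. *)
Let mean_le x x' t : close x x' t ->
  mean_estimator phi nu j Y x <= mean_estimator phi nu j Y x' + t.
Proof.
move=> xx'; pose m := Ordinal n1.
have intK x0 : P.-integrable setT (fun w => (Kstar phi nu j x0 (Y m w))%:E).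
  by apply: (@bounded_integrable _ _ _ _ _ (q * (C * M))) => // w; exact: Kstar_bound.
have intt : P.-integrable setT (fun=> t%:E).
  exact: (@bounded_integrable _ _ _ _ _ `|t|).
rewrite -lee_fin EFinD -(Kstar_copy_mean x m) -(Kstar_copy_mean x' m).
have -> : t%:E = (\int[P]_w t%:E)%E.
  by rewrite integral_cst//= [X in (_ * X)%E]probability_setT mule1.
rewrite -integralD//; apply: le_integral => //; first exact: integrableD.
move=> w _; rewrite -EFinD lee_fin addrC -lerBlDr.
exact: le_trans (ler_norm _) (xx' _).
Qed.

Let dev_close x x' t w : close x x' t -> `|dev x w - dev x' w| <= 2 * t.
Proof.
move=> xx'.
have x'x : close x' x t by move=> y; rewrite distrC.
have := avg_close (fun=> 1) (Y ^~ w) xx'.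
under eq_bigr do rewrite mul1r.
under [in X in _ - X]eq_bigr do rewrite mul1r.
rewrite normr1 sumr_const card_ord mulVf ?gt_eqF// mul1r -!/(estimator _ _ _ _ _ _).
have := mean_le xx'; have := mean_le x'x; rewrite /dev !ler_norml.
set k := mean_estimator _ _ _ _ _; set k' := mean_estimator _ _ _ _ _.
set g := estimator _ _ _ _ _ _; set g' := estimator _ _ _ _ _ _.
by move=> h1 h2 /andP[h3 h4]; apply/andP; split; lra.
Qed.

Let xi_spec : exists xi : nat -> R,
  (forall w x t, 0 < t -> exists i, `|rad_avg x w - rad_avg (xi i) w| <= t) /\
  (forall w x t, 0 < t -> exists i, `|dev x w - dev (xi i) w| <= t).
Proof.
have [xi h] := Kstar_dense; exists xi; split => w x t t0.
  pose s := n%:R^-1 * \sum_m `|r m w|.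
  have s0 : 0 <= s by rewrite mulr_ge0 ?invr_ge0 ?ler0n// sumr_ge0.
  have s1 : 0 < s + 1 by rewrite ltr_wpDl.
  have [i hi] := h x _ (divr_gt0 t0 s1); exists i.
  apply: le_trans (avg_close (fun m => r m w) (Y ^~ w) hi) _.
  by rewrite -/s mulrA mulrAC ler_piMl ?(ltW t0)// ler_pdivrMr// mul1r lerDl.
have [i hi] := h x (t / 2) (divr_gt0 t0 (ltr0n _ 2)); exists i.
by apply: le_trans (dev_close w hi) _; rewrite mulrC divfK.
Qed.

Let mrad x : measurable_fun setT (rad_avg x).
Proof.
apply: measurable_funM => //; apply: measurable_sum => m.
apply: measurable_funM (mKY x m).
exact: (@measurable_funPT _ _ _ _ (r m)).
Qed.

Let mdev x : measurable_fun setT (dev x).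
Proof.
apply: measurable_funB => //; apply: measurable_funM => //.
by apply: measurable_sum => m; exact: mKY.
Qed.

Lemma measurable_rademacher_process_sup :
  measurable_fun setT (rademacher_sup phi nu j Y r).
Proof. by have [xi [h _]] := xi_spec; exact: measurable_dense_sup mrad h. Qed.

Lemma rademacher_sup_real w :
  exists2 t : R, 0 <= t & rademacher_sup phi nu j Y r w = t%:E.
Proof.
have ub : (rademacher_sup phi nu j Y r w <=
    (n%:R^-1 * (\sum_m `|r m w| * (q * (C * M))))%:E)%E.
  apply: ge_ereal_sup => _ [x _ <-]; rewrite lee_fin normrM.
  rewrite ger0_norm ?invr_ge0 ?ler0n// ler_wpM2l ?invr_ge0 ?ler0n//.
  apply: le_trans (ler_norm_sum _ _ _) _; apply: ler_sum => m _.
  by rewrite normrM ler_wpM2l// Kstar_bound.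
have lb : (0 <= rademacher_sup phi nu j Y r w)%E.
  by apply: le_trans (ereal_sup_ubound _); last by exists 0.
exists (fine (rademacher_sup phi nu j Y r w)); first exact: fine_ge0.
by rewrite fineK// ge0_fin_numE// (le_lt_trans ub)// ltry.
Qed.

Lemma measurable_sigmaR z : measurable_fun setT (sigmaR phi nu j Y r f a z).
Proof.
do 2 apply: emeasurable_funD => //.
by apply: emeasurable_funM => //; exact: measurable_rademacher_process_sup.
Qed.

(** On the event, the supremum of the deviations exceeds 6 times the Rademacher
    supremum by strictly more than c/n, hence so does one term of the countable
    dense family: this is countable_deviation_event. The level z + ln 2 pays for
    the factor 2 in its probability. *)
Lemma deviation_band z : 0 < z ->
  (P [set w | sigmaR phi nu j Y r f a z w
                <= sup_norm (fun x => (estimator phi nu j Y x w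
                                       - mean_estimator phi nu j Y x)%R)]
     <= (expR (- z))%:E)%E.
Proof.
move=> z0; have [xi [radxi devxi]] := xi_spec.
have ln20 : 0 < ln 2 :> R by apply: ln_gt0; rewrite ltr1n.
pose z' := z + ln 2; have z'0 : 0 < z' by exact: addr_gt0.
have M0 : 0 < M by rewrite divr_gt0// sqrtr_gt0 divr_gt0// pi_gt0.
pose U := q * (C * M); have U0 : 0 < U := mulr_gt0 q0 (mulr_gt0 C0 M0).
pose v := q ^+ 2 * (C ^+ 2 * (G * v0)).
have bound := @countable_deviation_probability _ _ _ P n Y r hr
  (fun i => Kstar phi nu j (xi i)) (fun i => mean_estimator phi nu j Y (xi i)) U v
  (fun i => measurable_Kstar (xi i)) (fun i => Kstar_bound (xi i))
  (fun i m => Kstar_copy_mean (xi i) m) (fun i m => Kstar_copy_sqr (xi i) m)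
  n1 U0 z' _.
have {bound} := bound _; rewrite lerDr ltW// => /(_ isT).
have -> : ln 2 - z' = - z by rewrite /z' opprD addrCA subrr addr0.
apply: le_trans; apply: le_measure.
- rewrite inE -[X in measurable X]setTI; apply: emeasurable_fun_le => //.
    exact: measurable_sigmaR.
  exact: (measurable_dense_sup mdev devxi).
- rewrite inE; apply: measurable_countable_deviation_event => i.
  exact: measurable_Kstar.
move=> w /=; rewrite /sup_norm (ereal_sup_dense (devxi w)).
have [t t0 tE] := rademacher_sup_real w.
rewrite /sigmaR tE -EFinM -!EFinD.
set c1 := D1 _ _ / _ * _; set c2 := D2 _ _ / _ * _ => hsup.
pose c := 10 * Num.sqrt v * Num.sqrt (n%:R * z') + 15 * U * z'.
have cc : c < n%:R * (c1 + c2).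
  rewrite /c /v /v0 variance_constant ?(ltW C0) ?(ltW z'0) ?linfty_norm_ge0 ?norm1_ge0//; last first.
    by rewrite divr_ge0 ?(ltW a0) ?pi_ge0.
  rewrite [n%:R * (c1 + c2)]mulrDr /c1 /D1 (wavelet_norm1 phi) ltrD2l.
  exact: range_scaling (range_constant a0).
have : ((6 * t + n%:R^-1 * c)%:E < ereal_sup (range (fun i => (`|dev (xi i) w|)%:E)))%E.
  apply: lt_le_trans hsup; rewrite lte_fin -addrA ltrD2l mulrC.
  by rewrite ltr_pdivrMr// mulrC.
move=> /ereal_sup_gt[_ [i _ <-]]; rewrite lte_fin => hi.
exists i => i' /=.
have radt : n%:R^-1 * `|\sum_m r m w * Kstar phi nu j (xi i') (Y m w)| <= t.
  rewrite -[X in X * _]ger0_norm ?invr_ge0 ?ler0n// -normrM -lee_fin -tE.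
  by apply: ereal_sup_ubound; exists (xi i').
have -> : \sum_m Kstar phi nu j (xi i) (Y m w) -
    n%:R * mean_estimator phi nu j Y (xi i) = n%:R * dev (xi i) w.
  by rewrite /dev /estimator mulrBr mulrA mulfV ?mul1r// gt_eqF.
rewrite -/c normrM (gtr0_norm nR0) -ltr_pdivrMl//; apply: le_lt_trans hi.
by rewrite mulrDr lerD2r mulrCA ler_wpM2l.
Qed.

Lemma sigmaR_real z w : 0 < z ->
  exists2 t : R, 0 <= t & sigmaR phi nu j Y r f a z w = t%:E.
Proof.
move=> z0; have [t t0 tE] := rademacher_sup_real w.
have ln20 : 0 < ln 2 :> R by apply: ln_gt0; rewrite ltr1n.
have z'0 : 0 < z + ln 2 by exact: addr_gt0.
rewrite /sigmaR tE -EFinM -!EFinD.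
set s := (X in X%:E); exists s => //.
rewrite /s !addr_ge0 ?mulr_ge0 ?invr_ge0 ?sqrtr_ge0 ?ler0n ?(ltW l0) ?(ltW C0)
  ?(ltW q0) ?(ltW z'0)//.
by rewrite wavelet_norm1 norm1_ge0.
Qed.

Lemma mean_diameter z : 0 < z ->
  (\int[P]_w diameter (confidence_band phi nu j Y r f a z w) =
   2%:E * \int[P]_w sigmaR phi nu j Y r f a z w)%E.
Proof.
move=> z0; rewrite -ge0_integralZl//.
- apply: eq_integral => w _; have [t t0 tE] := sigmaR_real w z0.
  exact: diameter_band t0 tE.
- exact: measurable_sigmaR.
- by move=> w _; have [t t0 ->] := sigmaR_real w z0; rewrite lee_fin.
Qed.

Let S w := ereal_sup (range (fun i : nat => (`|\sum_m r m w * B (zenum i) (Y m w)|)%:E)).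

(* The supremum over x is replaced by one over the countably many phitilde_k. *)
Let rademacher_sup_le w :
  (rademacher_sup phi nu j Y r w <= (n%:R^-1 * (q * C))%:E * S w)%E.
Proof.
have c0 : 0 < n%:R^-1 * (q * C) by rewrite !mulr_gt0// ?invr_gt0.
have S0 : (0 <= S w)%E by apply: le_trans (ereal_sup_ubound _); last by exists 0%N.
apply: ge_ereal_sup => _ [x _ <-].
case SE : (S w) S0 => [s| |]// S0; last by rewrite gt0_muley ?lte_fin// leey.
rewrite lee_fin normrM ger0_norm ?invr_ge0 ?ler0n// -mulrA ler_wpM2l ?invr_ge0 ?ler0n//.
rewrite -mulrA; apply: Kstar_lincomb => k.
rewrite -lee_fin -SE; have [i <-] := zenum_surj k.
by apply: ereal_sup_ubound; exists i.
Qed.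

Let b : R := a / pi.
Let b0 : 0 < b. Proof. by rewrite divr_gt0// pi_gt0. Qed.
(* The 1 added here and to G keeps v positive even when G vanishes. *)
Let kap : R := N1 ^+ 2 + 1.
Let kap0 : 0 < kap. Proof. by rewrite ltr_wpDl// sqr_ge0. Qed.
Let G0 : 0 <= G. Proof. exact: linfty_norm_ge0. Qed.
Let v : R := (G + 1) * (b * kap / (q * l ^+ 2)).
Let v_gt0 : 0 < v.
Proof.
have G1 : 0 < G + 1 by rewrite ltr_wpDl.
exact: mulr_gt0 G1 (divr_gt0 (mulr_gt0 b0 kap0) (mulr_gt0 q0 (exprn_gt0 2 l0))).
Qed.

(** The variances of the phitilde_k(Y_m) are at most v each, and their sum V is the
    mean of the pointwise sum of squares, which is at most N 2^j v. *)
Lemma rademacher_sup_mean (N : nat) : a <= N%:R * pi -> (1 <= j)%N ->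
  (\int[P]_w rademacher_sup phi nu j Y r w <=
   (n%:R^-1 * (q * C) * ((5 + 2 * N%:R) *
     (Num.sqrt (n%:R * v * j%:R) + 4 / 3 * M * j%:R)))%:E)%E.
Proof.
move=> aN j1; pose m0 := Ordinal n1.
have intB m i : P.-integrable setT (fun w => (B (zenum i) (Y m w) ^+ 2)%:E).
  apply: (@bounded_integrable _ _ _ _ _ (M ^+ 2)).
    by apply: measurable_funX; exact: measurableT_comp.
  by move=> w; rewrite normrX lerXn2r ?nnegrE// (le_trans _ (BM 0 0)).
pose om i := (\int[P]_w (B (zenum i) (Y m0 w) ^+ 2))%R.
have omE i : ((om i)%:E = \int[P]_w (B (zenum i) (Y m0 w) ^+ 2)%:E)%E.
  exact: (EFin_Rintegral (intB m0 i)).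
have om0 i : 0 <= om i by apply: Rintegral_ge0 => w _; exact: sqr_ge0.
have omv i : 0 <= om i <= v.
  rewrite om0/= -lee_fin omE; apply: le_trans (phitilde_copy_sqr _ _) _.
  rewrite lee_fin; apply: ler_pM => //; last 1 first.
  - rewrite /v0 ler_wpM2r ?invr_ge0 ?(mulr_ge0 (ltW q0) (sqr_ge0 l))//.
    by rewrite ler_wpM2l ?(ltW b0)// lerDl.
  - by rewrite divr_ge0 ?(mulr_ge0 (ltW b0) (sqr_ge0 N1)) ?(mulr_ge0 (ltW q0) (sqr_ge0 l)).
  - by rewrite lerDl.
have mS : measurable_fun setT S.
  exact: (@measurable_rademacher_sup _ _ _ P n Y r (fun i => B (zenum i)) (fun i => mB (zenum i))).
pose V := N%:R * a * N1 ^+ 2 / (pi * l ^+ 2).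
have V0 : 0 <= V.
  apply: divr_ge0; last exact: mulr_ge0 (pi_ge0 R) (sqr_ge0 l).
  exact: mulr_ge0 (mulr_ge0 (ler0n _ N) (ltW a0)) (sqr_ge0 N1).
have omV K : \sum_(i < K) om i <= V.
  rewrite -lee_fin -sumEFin.
  under eq_bigr do rewrite omE.
  rewrite -integral_sum//; under eq_integral do rewrite sumEFin.
  have -> : V%:E = (\int[P]_w V%:E)%E.
    by rewrite integral_cst//= [X in (_ * X)%E]probability_setT mule1.
  apply: ge0_le_integral => //.
  - by move=> w _; rewrite lee_fin sumr_ge0// => i _; exact: sqr_ge0.
  - apply/measurable_EFinP; apply: measurable_sum => i; apply: measurable_funX.
    exact: measurableT_comp.
  - by move=> w _; rewrite lee_fin; exact: (phitilde_sqr_sum iphi phisupp a0 law_pos).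
have VN : V <= N%:R * (2 ^+ j * v).
  by apply: coefficient_energy_total => //; [exact: sqr_ge0|exact: pi_gt0].
have M_gt0 : 0 < M by rewrite divr_gt0// sqrtr_gt0.
have [la [t [la0 lau t1 lb]]] := cosh_sum_optimum M_gt0 v_gt0 n1 j1 V0 VN.
have omE' i m : (\int[P]_w (B (zenum i) (Y m w) ^+ 2)%:E <= (om i)%:E)%E.
  rewrite omE (@ge0_integral_same_law _ _ _ _ _ _ (mY m) (mY m0) _ (fun y => B (zenum i) y ^+ 2))//.
  - by move=> A mA; rewrite (lawY m)// (lawY m0).
  - by apply: (@measurable_funX _ mT); exact: mB.
  - by move=> y; exact: sqr_ge0.
have h := rademacher_sup_expectation hr (h := fun i => B (zenum i))
  (fun i => mB (zenum i)) (fun i => BM (zenum i)) omE' omv omV la0 lau t1.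
have c0 : 0 <= n%:R^-1 * (q * C) by rewrite !mulr_ge0 ?invr_ge0 ?ler0n ?(ltW q0) ?(ltW C0).
apply: (@le_trans _ _ (\int[P]_w ((n%:R^-1 * (q * C))%:E * S w))%E).
  apply: ge0_le_integral => //.
  - by move=> w _; have [t' t'0 ->] := rademacher_sup_real w.
  - exact: measurable_rademacher_process_sup.
  - by apply: emeasurable_funM => //; exact: mS.
rewrite ge0_integralZl//; last first.
  by move=> w _; apply: le_trans (ereal_sup_ubound _); last by exists 0%N.
rewrite [leRHS]EFinM lee_wpmul2l ?lee_fin//.
by apply: le_trans h _; rewrite lee_fin.
Qed.

Lemma mean_sigmaR_rate (N : nat) z : a <= N%:R * pi -> 0 < z -> (1 <= j)%N ->
  (2%:E * \int[P]_w sigmaR phi nu j Y r f a z w <=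
   (width_constant phi a G z N%:R * l^-1 *
     (Num.sqrt (q * j%:R / n%:R) + q * j%:R / n%:R))%:E)%E.
Proof.
move=> aN z0 j1.
have ln20 : 0 < ln 2 :> R by apply: ln_gt0; rewrite ltr1n.
have z'0 : 0 <= z + ln 2 by rewrite addr_ge0// ltW.
have j1R : 1 <= j%:R :> R by rewrite ler1n.
have D10 : 0 <= D1 phi a.
  by rewrite /D1 wavelet_norm1 !mulr_ge0 ?sqrtr_ge0 ?norm1_ge0 ?(ltW C0).
have D20 : 0 <= D2 phi a by rewrite /D2 !mulr_ge0 ?sqrtr_ge0 ?(ltW C0).
pose rate : R := q * j%:R / n%:R.
have rate0 : 0 <= rate by rewrite divr_ge0 ?mulr_ge0 ?(ltW q0).
have le_rate (c : R) : 0 <= c -> q * c / n%:R <= c * rate.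
  move=> c0; rewrite /rate !mulrA (mulrC c q) ler_wpM2r ?invr_ge0//.
  by rewrite ler_peMr// mulr_ge0 ?(ltW q0).
pose c1 := D1 phi a / l * Num.sqrt (q * G * (z + ln 2) / n%:R).
pose c2 := D2 phi a / l * (q * (z + ln 2) / n%:R).
have c10 : 0 <= c1 by rewrite mulr_ge0 ?sqrtr_ge0// divr_ge0// ltW.
have c20 : 0 <= c2.
  by rewrite mulr_ge0 ?divr_ge0 ?(mulr_ge0 (ltW q0) z'0) ?(ltW l0).
have rsint : (\int[P]_w sigmaR phi nu j Y r f a z w =
    6%:E * \int[P]_w rademacher_sup phi nu j Y r w + (c1 + c2)%:E)%E.
  rewrite -ge0_integralZl//; last 2 first.
  - exact: measurable_rademacher_process_sup.
  - by move=> w _; have [t' t'0 ->] := rademacher_sup_real w.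
  have -> : (c1 + c2)%:E = (\int[P]_w (c1 + c2)%:E)%E.
    by rewrite integral_cst//= [X in (_ * X)%E]probability_setT mule1.
  rewrite -ge0_integralD//.
  - by apply: eq_integral => w _; rewrite [(c1 + c2)%:E]EFinD [RHS]addeA.
  - by move=> w _; have [t' t'0 ->] := rademacher_sup_real w; rewrite lee_fin mulr_ge0.
  - by apply: emeasurable_funM => //; exact: measurable_rademacher_process_sup.
  - by move=> w _; rewrite lee_fin addr_ge0.
rewrite rsint; set A := n%:R^-1 * (q * C) * ((5 + 2 * N%:R) *
     (Num.sqrt (n%:R * v * j%:R) + 4 / 3 * M * j%:R)).
apply: (@le_trans _ _ (2 * (6 * A + (c1 + c2)))%:E).
  rewrite EFinM lee_wpmul2l// [leRHS]EFinD leeD2r// EFinM lee_wpmul2l//.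
  exact: rademacher_sup_mean.
rewrite lee_fin; apply: width_rate => //.
- exact: ltW.
- rewrite /A rademacher_term_rate ?(ltW kap0) ?(ltW b0)//.
- rewrite ler_wpM2l ?divr_ge0 ?(ltW l0)//.
  rewrite -sqrtrM ?(mulr_ge0 G0 z'0)// ler_sqrt; last first.
    exact: mulr_ge0 (mulr_ge0 G0 z'0) rate0.
  by rewrite -(mulrA q); apply: le_rate; exact: mulr_ge0 G0 z'0.
- by rewrite ler_wpM2l ?divr_ge0 ?(ltW l0)//; exact: le_rate.
Qed.

End Sample.
End Kernel.

Theorem proposition3 (R : realType) (phi psi : R -> R) (a' a : R)
    (hw : wavelet_condition phi psi a' a) :
  (forall (d : measure_display) (T : measurableType d) (P : probability T R)
      (f : R -> R) (nu : probability (measurableTypeR R) R)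
      (X e : {RV P >-> R}) (n : nat) (Y rad : 'I_n -> {RV P >-> R})
      (j : nat) (z : R),
    deconvolution_model f nu X e ->
    iid_copies (X \+ e) Y ->
    rademacher_multipliers Y rad ->
    (forall t, t \in `[- (2 ^+ j * a), 2 ^+ j * a] ->
       0 < cabs (fourier_law nu t)) ->
    (1 <= n)%N -> 0 < z ->
    (P [set w | sigmaR phi nu j Y rad f a z w
                <= sup_norm (fun x => (estimator phi nu j Y x w
                                       - mean_estimator phi nu j Y x)%R)]
     <= (expR (- z))%:E)%E) /\
  (forall (G z : R), 0 < z ->
    exists C : R,
    forall (d : measure_display) (T : measurableType d) (P : probability T R)
      (f : R -> R) (nu : probability (measurableTypeR R) R)
      (X e : {RV P >-> R}) (n : nat) (Y rad : 'I_n -> {RV P >-> R})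
      (j : nat),
    deconvolution_model f nu X e ->
    iid_copies (X \+ e) Y ->
    rademacher_multipliers Y rad ->
    (forall t, t \in `[- (2 ^+ j * a), 2 ^+ j * a] ->
       0 < cabs (fourier_law nu t)) ->
    linfty_norm (convolution nu f) = G ->
    (1 <= n)%N -> (1 <= j)%N ->
    (\int[P]_w diameter (confidence_band phi nu j Y rad f a z w)
       = 2%:E * \int[P]_w sigmaR phi nu j Y rad f a z w)%E /\
    (2%:E * \int[P]_w sigmaR phi nu j Y rad f a z w
       <= (C * (delta nu j a)^-1 *
           (Num.sqrt (2 ^+ j * j%:R / n%:R) + 2 ^+ j * j%:R / n%:R))%:E)%E).
Proof.
split=> [d T P f nu X e n Y r j z hm hY hr law_pos n1 z0|G z z0].
  exact: (deviation_band hw law_pos hm hY hr n1 z0).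
exists (width_constant phi a G z (Num.truncn (a / pi)).+1%:R).
move=> d T P f nu X e n Y r j hm hY hr law_pos <- n1 j1; split.
  exact: (mean_diameter hw law_pos f r hY n1 z0).
apply: (mean_sigmaR_rate hw law_pos hm hY hr n1 _ z0 j1).
by rewrite -ler_pdivrMr ?pi_gt0// ltW// truncnS_gt.
Qed.
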